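(* Let $d\ge 1$. For all sufficiently small $\epsilon>0$ (depending on $d$), the following holds: if $x\in A\subset\mathbb{Z}^d$ and $|A|=n$, then $$e_x(A)\le e_o(B_n)\,(1+O(n^{-\epsilon})),$$ where the implied constant depends only on $d$ and $\epsilon$ (not on $n$, $A$ or $x$).
   Context: For a finite set $A\subset\mathbb{Z}^d$ and $x\in A$, $e_x(A)$ denotes the expected time for simple random walk on $\mathbb{Z}^d$ started at $x$ to first leave $A$. $|A|$ is the cardinality of $A$, $o$ is the origin of $\mathbb{Z}^d$, $\|\cdot\|$ is the Euclidean norm, and $\omega_d$ is the volume of the unit ball in $\mathbb{R}^d$. $B_n$ is the lattice ball of radius $(n/\omega_d)^{1/d}$: $B_n=\{y\in\mathbb{Z}^d : \omega_d\|y\|^d<n\}$. *)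

(* Defs.v *)
From HB Require Import structures.
From mathcomp Require Import all_boot all_order all_algebra finmap.
From mathcomp Require Import all_classical all_reals all_analysis.

Set Implicit Arguments.
Unset Strict Implicit.
Unset Printing Implicit Defensive.

Import Order.TTheory GRing.Theory Num.Theory numFieldNormedType.Exports.
Local Open Scope classical_set_scope.
Local Open Scope ring_scope.

Section Volume.
Context {R : realType}.

Definition enorm (d : nat) (v : 'rV[R]_d) : R :=
  Num.sqrt (\sum_(i < d) v ord0 i ^+ 2).

(* d-dimensional Lebesgue measure as the d-fold product of lebesgue_measure,
   each step being the defining formula of the product measure (the integral of
   the measures of the sections). It is the Lebesgue measure on Borel sets; no
   claim is made on non-measurable sets. *)
Fixpoint lebesgue_volume (d : nat) : set 'rV[R]_d -> \bar R :=
  if d is d'.+1 then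
    fun A => (\int[lebesgue_measure]_(t in [set: R])
      lebesgue_volume [set v : 'rV[R]_d' | A (row_mx (const_mx t : 'rV_1) v)])%E
  else fun A => (\1_A 0)%:E.

Definition omega (d : nat) : R :=
  fine (lebesgue_volume [set v : 'rV[R]_d | enorm v <= 1]).

Definition lattice_ball (d n : nat) : set 'rV[int]_d :=
  [set y | omega d * enorm (map_mx intr y) ^+ d < n%:R].

End Volume.
Arguments omega R d : clear implicits.
Arguments lattice_ball R d n : clear implicits.

Section SimpleRandomWalk.
Context {R : realType} {disp : measure_display} {T : measurableType disp}.
Variables (P : probability T R) (d : nat).

Definition unit_step (v : 'rV[int]_d) : bool :=
  [exists i, (v == delta_mx ord0 i) || (v == - delta_mx ord0 i)].

Definition independent_steps (xi : nat -> T -> 'rV[int]_d) : Prop :=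
  forall (J : {fset nat}) (V : nat -> set 'rV[int]_d),
    P (\bigcap_(k in [set` J]) (xi k @^-1` V k)) =
    (\prod_(k <- J) P (xi k @^-1` V k))%E.

(* Z^d carries the discrete sigma-algebra; as it is countable, measurability of
   the fibres is measurability of the step. *)
Definition simple_steps (xi : nat -> T -> 'rV[int]_d) : Prop :=
  [/\ forall k v, measurable (xi k @^-1` [set v]),
      forall k v, P (xi k @^-1` [set v]) =
        (if unit_step v then (2 * d)%:R^-1 else 0)%:E
    & independent_steps xi].

Definition walk (xi : nat -> T -> 'rV[int]_d) (x : 'rV[int]_d) (k : nat)
    (w : T) : 'rV[int]_d :=
  x + \sum_(i < k) xi i w.

(* +oo on the event that the walk never leaves A *)
Definition exit_time (xi : nat -> T -> 'rV[int]_d) (x : 'rV[int]_d)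
    (A : set 'rV[int]_d) (w : T) : \bar R :=
  ereal_inf [set (k%:R)%:E | k in [set k : nat | ~ A (walk xi x k w)]].

Definition expected_exit_time (xi : nat -> T -> 'rV[int]_d) (x : 'rV[int]_d)
    (A : set 'rV[int]_d) : \bar R :=
  (\int[P]_w exit_time xi x A w)%E.

End SimpleRandomWalk.

(* Main.v *)
Require Import Defs.
From HB Require Import structures.
From mathcomp Require Import all_boot all_order all_algebra finmap.
From mathcomp Require Import all_classical all_reals all_analysis.
From mathcomp Require Import measurable_realfun.
From mathcomp Require Import ring lra zify.

Set Implicit Arguments.
Unset Strict Implicit.
Unset Printing Implicit Defensive.

Import Order.TTheory GRing.Theory Num.Theory numFieldNormedType.Exports.
Local Open Scope classical_set_scope.
Local Open Scope ring_scope.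

(** Write r = n^(1/d) and K = omega_d^(1/d). Both exit times are compared with
    (r/K)^2.

    The lower bound on e_o(B_n) has no error term: the walk leaves B_n at a point y with
    |y|^2 >= (r/K)^2, and |S_k|^2 - k is a martingale
    ([expected_exit_time_ge_sqr]).

    For the upper bound, the truncated exit times from A are functions u that
    are nonnegative, vanish off A and whose average over the neighbours falls
    below u by at most 1 on A. All such subsolutions are bounded by
    (r/K)^2 (1 + O(r^(-1/(d+6)))) ([torsion_sharp]). If u is a subsolution on A,
    then (u - delta)_+ is one on {u > delta}, so the point is to show that the
    set {u > delta} has a radius smaller than r by almost K^2 delta / (2 r), which
    is the loss for the parabola (r^2 - (K |y|)^2) / K^2. With delta = r^2/s this
    is [sharp_step], with a relative error O(1/s) in the loss;
    [radius_recursion] sums up the losses, and s is taken to be a small power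
    of r.

    The isoperimetric argument behind [sharp_step] replaces level surfaces by
    neighbourhoods of macroscopic size. Let v be u smoothed by averaging over
    segments of length about r/s^3, and let w be the maximum of v over lattice
    balls of radius s. Then {w > t} is the sum of {v > t} and a lattice ball, so a
    discrete Brunn-Minkowski inequality ([brunn_minkowski]) bounds its
    cardinal below by that of {v > t} plus about d K s r^(d-1); integrating over a
    band of levels t by [layer_cake] gives a lower bound for the sum over the band
    of w - v ([layers_grow]). Conversely, w - v is at most s |grad v| up to a
    Taylor remainder, which is small because averaging makes the second
    differences of v small in l2 norm. The sum of |grad v|^2 over the band is
    controlled by testing the equation against the truncation of v, and
    2 s |grad v| <= s (1/tau + tau |grad v|^2) with the optimal tau turns this into
    a lower bound for the number of points in the band ([band_inequality]).
    The remainders are estimated with the total energy of u, which is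
    of the right order thanks to a bound u <= C r^2 with a non-optimal constant
    ([torsion_crude]); that bound is proved by the same recursion with the
    isoperimetric inequality alone.

    Sums by parts and translations are carried out on a torus (Z/N)^d that is
    large enough to contain a copy of A and its neighbourhoods. Finally the
    probability of staying in A for k steps satisfies the first-step recursion
    ([prob_stays]), and the expected exit time is the sum of these
    probabilities over k ([expected_exit_time_series]). *)

(** * Convexity and integration over levels *)

Section Elementary.
Context {R : realType}.
Implicit Types (x t a b m : R).

(** Convexity of the power function. In the induction, multiplying by x produces
    the error term (n + 1) t^n (x - t)^2. *)
Lemma exprS_tangent n x t : 0 <= x -> 0 <= t ->
  t ^+ n.+1 + n.+1%:R * t ^+ n * (x - t) <= x ^+ n.+1.
Proof.
move=> x0 t0; elim: n => [|n IHn]; first by rewrite !expr1 expr0; lra.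
have : x * (t ^+ n.+1 + n.+1%:R * t ^+ n * (x - t)) <= x * x ^+ n.+1.
  exact: ler_wpM2l.
rewrite -exprS; apply: le_trans; rewrite -subr_ge0.
have -> : x * (t ^+ n.+1 + n.+1%:R * t ^+ n * (x - t)) -
    (t ^+ n.+2 + n.+2%:R * t ^+ n.+1 * (x - t)) =
    n.+1%:R * t ^+ n * (x - t) ^+ 2.
  by rewrite !exprS expr0 !mulrS; ring.
by rewrite mulr_ge0 ?sqr_ge0 // mulr_ge0 ?exprn_ge0.
Qed.

(** Radon's inequality for two terms: the power d + 1 at p/P and q/Q lies above its
    tangent at (p + q)/(P + Q), and the linear terms cancel with weights P, Q. *)
Lemma radon2 d (p q P Q : R) : 0 <= p -> 0 <= q -> 0 < P -> 0 < Q ->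
  (p + q) ^+ d.+1 <=
  (P + Q) ^+ d * (p ^+ d.+1 / P ^+ d + q ^+ d.+1 / Q ^+ d).
Proof.
move=> p0 q0 P0 Q0; set t := (p + q) / (P + Q).
have PQ0 : 0 < P + Q by rewrite addr_gt0.
have t0 : 0 <= t by rewrite divr_ge0 ?addr_ge0 // ltW.
have weighted (a A : R) : 0 <= a -> 0 < A ->
    A * (t ^+ d.+1 + d.+1%:R * t ^+ d * (a / A - t)) <= a ^+ d.+1 / A ^+ d.
  move=> a0 A0.
  have -> : a ^+ d.+1 / A ^+ d = A * (a / A) ^+ d.+1.
    by rewrite expr_div_n (exprS A d); field; rewrite expf_neq0 ?gt_eqF.
  rewrite ler_pM2l //; apply: exprS_tangent => //.
  by rewrite divr_ge0 // ltW.
have /(ler_wpM2l (exprn_ge0 d (ltW PQ0))) := lerD (weighted _ _ p0 P0) (weighted _ _ q0 Q0).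
apply: le_trans.
have -> : P * (t ^+ d.+1 + d.+1%:R * t ^+ d * (p / P - t)) +
  Q * (t ^+ d.+1 + d.+1%:R * t ^+ d * (q / Q - t)) =
  (P + Q) * t ^+ d.+1 + d.+1%:R * t ^+ d * ((p + q) - (P + Q) * t).
  by field; rewrite !gt_eqF.
have -> : (P + Q) * t = p + q by rewrite /t mulrC divfK // gt_eqF.
by rewrite subrr mulr0 addr0 mulrA -exprSr -exprMn /t mulrC divfK ?gt_eqF.
Qed.

Lemma expr_ge_linear d (x y : R) : 0 <= x -> 0 <= y ->
  x ^+ d + d%:R * x ^+ d.-1 * y <= (x + y) ^+ d.
Proof.
case: d => [|d] x0 y0; first by rewrite !expr0 !mul0r addr0.
have := @exprS_tangent d (x + y) x (addr_ge0 x0 y0) x0.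
by rewrite [x + y - x]addrC addKr.
Qed.

Lemma bernoulli_le n (x : R) : 0 <= x <= 1 -> 1 - n%:R * x <= (1 - x) ^+ n.
Proof.
case: n => [|n] /andP[x0 x1]; first by rewrite mul0r subr0 expr0.
have := @exprS_tangent n (1 - x) 1.
rewrite !expr1n mulr1 => /(_ _ ler01) /[!subr_ge0] /(_ x1).
by apply: le_trans; lra.
Qed.

(** As a function of x this is the length of the part of the band [a, b] below x;
    it is what integrating the indicators of {t < x} over the levels produces. *)
Definition band a b x : R := Num.min b (Num.max a x) - a.

Lemma band_ge0 a b x : a <= b -> 0 <= band a b x.
Proof.
by move=> ab; rewrite /band subr_ge0 le_min ab le_max lexx.
Qed.

Lemma band_le a b x : band a b x <= b - a.
Proof. by rewrite /band lerB // ge_min lexx. Qed.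

Lemma band_low a b x : a <= b -> x <= a -> band a b x = 0.
Proof. by move=> ab xa; rewrite /band max_l // min_r // subrr. Qed.

Lemma band_high a b x : a <= b -> b <= x -> band a b x = b - a.
Proof. by move=> ab bx; rewrite /band max_r ?(le_trans ab) // min_l. Qed.

Lemma band_mid a b x : a <= x -> x <= b -> band a b x = x - a.
Proof. by move=> ab bx; rewrite /band max_r // min_r. Qed.

(** h times this number of grid levels below x is a Riemann sum for the band. *)
Let count_below a h (k : nat) x : R := \sum_(l < k) (a + l%:R * h < x)%R%:R.

Lemma band_count_le a h k x : 0 <= h ->
  band a (a + k%:R * h) x <= h * count_below a h k x.
Proof.
move=> h0; elim: k => [|k IHk].
  by rewrite mul0r addr0 /count_below big_ord0 mulr0 (le_trans (band_le _ _ _)) ?subrr.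
rewrite /count_below big_ord_recr /= -/(count_below a h k x) mulrDr.
have kh : 0 <= k%:R * h by rewrite mulr_ge0.
case: ltP => [ltx|lex].
  rewrite mulr1; apply: le_trans (band_le _ _ _) _.
  move: IHk; rewrite band_high ?lerDl //; last exact: ltW.
  by rewrite -natr1 mulrDl mul1r; lra.
rewrite mulr0 addr0; apply: le_trans IHk; rewrite /band lerD2r.
rewrite le_min ge_min; apply/andP; split; last by rewrite ge_min lexx orbT.
by rewrite ge_max lex lerDl kh orbT.
Qed.

Lemma count_le_band a h k x : 0 <= h ->
  h * count_below a h k x <= band a (a + k%:R * h) x + h.
Proof.
move=> h0; case: k => [|k].
  by rewrite /count_below big_ord0 mulr0 addr_ge0 // band_ge0 // mul0r addr0.
suff H : h * count_below a h k.+1 x <= band a (a + k%:R * h) x + h.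
  apply: le_trans H _; rewrite lerD2r /band lerD2r le_min ge_min.
  rewrite -natr1 mulrDl mul1r addrA lerDl h0 /=.
  by rewrite ge_min lexx orbT.
elim: k => [|k IHk].
  rewrite /count_below big_ord1 /= !mul0r !addr0.
  have -> : band a a x = 0.
    by apply/eqP; rewrite eq_le band_ge0 // (le_trans (band_le _ _ _)) ?subrr.
  by rewrite add0r ler_piMr // lern1; case: (_ < _).
rewrite /count_below big_ord_recr /= -/(count_below a h k.+1 x) mulrDr.
have kh j : 0 <= j%:R * h by rewrite mulr_ge0.
case: ltP => [ltx|lex].
  rewrite mulr1 lerD2r band_high ?lerDl //; last exact: ltW.
  rewrite addrC addKr mulrC ler_wpM2r //.
  apply: le_trans (_ : \sum_(l < k.+1) 1 <= _).
    by apply: ler_sum => l _; case: (_ < _).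
  by rewrite sumr_const card_ord.
rewrite mulr0 addr0; apply: le_trans IHk _; rewrite !lerD2r.
rewrite le_min ge_min -natr1 mulrDl mul1r addrA lerDl h0 /=.
by rewrite ge_min lexx orbT.
Qed.

(** Layer cake: integrating the hypothesis over the levels t of the band gives
    the conclusion. The integral is replaced by Riemann sums over a grid, whose
    error vanishes as the grid is refined. *)
Lemma layer_cake (I J : finType) (x : I -> R) (z : J -> R) a b m : a < b ->
  (forall t, a <= t -> t < b ->
    m + #|[pred i | t < x i]|%:R <= #|[pred j | t < z j]|%:R) ->
  m * (b - a) + \sum_i band a b (x i) <= \sum_j band a b (z j).
Proof.
move=> ab H; rewrite -subr_ge0 leNgt; apply/negP; set D := _ - _ => lt0.
have [k k0 Hk] : exists2 k : nat, (0 < k)%N & (b - a) * #|J|%:R < k%:R * - D.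
  exists (Num.trunc ((b - a) * #|J|%:R / - D)).+1 => //.
  by rewrite -ltr_pdivrMr ?oppr_gt0 // truncnS_gt.
have k0' : 0 < k%:R :> R by rewrite ltr0n.
set h := (b - a) / k%:R.
have h0 : 0 <= h by rewrite divr_ge0 // ?ler0n // subr_ge0 ltW.
have kh : k%:R * h = b - a by rewrite /h mulrC divfK // gt_eqF.
have bE : b = a + k%:R * h by rewrite kh addrC subrK.
have countE (K : finType) (y : K -> R) :
    \sum_i count_below a h k (y i) =
    \sum_(l < k) #|[pred i | a + l%:R * h < y i]|%:R.
  rewrite exchange_big /=; apply: eq_bigr => l _.
  rewrite -sum1_card natr_sum [RHS]big_mkcond; apply: eq_bigr => i _.
  by rewrite inE; case: (_ < _).
have lower : \sum_i band a b (x i) <= h * \sum_i count_below a h k (x i).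
  by rewrite mulr_sumr; apply: ler_sum => i _; rewrite bE band_count_le.
have upper : h * \sum_j count_below a h k (z j) <= \sum_j band a b (z j) + h * #|J|%:R.
  have -> : h * #|J|%:R = \sum_(j : J) h by rewrite sumr_const mulr_natr.
  rewrite mulr_sumr -big_split /=; apply: ler_sum => j _.
  by rewrite [X in band a X]bE count_le_band.
have mid : k%:R * m + \sum_i count_below a h k (x i) <= \sum_j count_below a h k (z j).
  rewrite !countE.
  have -> : k%:R * m = \sum_(l < k) m by rewrite sumr_const card_ord mulr_natl.
  rewrite -big_split /=; apply: ler_sum => l _; apply: H.
    by rewrite lerDl mulr_ge0.
  rewrite bE ltrD2l ltr_pM2r ?ltr_nat //.
  by rewrite /h divr_gt0 // subr_gt0.
have {}mid := ler_wpM2l h0 mid.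
have hJ : h * #|J|%:R < - D.
  by rewrite /h mulrAC ltr_pdivrMr // [- D * _]mulrC.
have hkm : h * (k%:R * m) = m * (b - a) by rewrite mulrA [h * _]mulrC kh mulrC.
move: mid; rewrite mulrDr hkm /D in hJ *; lra.
Qed.

End Elementary.

(** * Brunn-Minkowski inequality on the lattice *)

Section BrunnMinkowski.
Context {R : realType}.
Local Open Scope fset_scope.
Local Open Scope ring_scope.

Lemma fset_int_max (I : {fset int}) : I != fset0 ->
  exists2 M, M \in I & forall i, i \in I -> i <= M.
Proof.
case/fset0Pn => i0 i0I.
case: (@Order.TotalTheory.arg_maxP _ _ I [` i0I] xpredT (fun i => val i)) => // M _ HM.
exists (val M) => [|i iI]; first exact: valP.
exact: (HM [` iI]).
Qed.

(** With M the largest element of I and m the smallest of J, the points i + m and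
    the points M + j + 1 form two disjoint families in K. *)
Lemma line_sumset (I J K : {fset int}) : I != fset0 -> J != fset0 ->
  (forall i j, i \in I -> j \in J -> (i + j \in K) && (i + j + 1 \in K)) ->
  (#|` I| + #|` J| <= #|` K|)%N.
Proof.
move=> /fset_int_max[M MI HM] J0 HK.
have [m mJ Hm] : exists2 m, m \in J & forall j, j \in J -> m <= j.
  have : [fset - j | j in J] != fset0.
    by case/fset0Pn: J0 => j jJ; apply/fset0Pn; exists (- j); apply/imfsetP; exists j.
  case/fset_int_max => _ /imfsetP[m /= mJ ->] Hm; exists m => // j jJ.
  by rewrite -lerN2 Hm //; apply/imfsetP; exists j.
have -> : #|` I| = #|` [fset i + m | i in I]|.
  by rewrite card_imfset //= => i j /addIr.
have -> : #|` J| = #|` [fset M + j + 1 | j in J]|.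
  by rewrite card_imfset //= => i j /addIr /addrI.
rewrite -cardfsUI -[leqRHS]addn0; apply: leq_add.
  apply: fsubset_leq_card; apply/fsubsetP => t /fsetUP[] /imfsetP[i /= iI ->].
    by case/andP: (HK _ _ iI mJ).
  by case/andP: (HK _ _ MI iI).
rewrite leqn0 cardfs_eq0 -fsubset0; apply/fsubsetP => t /fsetIP[].
case/imfsetP => i /= iI -> /imfsetP[j /= jJ] e.
by have := HM _ iI; have := Hm _ jJ; lia.
Qed.

Definition cons_row d (t : int) (v : 'rV[int]_d) : 'rV[int]_d.+1 :=
  row_mx (const_mx t : 'rV_1) v.

Definition slice d (X : {fset 'rV[int]_d.+1}) (t : int) : {fset 'rV[int]_d} :=
  [fset rsubmx (x : 'rV_(1 + d))
    | x in [fset x : 'rV[int]_d.+1 in X | x ord0 ord0 == t]].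

Definition heads d (X : {fset 'rV[int]_d.+1}) : {fset int} :=
  [fset x ord0 ord0 | x : 'rV[int]_d.+1 in X].

Lemma cons_row_head d t (v : 'rV[int]_d) : cons_row t v ord0 ord0 = t.
Proof.
by rewrite /cons_row mxE; case: (@splitP 1 d ord0) => // j _; rewrite mxE.
Qed.

Lemma row_splitE d (x : 'rV[int]_d.+1) :
  x = cons_row (x ord0 ord0) (rsubmx (x : 'rV_(1 + d))).
Proof.
have E : const_mx (x ord0 ord0) = lsubmx (x : 'rV_(1 + d)).
  by apply/rowP => i; rewrite !mxE; congr (x _ _); apply: val_inj; rewrite /= ord1.
by rewrite /cons_row E hsubmxK.
Qed.

Lemma cons_rowD d s t (v w : 'rV[int]_d) :
  cons_row s v + cons_row t w = cons_row (s + t) (v + w).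
Proof. by apply/rowP => i; rewrite !mxE; case: (@fintype.split 1 d i) => j; rewrite !mxE. Qed.

Lemma in_slice d (X : {fset 'rV[int]_d.+1}) t v : (v \in slice X t) = (cons_row t v \in X).
Proof.
apply/imfsetP/idP => [[x /=]|vX].
  by rewrite !inE => /andP[xX /eqP <-] ->; rewrite -row_splitE.
exists (cons_row t v); last by rewrite /cons_row row_mxKr.
by rewrite !inE vX cons_row_head eqxx.
Qed.

Lemma slice_neq0 d (X : {fset 'rV[int]_d.+1}) t : (slice X t != fset0) = (t \in heads X).
Proof.
apply/fset0Pn/imfsetP => [[v]|[x /= xX ->]].
  by rewrite in_slice => vX; exists (cons_row t v); rewrite ?cons_row_head.
by exists (rsubmx (x : 'rV_(1 + d))); rewrite in_slice -row_splitE.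
Qed.

Lemma card_slices d (X : {fset 'rV[int]_d.+1}) :
  #|` X| = (\sum_(t : heads X) #|` slice X (val t)|)%N.
Proof.
rewrite -(big_seq_fsetE _ (heads X) xpredT (fun t => #|` slice X t|)) /=.
rewrite card_fset_sum1 (partition_big_imfset _ (fun x : 'rV[int]_d.+1 => x ord0 ord0)).
apply: eq_bigr => t _; rewrite big_fset_condE -card_fset_sum1 [RHS]card_in_imfset //.
move=> x y; rewrite !inE => /andP[_ /eqP xt] /andP[_ /eqP yt] xy.
by rewrite [x]row_splitE [y]row_splitE xt yt; congr cons_row.
Qed.

Definition cube_corner d (e : 'rV[int]_d) : bool :=
  [forall i, (e ord0 i == 0) || (e ord0 i == 1)].

Lemma cube_corner_cons d t (e : 'rV[int]_d) : (t == 0) || (t == 1) ->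
  cube_corner e -> cube_corner (cons_row t e).
Proof.
move=> t01 /forallP e01; apply/forallP => i.
by rewrite /cons_row mxE; case: (@fintype.split 1 d i) => j //; rewrite mxE.
Qed.

Definition nroot (d : nat) (x : R) : R := x `^ d%:R^-1.

Lemma nrootK d x : 0 <= x -> nroot d.+1 x ^+ d.+1 = x.
Proof.
by move=> x0; rewrite /nroot -powR_mulrn ?powR_ge0 // -powRrM mulVf ?pnatr_eq0 // powRr1.
Qed.

Lemma nroot_ge0 d x : 0 <= nroot d x.
Proof. exact: powR_ge0. Qed.

Lemma nroot_gt0 d x : 0 < x -> 0 < nroot d x.
Proof. exact: powR_gt0. Qed.

Lemma nroot_expr_le d n : (0 < n)%N -> nroot d n%:R ^+ d <= n%:R.
Proof. by case: d => [|d] n0; [rewrite expr0 ler1n | rewrite nrootK]. Qed.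

Lemma nroot_add_scaled d (th u v u' v' : R) : 0 <= th -> th < 1 ->
  0 <= u -> 0 <= v -> th * u < u' -> th * v < v' ->
  th * (nroot d u + nroot d v) ^+ d < (nroot d u' + nroot d v') ^+ d.
Proof.
case: d => [|d] th0 th1 u0 v0 hu hv; first by rewrite !expr0 mulr1.
have grow x y : 0 <= x -> th * x < y -> nroot d.+1 th * nroot d.+1 x < nroot d.+1 y.
  move=> x0 xy; have y0 : 0 <= y by rewrite (le_trans _ (ltW xy)) // mulr_ge0.
  rewrite -(@ltr_pXn2r _ d.+1) ?nnegrE ?mulr_ge0 ?nroot_ge0 //.
  by rewrite exprMn !nrootK.
rewrite -{1}[th](nrootK d) // -exprMn ltr_pXn2r ?nnegrE ?mulr_ge0 ?addr_ge0 ?nroot_ge0 //.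
by rewrite mulrDr ltrD // grow.
Qed.

Lemma card_le_nroot_expr d (S : {fset 'rV[int]_d}) :
  #|` S|%:R <= nroot d #|` S|%:R ^+ d.
Proof.
case: d S => [|d] S; last by rewrite nrootK.
rewrite expr0 lern1; apply: (@leq_trans #|` [fset (0 : 'rV[int]_0)]|); last by rewrite cardfs1.
by apply/fsubset_leq_card/fsubsetP => v _; rewrite inE thinmx0.
Qed.

Lemma card_fset_pred (T : choiceType) (F : {fset T}) (S : pred T) :
  #|[pred i : F | S (val i)]| = #|` [fset t in F | S t]|.
Proof.
by rewrite card_fset_sum1 -big_fset_condE big_seq_fsetE /= -sum1_card.
Qed.

Lemma card_sum_pred (I J : finType) (S : pred (I + J)) :
  #|[pred k | S k]| = (#|[pred i | S (inl i)]| + #|[pred j | S (inr j)]|)%N.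
Proof. by rewrite -!sum1_card big_sumType. Qed.

Lemma band01_le (x : R) : 0 <= x -> band 0 1 x <= x.
Proof. by move=> x0; rewrite /band subr0 ge_min max_r // lexx orbT. Qed.

Lemma band01_id (x : R) : 0 <= x <= 1 -> band 0 1 x = x.
Proof. by case/andP=> x0 x1; rewrite band_mid ?subr0. Qed.

(** Brunn-Minkowski on the lattice; the corner cube {0,1}^d accounts for the
    unit cells. The layers of X and Y, normalised by their largest layers, have
    level sets to which the one-dimensional case applies, while the inductive
    hypothesis bounds each layer of Z from below. Integrating over the levels
    reduces the claim to Radon's inequality. The numbers p and q stand for the
    roots of the cardinals, in a form that makes sense for d = 0, where the
    induction starts. *)
Theorem brunn_minkowski d (X Y Z : {fset 'rV[int]_d}) (p q : R) :
  X != fset0 -> Y != fset0 -> 0 <= p -> 0 <= q ->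
  p ^+ d <= #|` X|%:R -> q ^+ d <= #|` Y|%:R ->
  (forall x y e, x \in X -> y \in Y -> cube_corner e -> x + y + e \in Z) ->
  (p + q) ^+ d <= #|` Z|%:R.
Proof.
elim: d X Y Z p q => [|d IHd] X Y Z p q X0 Y0 p0 q0 pX qY XYZ.
  rewrite expr0 ler1n cardfs_gt0; case/fset0Pn: X0 => x xX; case/fset0Pn: Y0 => y yY.
  apply/fset0Pn; exists (x + y + 0); apply: XYZ => //.
  by apply/forallP => i; rewrite mxE eqxx.
have big_layer (W : {fset 'rV[int]_d.+1}) : W != fset0 -> exists2 t, t \in heads W &
    forall s, s \in heads W -> (#|` slice W s| <= #|` slice W t|)%N.
  case/fset0Pn => w wW; have hw : w ord0 ord0 \in heads W by apply/imfsetP; exists w.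
  case: (@arg_maxnP _ [` hw] xpredT (fun t => #|` slice W (val t)|)) => // t _ Ht.
  by exists (val t) => [|s hs]; [exact: valP | exact: (Ht [` hs])].
have [tX tXX maxX] := big_layer X X0; have [tY tYY maxY] := big_layer Y Y0.
pose a t : R := #|` slice X t|%:R; pose b t : R := #|` slice Y t|%:R.
pose c t : R := #|` slice Z t|%:R.
have a0 : 0 < a tX by rewrite ltr0n cardfs_gt0 slice_neq0.
have b0 : 0 < b tY by rewrite ltr0n cardfs_gt0 slice_neq0.
pose P := nroot d (a tX); pose Q := nroot d (b tY).
have P0 : 0 < P by exact: nroot_gt0.
have Q0 : 0 < Q by exact: nroot_gt0.
have C0 : 0 < (P + Q) ^+ d by rewrite exprn_gt0 ?addr_gt0.
have layer i j e : i \in heads X -> j \in heads Y -> (e == 0) || (e == 1) ->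
    (nroot d (a i) + nroot d (b j)) ^+ d <= c (i + j + e).
  rewrite -!slice_neq0 => iX jY e01;
  apply: (IHd (slice X i) (slice Y j)) => //; rewrite ?nroot_ge0 //.
  - by apply: nroot_expr_le; rewrite cardfs_gt0.
  - by apply: nroot_expr_le; rewrite cardfs_gt0.
  move=> x y f; rewrite !in_slice => xX yY f01; rewrite -!cons_rowD.
  by apply: XYZ => //; exact: cube_corner_cons.
have level (th : R) i j : 0 <= th -> th < 1 -> th * a tX < a i -> th * b tY < b j ->
    th * (P + Q) ^+ d < (nroot d (a i) + nroot d (b j)) ^+ d.
  by move=> th0 th1 ha hb; apply: nroot_add_scaled => //; exact: ltW.
have cake : \sum_(k : heads X + heads Y)
      band 0 1 (match k with inl i => a (val i) / a tX | inr j => b (val j) / b tY end) <=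
    \sum_(t : heads Z) band 0 1 (c (val t) / (P + Q) ^+ d).
  rewrite -[leLHS]add0r -[X in X + _](mul0r (1 - 0)).
  apply: layer_cake => // th th0 th1; rewrite add0r ler_nat card_sum_pred /=.
  pose top (W : {fset 'rV[int]_d.+1}) (f : int -> R) m :=
    [fset t : int in heads W | th < f t / m].
  have -> : #|[pred t : heads Z | th < c (val t) / (P + Q) ^+ d]| =
    #|` top Z c ((P + Q) ^+ d)| by rewrite -card_fset_pred.
  have -> : #|[pred i : heads X | th < a (val i) / a tX]| = #|` top X a (a tX)|.
    by rewrite -card_fset_pred.
  have -> : #|[pred i : heads Y | th < b (val i) / b tY]| = #|` top Y b (b tY)|.
    by rewrite -card_fset_pred.
  apply: line_sumset.
  - by apply/fset0Pn; exists tX; rewrite !inE tXX divff ?gt_eqF.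
  - by apply/fset0Pn; exists tY; rewrite !inE tYY divff ?gt_eqF.
  move=> i j; rewrite !inE !ltr_pdivlMr // => /andP[iX ai] /andP[jY bj].
  have up e : (e == 0) || (e == 1) ->
      (i + j + e \in heads Z) && (th * (P + Q) ^+ d < c (i + j + e)).
    move=> e01; have lt := lt_le_trans (level _ _ _ th0 th1 ai bj) (layer _ _ _ iX jY e01).
    rewrite lt andbT -slice_neq0 -cardfs_gt0 -(ltr_nat R).
    by apply: le_lt_trans lt; rewrite mulr_ge0 // ltW.
  by rewrite -[in X in X && _](addr0 (i + j)) !up.
have left_mass : \sum_(k : heads X + heads Y)
      band 0 1 (match k with inl i => a (val i) / a tX | inr j => b (val j) / b tY end) =
    #|` X|%:R / a tX + #|` Y|%:R / b tY.
  rewrite big_sumType /= !card_slices !natr_sum !mulr_suml.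
  congr (_ + _); apply: eq_bigr => t _; rewrite band01_id // divr_ge0 ?ler0n //=.
    by rewrite ler_pdivrMr // mul1r ler_nat maxX // valP.
  by rewrite ler_pdivrMr // mul1r ler_nat maxY // valP.
have right_mass : \sum_(t : heads Z) band 0 1 (c (val t) / (P + Q) ^+ d) <=
    #|` Z|%:R / (P + Q) ^+ d.
  rewrite card_slices natr_sum mulr_suml; apply: ler_sum => t _.
  by apply: band01_le; rewrite divr_ge0 ?ler0n // ltW.
have := le_trans cake right_mass; rewrite left_mass ler_pdivlMr //.
apply: le_trans; apply: le_trans (radon2 d p0 q0 P0 Q0) _.
rewrite mulrC ler_pM2r //.
have dens (W : {fset 'rV[int]_d.+1}) (u : R) t : t \in heads W -> 0 <= u -> u <= #|` W|%:R ->
    u / nroot d #|` slice W t|%:R ^+ d <= #|` W|%:R / #|` slice W t|%:R.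
  rewrite -slice_neq0 -cardfs_gt0 -(ltr0n R) => tW u0 uW.
  have r0 : 0 < nroot d #|` slice W t|%:R ^+ d by rewrite exprn_gt0 // nroot_gt0.
  by rewrite ler_pM ?invr_ge0 ?(ltW r0) // lef_pV2 ?posrE // card_le_nroot_expr.
by rewrite lerD // dens // exprn_ge0.
Qed.

End BrunnMinkowski.

(** * Lattice balls and the volume of the unit ball *)

Section Omega.
Context {R : realType}.

Lemma lebesgue_volume_ge0 d (A : set 'rV[R]_d) : (0 <= lebesgue_volume A)%E.
Proof.
elim: d A => [|d IHd] A /=; first by rewrite lee_fin.
by apply: integral_ge0 => t _; exact: IHd.
Qed.

(** Monotone on all sets, as the integral of a nonnegative function is the supremum
    of the integrals of the simple functions below it. *)
Lemma le_lebesgue_volume d (A B : set 'rV[R]_d) : A `<=` B ->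
  (lebesgue_volume A <= lebesgue_volume B)%E.
Proof.
elim: d A B => [|d IHd] A B AB /=.
  rewrite lee_fin !indicE ler_nat; have [/set_mem /AB/mem_set -> //|] := boolP (0 \in A).
  by case: (_ \in B).
rewrite !ge0_integralTE; try by move=> t; exact: lebesgue_volume_ge0.
apply: le_ereal_sup => _ [h hA <-]; exists h => // t; apply: le_trans (hA t) _.
by apply: IHd => v; exact: AB.
Qed.

(** The union of the cells of side 1/k with lower corner in E/k, which turns
    cardinals into volumes. *)
Definition cells d (k : nat) (E : {fset 'rV[int]_d}) : set 'rV[R]_d :=
  [set v | map_mx (fun t => Num.floor (k%:R * t)) v \in E].

Lemma floor_cell (k : nat) (j : int) : (0 < k)%N ->
  [set t : R | Num.floor (k%:R * t) = j] =
  `[(j%:~R / k%:R : R), ((j + 1)%:~R / k%:R : R)[%classic.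
Proof.
move=> k0; have k0' : 0 < k%:R :> R by rewrite ltr0n.
apply/seteqP; split => t /=; rewrite in_itv /= ler_pdivrMr // ltr_pdivlMr // ![t * _]mulrC.
  by move=> <-; rewrite floor_le_tmp floorD1_gt.
by move/floor_def.
Qed.

Lemma lebesgue_volume_cells d k (E : {fset 'rV[int]_d}) : (0 < k)%N ->
  lebesgue_volume (cells k E) = (#|` E|%:R / k%:R ^+ d)%:E.
Proof.
move=> k0; elim: d E => [|d IHd] E /=.
  rewrite expr0 divr1 indicE; congr (_%:R%:E).
  have -> : (0 \in cells k E) = (#|` E| > 0)%N.
    rewrite cardfs_gt0; apply/idP/fset0Pn => [/set_mem E0|[v vE]].
      by exists (map_mx (fun t => Num.floor (k%:R * t)) (0 : 'rV[R]_0)).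
    by apply/mem_set; rewrite /cells /= (_ : map_mx _ _ = v) // !thinmx0.
  have := card_le_nroot_expr (R := R) E; rewrite expr0 lern1.
  by case: (#|` E|%fset) => [|[|]].
have k0' : 0 < k%:R :> R by rewrite ltr0n.
pose c (j : heads E) : R := #|` slice E (val j)|%:R / k%:R ^+ d.
pose D (j : heads E) : set R := `[((val j)%:~R / k%:R : R), ((val j + 1)%:~R / k%:R : R)[%classic.
have section_volume t :
    lebesgue_volume [set v : 'rV[R]_d | cells k E (row_mx (const_mx t : 'rV_1) v)] =
    (\sum_(j : heads E) ((c j)%:E * (\1_(D j) t)%:E))%E.
  have -> : [set v : 'rV[R]_d | cells k E (row_mx (const_mx t : 'rV_1) v)] =
      cells k (slice E (Num.floor (k%:R * t))).
    have rowE v : map_mx (fun t => Num.floor (k%:R * t))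
        (row_mx (const_mx t : 'rV_1) v : 'rV[R]_d.+1) =
        cons_row (Num.floor (k%:R * t)) (map_mx (fun t => Num.floor (k%:R * t)) v).
      by apply/rowP => i; rewrite !mxE; case: (@fintype.split 1 d i) => j; rewrite !mxE.
    by apply/seteqP; split => v; rewrite /cells /= in_slice rowE.
  rewrite IHd; have [tE|tE] := boolP (Num.floor (k%:R * t) \in heads E).
    rewrite (bigD1 [` tE]%fset) //= big1 => [|j jt]; last first.
      rewrite indicE memNset ?mule0 // /D -floor_cell //= => jE.
      by move/eqP: jt; apply; apply: val_inj.
    by rewrite adde0 indicE mem_set ?mule1 // /D -floor_cell.
  rewrite -slice_neq0 negbK in tE.
  rewrite (eqP tE) cardfs0 mul0r big1 // => j _.
  rewrite indicE memNset ?mule0 // /D -floor_cell //= => jE.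
  by move: tE; rewrite jE; apply/negP; rewrite slice_neq0; exact: (valP j).
under eq_integral do rewrite section_volume.
rewrite ge0_integral_sum //; first last.
- by move=> j t _; rewrite mule_ge0 // lee_fin // divr_ge0 // exprn_ge0.
- move=> j; apply: measurable_funeM; apply/measurable_EFinP.
  by apply: measurable_indic; exact: measurable_itv.
rewrite card_slices natr_sum mulr_suml -sumEFin; apply: eq_bigr => j _.
rewrite ge0_integralZl //; first last.
- by rewrite lee_fin divr_ge0 // exprn_ge0.
- by apply/measurable_EFinP; apply: measurable_indic; exact: measurable_itv.
rewrite integral_indic //; last exact: measurable_itv.
have muD : lebesgue_measure (D j) = (k%:R^-1)%:E.
  rewrite /D lebesgue_measure_itv /= lte_fin ltr_pM2r ?invr_gt0 // ltr_int ltzD1 lexx.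
  by rewrite -EFinB intrD; congr EFin; field; rewrite gt_eqF.
rewrite setIT [X in (_ * X)%E](_ : _ = (k%:R^-1)%:E) //.
by rewrite -EFinM; congr EFin; rewrite /c exprSr invfM mulrA.
Qed.

Lemma enorm_le1 d (v : 'rV[R]_d) : (enorm v <= 1) = (\sum_i v ord0 i ^+ 2 <= 1).
Proof. by rewrite /enorm -{1}sqrtr1 ler_sqrt. Qed.

End Omega.

Section LatticeBall.
Local Open Scope fset_scope.
Local Open Scope ring_scope.

Definition box_point d N (f : {ffun 'I_d -> 'I_(N.*2.+1)}) : 'rV[int]_d :=
  \row_i ((f i)%:Z - N%:Z).

Definition zbox (d N : nat) : {fset 'rV[int]_d} :=
  [fset box_point f | f in {: {ffun 'I_d -> 'I_(N.*2.+1)}}].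

Lemma mem_zbox d N (z : 'rV[int]_d) :
  reflect (forall i, `|z ord0 i| <= N%:Z) (z \in zbox d N).
Proof.
apply: (iffP idP) => [/imfsetP[f /= _ ->] i|Hz]; last apply/imfsetP.
  rewrite mxE ler_norml; case: (f i) => m /= mN. by apply/andP; split; lia.
exists [ffun i => inord (absz (z ord0 i + N%:Z))] => //.
apply/rowP => i; have := Hz i; rewrite ler_norml => /andP[lo hi].
have -> : z 0 i = z ord0 i by [].
by rewrite mxE ffunE; move: (z ord0 i) lo hi => t lo hi; rewrite inordK; lia.
Qed.

Lemma card_zbox d N : (#|` zbox d N| <= N.*2.+1 ^ d)%N.
Proof.
apply: leq_trans (leq_imfset_card _ _ _) _ => /=.
by rewrite -[in leqRHS](card_ord d) -[in leqRHS](card_ord N.*2.+1) -card_ffun cardE.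
Qed.

Definition zball (d s : nat) : {fset 'rV[int]_d} :=
  [fset z in zbox d s | \sum_i z ord0 i ^+ 2 <= s%:Z ^+ 2].

Lemma mem_zball d s (z : 'rV[int]_d) :
  (z \in zball d s) = (\sum_i z ord0 i ^+ 2 <= s%:Z ^+ 2).
Proof.
rewrite !inE /= andb_idl // => zs; apply/mem_zbox => i.
rewrite -(@ler_pXn2r _ 2) ?nnegrE // -normrX ger0_norm ?sqr_ge0 //.
by apply: le_trans zs; rewrite (bigD1 i) //= lerDl sumr_ge0 // => j _; rewrite sqr_ge0.
Qed.

Context {R : realType}.

Let unit_ball d := [set v : 'rV[R]_d | enorm v <= 1].

(** Rounding down the coordinates of k v moves it by at most sqrt d, hence by at
    most d. *)
Lemma unit_ball_sub_cells d k : (0 < k)%N -> (@unit_ball d `<=` cells k (zball d (k + d)))%classic.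
Proof.
move=> k0 v; rewrite /unit_ball /cells /= enorm_le1 mem_zball => v1.
have k0' : 0 < k%:R :> R by rewrite ltr0n.
rewrite -(ler_int R) rmorph_sum /=.
have vi i : `|v ord0 i| <= 1.
  rewrite -(@ler_pXn2r _ 2) ?nnegrE // -normrX ger0_norm ?sqr_ge0 // expr1n.
  by apply: le_trans v1; rewrite (bigD1 i) //= lerDl sumr_ge0 // => j _; rewrite sqr_ge0.
apply: le_trans (_ : \sum_i (k%:R ^+ 2 * v ord0 i ^+ 2 + (2 * k%:R + 1)) <= _).
  apply: ler_sum => i _; rewrite mxE rmorphXn /=.
  have := floor_itv (k%:R * v ord0 i); set f := (Num.floor _)%:~R.
  rewrite intrD -/f => /andP[fl fu].
  have kv : `|k%:R * v ord0 i * (f - k%:R * v ord0 i)| <= k%:R.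
    rewrite !normrM ger0_norm // -mulrA ler_piMr // mulr_ile1 //.
    by rewrite ler_norml; apply/andP; split; lra.
  have th : (f - k%:R * v ord0 i) ^+ 2 <= 1.
    rewrite -subr_ge0 (_ : _ - _ = (1 + (f - k%:R * v ord0 i)) * (1 - (f - k%:R * v ord0 i))).
      by rewrite mulr_ge0 //; lra.
    by ring.
  have := ler_norm (k%:R * v ord0 i * (f - k%:R * v ord0 i)).
  have -> : f ^+ 2 = k%:R ^+ 2 * v ord0 i ^+ 2 +
    2 * (k%:R * v ord0 i * (f - k%:R * v ord0 i)) + (f - k%:R * v ord0 i) ^+ 2 by ring.
  lra.
rewrite big_split /= -mulr_sumr.
have -> : \sum_(i < d) (2 * k%:R + 1) = (2 * k%:R + 1) * d%:R :> R.
  by rewrite sumr_const card_ord [RHS]mulr_natr.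
apply: le_trans (_ : k%:R ^+ 2 * 1 + (2 * k%:R + 1) * d%:R <= _).
  by rewrite lerD2r ler_wpM2l // sqr_ge0.
rewrite rmorphXn /= -pmulrn natrD.
have : d%:R <= d%:R ^+ 2 :> R by rewrite -natrX ler_nat; nia.
nra.
Qed.

Lemma cells0_sub_unit_ball d : (cells d.+1 [fset 0]%fset `<=` @unit_ball d)%classic.
Proof.
move=> v; rewrite /unit_ball /cells /= enorm_le1 inE => /eqP/rowP v0.
have d0 : 0 < d.+1%:R :> R by rewrite ltr0n.
apply: le_trans (_ : \sum_(i < d) d.+1%:R^-1 <= _).
  apply: ler_sum => i _; have /eqP := v0 i; rewrite !mxE floor_eq add0r.
  rewrite -ltr_pdivlMl // mulr1 pmulr_rge0 // => /andP[vi0 vi1].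
  rewrite expr2; apply: le_trans (ltW vi1); rewrite ler_piMr //.
  by rewrite (le_trans (ltW vi1)) // invf_le1 // ler1n.
by rewrite sumr_const card_ord -[leLHS]mulr_natl ler_pdivrMr // mul1r ler_nat.
Qed.

Lemma omega_volume d : lebesgue_volume (@unit_ball d) = (omega R d)%:E.
Proof.
rewrite /omega fineK //; apply/fin_numP; split.
  by rewrite gt_eqF // (lt_le_trans ltNy0) // lebesgue_volume_ge0.
rewrite lt_eqF //; apply: le_lt_trans (le_lebesgue_volume (@unit_ball_sub_cells d 1 isT)) _.
by rewrite lebesgue_volume_cells // ltry.
Qed.

Lemma omega_gt0 d : 0 < omega R d.
Proof.
rewrite -lte_fin -omega_volume.
apply: lt_le_trans (le_lebesgue_volume (@cells0_sub_unit_ball d)).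
by rewrite lebesgue_volume_cells // cardfs1 lte_fin divr_gt0 // exprn_gt0.
Qed.

(** This is how omega enters the isoperimetric argument. The excess d of
    the radius over k is of relative order 1/k. *)
Lemma card_zball_ge d k : (0 < k)%N -> omega R d * k%:R ^+ d <= #|` zball d (k + d)|%:R.
Proof.
move=> k0; rewrite -ler_pdivlMr ?exprn_gt0 ?ltr0n // -lee_fin -omega_volume.
by rewrite -lebesgue_volume_cells //; exact/le_lebesgue_volume/unit_ball_sub_cells.
Qed.

End LatticeBall.

(** * Differences and l2 bounds on a discrete torus *)

Section TorusAnalysis.
Context {R : realType} {G : finZmodType} {d : nat}.
Variable iota : {additive 'rV[int]_d -> G}.
Implicit Types (f g u v w : G -> R) (y a : G) (i j : 'I_d) (z : 'rV[int]_d).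

Definition step i : G := iota (delta_mx ord0 i).

Definition grad f i : G -> R := fun y => f (y + step i) - f y.

Lemma gradE f i y : grad f i y = f (y + step i) - f y.
Proof. by []. Qed.

(** The function f minus its average over the neighbours, multiplied by 2 d. *)
Definition neglap f y : R :=
  \sum_i (2 * f y - f (y + step i) - f (y - step i)).

(** An upper bound for the l2 norm; squares spare the extraction of roots. *)
Definition l2_le f (p : R) : Prop := 0 <= p /\ \sum_y f y ^+ 2 <= p ^+ 2.

Lemma sum_shift (F : G -> R) a : \sum_y F (y + a) = \sum_y F y.
Proof. by rewrite [RHS](reindex_inj (addIr a)). Qed.

(** Minkowski's inequality, from (x + y)^2 <= (1 + q/p) x^2 + (1 + p/q) y^2. *)
Lemma l2_leD f g p q : l2_le f p -> l2_le g q -> l2_le (fun y => f y + g y) (p + q).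
Proof.
move=> [p0 Hf] [q0 Hg]; split; first exact: addr_ge0.
have zero h : \sum_y h y ^+ 2 <= 0 ^+ 2 :> R -> forall y, h y = 0.
  rewrite expr0n /= => le0 y; have : \sum_y h y ^+ 2 = 0.
    by apply/eqP; rewrite eq_le le0 sumr_ge0 // => x _; rewrite sqr_ge0.
  by move/psumr_eq0P => /(_ (fun x _ => sqr_ge0 (h x))) /(_ y isT) /eqP; rewrite sqrf_eq0 => /eqP.
have [p_eq0|p_neq0] := eqVneq p 0.
  rewrite p_eq0 in Hf *; rewrite add0r; apply: le_trans Hg.
  by apply: ler_sum => y _; rewrite (zero _ Hf) add0r.
have [q_eq0|q_neq0] := eqVneq q 0.
  rewrite q_eq0 in Hg *; rewrite addr0; apply: le_trans Hf.
  by apply: ler_sum => y _; rewrite (zero _ Hg) addr0.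
have p_gt0 : 0 < p by rewrite lt0r p_neq0.
have q_gt0 : 0 < q by rewrite lt0r q_neq0.
apply: le_trans (_ : \sum_y ((1 + q / p) * f y ^+ 2 + (1 + p / q) * g y ^+ 2) <= _).
  apply: ler_sum => y _; rewrite -subr_ge0.
  have -> : (1 + q / p) * f y ^+ 2 + (1 + p / q) * g y ^+ 2 - (f y + g y) ^+ 2 =
     (q * f y - p * g y) ^+ 2 / (p * q) by field; rewrite p_neq0 q_neq0.
  by rewrite divr_ge0 ?sqr_ge0 // mulr_ge0.
rewrite big_split /= -!mulr_sumr.
have -> : (p + q) ^+ 2 = (1 + q / p) * p ^+ 2 + (1 + p / q) * q ^+ 2.
  by field; rewrite p_neq0 q_neq0.
by rewrite lerD // ler_wpM2l // addr_ge0 // divr_ge0.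
Qed.

Lemma l2_le0 : l2_le (fun=> 0) 0.
Proof. by split=> //; rewrite big1 ?sqr_ge0 // => y _; rewrite expr0n. Qed.

Lemma l2_le_mono f p q : p <= q -> l2_le f p -> l2_le f q.
Proof.
move=> pq [p0 Hf]; split; first exact: le_trans pq.
by rewrite (le_trans Hf) // ler_pXn2r // nnegrE ?(le_trans p0).
Qed.

Lemma l2_leZ (c : R) f p : l2_le f p -> l2_le (fun y => c * f y) (`|c| * p).
Proof.
move=> [p0 Hf]; split; first by rewrite mulr_ge0.
under eq_bigr do rewrite exprMn.
by rewrite -mulr_sumr exprMn real_normK ?num_real // ler_wpM2l ?sqr_ge0.
Qed.

Lemma l2_leN f p : l2_le f p -> l2_le (fun y => - f y) p.
Proof. by move=> [p0 Hf]; split=> //; under eq_bigr do rewrite sqrrN. Qed.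

Lemma l2_le_shift f p a : l2_le f p -> l2_le (fun y => f (y + a)) p.
Proof. by move=> [p0 Hf]; split=> //; rewrite (sum_shift (fun y => f y ^+ 2)). Qed.

Lemma l2_le_sum (I : Type) (s : seq I) (F : I -> G -> R) (p : R) : 0 <= p ->
  (forall k, l2_le (F k) p) -> l2_le (fun y => \sum_(k <- s) F k y) ((size s)%:R * p).
Proof.
move=> p0 HF; elim: s => [|k s IHs].
  by rewrite mul0r; under eq_fun do rewrite big_nil; exact: l2_le0.
under eq_fun do rewrite big_cons.
by rewrite /= -addn1 addnC natrD mulrDl mul1r; exact: l2_leD.
Qed.

Lemma l2_le_sum_ord n (F : 'I_n -> G -> R) (p : R) : 0 <= p ->
  (forall k, l2_le (F k) p) -> l2_le (fun y => \sum_(k < n) F k y) (n%:R * p).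
Proof.
move=> p0 HF; have := l2_le_sum (enum 'I_n) p0 HF; rewrite size_enum_ord.
by congr l2_le; apply/funext => y; rewrite big_enum.
Qed.

Lemma l2_le_abs f g p : (forall y, `|f y| <= `|g y|) -> l2_le g p -> l2_le f p.
Proof.
move=> fg [p0 Hg]; split=> //; apply: le_trans Hg; apply: ler_sum => y _.
rewrite -(real_normK (num_real (f y))) -(real_normK (num_real (g y))).
by rewrite ler_pXn2r // nnegrE.
Qed.

Lemma green_identity u w :
  \sum_i \sum_y grad u i y * grad w i y = \sum_y w y * neglap u y.
Proof.
under [RHS]eq_bigr do rewrite mulr_sumr.
rewrite [RHS]exchange_big /=; apply: eq_bigr => i _.
under eq_bigr do rewrite [grad w _ _]/grad mulrBr.
rewrite sumrB -(sum_shift (fun y => grad u i y * w (y + step i)) (- step i)) -sumrB.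
by apply: eq_bigr => y _; rewrite /grad subrK; ring.
Qed.

Definition l1 z : nat := (\sum_i absz (z ord0 i))%N.

Lemma l1_step z k : l1 z = k.+1 -> exists z' i,
  (z = z' + delta_mx ord0 i \/ z = z' - delta_mx ord0 i) /\ l1 z' = k.
Proof.
move=> zk; have [i zi] : exists i, z ord0 i != 0.
  apply/existsP; apply: contra_eqT zk; rewrite negb_exists => /forallP z0.
  by rewrite /l1 big1 // => i _; have /negPn/eqP -> := z0 i.
have other (c : int) j : j != i -> (z + c *: delta_mx ord0 i) ord0 j = z ord0 j.
  by move=> ji; rewrite !mxE eqxx (negbTE ji) mulr0 addr0.
have own (c : int) : (z + c *: delta_mx ord0 i) ord0 i = z ord0 i + c.
  by rewrite !mxE !eqxx mulr1.
have l1E (c : int) : l1 (z + c *: delta_mx ord0 i) =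
    (absz (z ord0 i + c)%R + \sum_(j | j != i) absz (z ord0 j))%N.
  by rewrite /l1 (bigD1 i) //= own; congr addn; apply: eq_bigr => j /other ->.
move: zk; rewrite -{1}[z]addr0 -(scale0r (delta_mx ord0 i)) l1E addr0 => zk.
have [zpos|zneg] := ltP 0 (z ord0 i).
  exists (z + (-1) *: delta_mx ord0 i), i; rewrite scaleN1r subrK; split; first by left.
  by rewrite -scaleN1r l1E; lia.
exists (z + 1 *: delta_mx ord0 i), i; rewrite scale1r addrK; split; first by right.
by rewrite -[delta_mx _ _]scale1r l1E; lia.
Qed.

(** A translation by z is a succession of l1 z unit translations, each of which
    changes f by at most kap in l2 norm. *)
Lemma l2_translate f (kap : R) : 0 <= kap -> (forall i, l2_le (grad f i) kap) ->
  forall z, l2_le (fun y => f (y + iota z) - f y) ((l1 z)%:R * kap).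
Proof.
move=> kap0 Hf z; move zk : (l1 z) => k; elim: k z zk => [|k IHk] z.
  move/eqP; rewrite sum_nat_eq0 => /forallP z0.
  have -> : z = 0 by apply/rowP => i; rewrite mxE; apply/eqP; rewrite -absz_eq0; exact: z0.
  by rewrite mul0r; under eq_fun do rewrite raddf0 addr0 subrr; exact: l2_le0.
move/l1_step => [z' [i [zE z'k]]]; rewrite -natr1 mulrDl mul1r.
case: zE => ->.
  have := l2_leD (IHk _ z'k) (l2_le_shift (iota z') (Hf i)).
  congr l2_le; apply/funext => y; rewrite /grad raddfD /= -/(step i) [y + (_ + _)]addrA; ring.
have := l2_leD (IHk _ z'k) (l2_leN (l2_le_shift (iota z' - step i) (Hf i))).
congr l2_le; apply/funext => y.
by rewrite /grad [iota (_ - _)]raddfB -/(step i) -[y + _ + step i]addrA subrK; ring.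
Qed.

Definition taylor_rest v z : G -> R := fun y =>
  v (y + iota z) - v y - \sum_i (z ord0 i)%:~R * grad v i y.

(** Each unit step of a lattice path from 0 to z contributes a difference of two
    values of a gradient component, at points at most l1 z steps apart. *)
Lemma l2_taylor v (kap : R) : 0 <= kap ->
  (forall i j, l2_le (grad (grad v i) j) kap) ->
  forall z, l2_le (taylor_rest v z) ((l1 z)%:R ^+ 2 * kap).
Proof.
move=> kap0 Hv z; move zk : (l1 z) => k; elim: k z zk => [|k IHk] z.
  move/eqP; rewrite sum_nat_eq0 => /forallP z0.
  have -> : z = 0 by apply/rowP => i; rewrite mxE; apply/eqP; rewrite -absz_eq0; exact: z0.
  rewrite expr0n mul0r; have -> : taylor_rest v 0 = fun=> 0; last exact: l2_le0.
  apply/funext => y; rewrite /taylor_rest raddf0 addr0 subrr big1 ?subr0 // => i _.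
  by rewrite mxE mul0r.
move=> zk; have [z' [j [zE z'k]]] := l1_step zk.
have sumE (c : int) (e : 'rV[int]_d) y : (forall i, e ord0 i = c * (i == j)%:R) ->
    \sum_i ((z' + e) ord0 i)%:~R * grad v i y =
    \sum_i (z' ord0 i)%:~R * grad v i y + c%:~R * grad v j y.
  move=> eE; rewrite (bigD1 j) //= [in RHS](bigD1 j) //= mxE eE eqxx mulr1 intrD mulrDl.
  rewrite -!addrA; congr (_ + _); rewrite addrC; congr (_ + _); apply: eq_bigr => i ij.
  by rewrite mxE eE (negbTE ij) mulr0 addr0.
case: zE => zE.
  apply: (@l2_le_mono _ (k%:R ^+ 2 * kap + k%:R * kap)).
    by rewrite -natr1; have := ler0n R k; nra.
  have := l2_leD (IHk _ z'k) (l2_translate kap0 (Hv j) z'); rewrite z'k.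
  congr l2_le; apply/funext => y.
  rewrite /taylor_rest zE (sumE 1) => [|i]; last by rewrite mxE eqxx mul1r.
  by rewrite [iota (_ + _)]raddfD -/(step j) [y + (_ + _)]addrA /grad; ring.
apply: (@l2_le_mono _ (k%:R ^+ 2 * kap + k.+1%:R * kap)).
  by rewrite -natr1; have := ler0n R k; nra.
have := l2_leD (IHk _ z'k) (l2_leN (l2_translate kap0 (Hv j) z)); rewrite zk.
congr l2_le; apply/funext => y.
rewrite /taylor_rest zE (sumE (-1)) => [|i]; last by rewrite !mxE eqxx mulN1r.
by rewrite [iota (_ - _)]raddfB -/(step j) /grad -[y + _ + step j]addrA subrK; ring.
Qed.

Section Smoothing.
Variable l : nat.
Hypothesis l_gt0 : (0 < l)%N.

Let l_pos : 0 < l%:R :> R. Proof. by rewrite ltr0n. Qed.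

(** Averages over segments: they keep upper bounds on neglap, move f little in l2
    norm, and, taken in every direction, have small second differences, which
    are the three properties needed to replace a subsolution by a function with
    a Taylor expansion. *)
Definition avg i f : G -> R := fun y => l%:R^-1 * \sum_(k < l) f (y + step i *+ k).

Lemma avg_ge (m : R) i f : (forall y, m <= f y) -> forall y, m <= avg i f y.
Proof.
move=> Hf y; rewrite /avg mulrC ler_pdivlMr //.
have -> : m * l%:R = \sum_(k < l) m by rewrite sumr_const card_ord mulr_natr.
by apply: ler_sum => k _.
Qed.

Lemma avgN i f : avg i (fun y => - f y) = fun y => - avg i f y.
Proof. by apply/funext => y; rewrite /avg sumrN mulrN. Qed.

Lemma avg_le (m : R) i f : (forall y, f y <= m) -> forall y, avg i f y <= m.
Proof.
move=> Hf y; rewrite -lerN2; have := @avg_ge (- m) i (fun y => - f y).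
by rewrite avgN; apply=> x; rewrite lerN2.
Qed.

Lemma grad_avg i f j : grad (avg i f) j = avg i (grad f j).
Proof.
apply/funext => y; rewrite /grad /avg -mulrBr -sumrB; congr (_ * _).
by apply: eq_bigr => k _; rewrite addrAC.
Qed.

Lemma neglap_avg i f : neglap (avg i f) = avg i (neglap f).
Proof.
apply/funext => y; rewrite /neglap [RHS]/avg exchange_big /= mulr_sumr.
apply: eq_bigr => j _; rewrite /avg mulrCA -!mulrBr; congr (_ * _).
rewrite mulr_sumr -!sumrB; apply: eq_bigr => k _.
by rewrite ![y + _ + step i *+ k]addrAC.
Qed.

Lemma l2_avg i f p : l2_le f p -> l2_le (avg i f) p.
Proof.
move=> Hf; have [p0 _] := Hf.
have := l2_leZ l%:R^-1 (l2_le_sum_ord p0 (fun k : 'I_l => l2_le_shift (step i *+ k) Hf)).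
by rewrite ger0_norm ?invr_ge0 // mulrA mulVf ?gt_eqF // mul1r.
Qed.

(** The difference in the direction of the average telescopes. *)
Lemma l2_grad_avg i f p : l2_le f p -> l2_le (grad (avg i f) i) (2 * p / l%:R).
Proof.
move=> Hf; have -> : grad (avg i f) i = fun y => l%:R^-1 * (f (y + step i *+ l) + - f y).
  apply/funext => y; rewrite /grad /avg -mulrBr; congr (_ * _).
  rewrite -sumrB; under eq_bigr do rewrite -addrA -mulrS.
  rewrite -(big_mkord xpredT (fun k => f (y + step i *+ k.+1) - f (y + step i *+ k))).
  by rewrite (telescope_sumr (fun k => f (y + step i *+ k))) // mulr0n addr0.
have := l2_leZ l%:R^-1 (l2_leD (l2_le_shift (step i *+ l) Hf) (l2_leN Hf)).
by rewrite ger0_norm ?invr_ge0 //; congr l2_le; ring.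
Qed.

Lemma l2_avg_close i f p : l2_le (grad f i) p -> l2_le (fun y => avg i f y - f y) (l%:R * p).
Proof.
move=> Hf; have [p0 _] := Hf.
have shift k : l2_le (fun y => f (y + step i *+ k) - f y) (k%:R * p).
  elim: k => [|k IHk].
    by rewrite mul0r; under eq_fun do rewrite mulr0n addr0 subrr; exact: l2_le0.
  rewrite -natr1 mulrDl mul1r.
  have := l2_leD IHk (l2_le_shift (step i *+ k) Hf).
  by congr l2_le; apply/funext => y; rewrite /grad mulrSr [y + (_ + _)]addrA; ring.
have shift' (k : 'I_l) : l2_le (fun y => f (y + step i *+ k) - f y) (l%:R * p).
  by apply: l2_le_mono (shift k); rewrite ler_wpM2r // ler_nat ltnW.
have lp0 : 0 <= l%:R * p by rewrite mulr_ge0.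
have := l2_leZ l%:R^-1 (l2_le_sum_ord lp0 shift').
rewrite ger0_norm ?invr_ge0 // [X in l2_le _ X]mulrA mulVf ?gt_eqF // mul1r.
congr l2_le; apply/funext => y; rewrite /avg big_split /= mulrDr; congr (_ + _).
by rewrite sumr_const card_ord -[- f y *+ _]mulr_natl mulrA mulVf ?gt_eqF // mul1r.
Qed.

Definition smooth (s : seq 'I_d) f : G -> R := foldr avg f s.

Lemma smooth_ge0 s f : (forall y, 0 <= f y) -> forall y, 0 <= smooth s f y.
Proof. by move=> f0; elim: s => //= i s IHs; exact: avg_ge. Qed.

Lemma neglap_smooth_le s f (m : R) :
  (forall y, neglap f y <= m) -> forall y, neglap (smooth s f) y <= m.
Proof.
by move=> fm; elim: s => //= i s IHs; rewrite neglap_avg; exact: avg_le.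
Qed.

Lemma grad_smooth s f j : grad (smooth s f) j = smooth s (grad f j).
Proof. by elim: s => //= i s IHs; rewrite grad_avg IHs. Qed.

Lemma l2_smooth s f p : l2_le f p -> l2_le (smooth s f) p.
Proof. by move=> fp; elim: s => //= i s IHs; exact: l2_avg. Qed.

Lemma l2_smooth_close s f p : 0 <= p -> (forall i, l2_le (grad f i) p) ->
  l2_le (fun y => smooth s f y - f y) ((size s)%:R * (l%:R * p)).
Proof.
move=> p0 fp; elim: s => [|i s IHs] /=.
  by rewrite mul0r; under eq_fun do rewrite subrr; exact: l2_le0.
rewrite -addn1 addnC natrD mulrDl mul1r.
have gp : l2_le (grad (smooth s f) i) p by rewrite grad_smooth; exact: l2_smooth.
have := l2_leD (l2_avg_close gp) IHs.
by congr l2_le; apply/funext => y; ring.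
Qed.

Lemma l2_grad_smooth s f p j : l2_le f p -> j \in s ->
  l2_le (grad (smooth s f) j) (2 * p / l%:R).
Proof.
move=> fp; elim: s => //= i s IHs; rewrite in_cons.
have [->|ji] := eqVneq j i => /= js; first by apply/l2_grad_avg/l2_smooth.
by rewrite grad_avg; apply/l2_avg/IHs.
Qed.

End Smoothing.

End TorusAnalysis.

(** * Isoperimetry and the crude bound *)

(** Here c0 is the constant of the isoperimetric inequality [perimeter_ge], the
    first quotient is the height of the levels removed at each step of
    [torsion_crude], relative to the radius, and the minimum is the loss of radius. *)
Definition crude_constant (R : realType) (d : nat) : R :=
  let c0 := (3 ^ d * d)%:R^-1 in
  4 * d%:R / c0 / Num.min 1 (c0 / (4 * d%:R) / (d%:R * 2 ^+ d.-1)).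

Lemma crude_constant_gt0 (R : realType) d : (0 < d)%N -> 0 < crude_constant R d.
Proof.
move=> d0; have d0' : 0 < d%:R :> R by rewrite ltr0n.
have c0 : 0 < (3 ^ d * d)%:R^-1 :> R by rewrite invr_gt0 ltr0n muln_gt0 expn_gt0.
rewrite /crude_constant; apply: divr_gt0; first by rewrite divr_gt0 // mulr_gt0.
by rewrite lt_min ltr01 !divr_gt0 // mulr_gt0 // exprn_gt0.
Qed.

Section TorusIsoperimetry.
Context {R : realType} {G : finZmodType} {d : nat}.
Variable iota : {additive 'rV[int]_d -> G}.
Implicit Types (f g u v w : G -> R) (y a : G) (i j : 'I_d) (z : 'rV[int]_d).
Local Notation step := (step iota).
Local Notation grad := (grad iota).
Local Notation neglap := (neglap iota).

Lemma zbox_sub K L z : (L <= K)%N -> z \in zbox d L -> z \in zbox d K.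
Proof.
by move=> LK /mem_zbox Hz; apply/mem_zbox => i; rewrite (le_trans (Hz i)) // lez_nat.
Qed.

Lemma zboxD K L z z' : z \in zbox d K -> z' \in zbox d L -> z + z' \in zbox d (K + L).
Proof.
move=> /mem_zbox Hz /mem_zbox Hz'; apply/mem_zbox => i.
by rewrite mxE PoszD (le_trans (ler_normD _ _)) // lerD.
Qed.

(** Smoothing stays within reach of the box that contains the support. *)
Lemma smooth_supp l s f L : (0 < l)%N ->
  (forall y, f y != 0 -> exists2 z, z \in zbox d L & y = iota z) ->
  forall y, smooth iota l s f y != 0 ->
    exists2 z, z \in zbox d (L + size s * l) & y = iota z.
Proof.
move=> l0 Hf; elim: s => [|i s IHs] y /=; first by rewrite mul0n addn0; exact: Hf.
move=> yn0; have [k kn0] : exists k : 'I_l, smooth iota l s f (y + step i *+ k) != 0.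
  apply/existsP; apply: contraR yn0; rewrite negb_exists => /forallP k0.
  by rewrite /avg big1 ?mulr0 // => k _; have /negPn/eqP := k0 k.
have [z zL yE] := IHs _ kn0; exists (z - delta_mx ord0 i *+ k).
  rewrite mulSn addnCA addnC; apply: zboxD => //; apply/mem_zbox => j.
  rewrite !mxE mulmxnE !mxE eqxx /= normrN normrMn.
  have := ltn_ord k; case: (j == i) => /=; lia.
by rewrite raddfB raddfMn -/(step i) -yE addrK.
Qed.

Definition thick (W : {fset 'rV[int]_d}) (E : {set G}) : {set G} :=
  [set y | has (fun z => y + iota z \in E) (enum_fset W)].

Lemma thickP (W : {fset 'rV[int]_d}) (E : {set G}) y :
  reflect (exists2 z, z \in W & y + iota z \in E) (y \in thick W E).
Proof. by rewrite inE; apply: hasP. Qed.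

(** Brunn-Minkowski is transported to G by lifting both sets to a box of the
    lattice on which iota is injective. *)
Lemma thick_card K L M (W Y : {fset 'rV[int]_d}) (E : {set G}) (q : R) :
  (0 < d)%N -> {in zbox d K &, injective iota} -> (L + M <= K)%N ->
  (forall y, y \in E -> exists2 z, z \in zbox d L & y = iota z) ->
  (forall z, z \in W -> z \in zbox d M) ->
  (forall x e : 'rV[int]_d, x \in Y -> cube_corner e -> - (x + e) \in W) ->
  E != finset.set0 -> Y != fset0 -> 0 <= q -> q ^+ d <= #|` Y|%fset%:R ->
  #|E|%:R + d%:R * nroot d #|E|%:R ^+ d.-1 * q <= #|thick W E|%:R.
Proof.
move=> d0 injK LMK EL WM YW E0 Y0 q0 qY.
pose E' : {fset 'rV[int]_d} := [fset z in zbox d L | iota z \in E]%fset.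
pose Z : {fset 'rV[int]_d} := [fset z in zbox d K | iota z \in thick W E]%fset.
have EE' : (#|E| <= #|` E'|%fset)%N.
  rewrite cardE -(size_map iota E'); apply: uniq_leq_size; first exact: enum_uniq.
  move=> y; rewrite mem_enum => yE; have [z zL yz] := EL _ yE.
  by apply/mapP; exists z => //; rewrite !inE /= zL -yz.
have ZZ : (#|` Z|%fset <= #|thick W E|)%N.
  rewrite cardE -(size_map iota Z); apply: uniq_leq_size.
    rewrite map_inj_in_uniq ?fset_uniq // => z z'; rewrite !inE /= => /andP[zK _] /andP[z'K _].
    exact: injK.
  by move=> y /mapP[z]; rewrite !inE /= => /andP[_ zE] ->; rewrite mem_enum inE.
have rootE : nroot d #|E|%:R ^+ d = #|E|%:R :> R by case: d d0 => // k _; rewrite nrootK.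
have Erad : #|E|%:R <= #|` E'|%fset%:R :> R by rewrite ler_nat.
have E'0 : E' != fset0.
  by rewrite -cardfs_gt0 (leq_trans _ EE') // card_gt0.
have BM : (nroot d #|E|%:R + q) ^+ d <= #|` Z|%fset%:R.
  apply: (@brunn_minkowski R d E' Y Z) => //; rewrite ?nroot_ge0 ?rootE //.
  move=> x y e; rewrite !inE /= => /andP[xL xE] yY e01.
  have yeW := YW _ _ yY e01.
  have -> /= : x + y + e \in zbox d K.
    apply: zbox_sub LMK _; rewrite -addrA; apply: zboxD => //.
    have /mem_zbox H := WM _ yeW; apply/mem_zbox => i.
    by have := H i; rewrite mxE normrN.
  apply/hasP; exists (- (y + e)) => //=.
  by rewrite -raddfD -[x + y + e]addrA addrK.
rewrite -{1}rootE; apply: le_trans (expr_ge_linear d _ q0) _; first exact: nroot_ge0.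
by apply: le_trans BM _; rewrite ler_nat.
Qed.

(** Subsolutions of the exit-time equation (torsion problem): the average of u
    over the neighbours falls below u by at most 1 on A. The truncated expected
    exit times are of this kind. *)
Definition sub_torsion (A : {set G}) u : Prop :=
  [/\ forall y, 0 <= u y, forall y, y \notin A -> u y = 0
    & forall y, y \in A -> neglap u y <= 2 * d%:R].

Lemma neglap_le_at0 u y (m : R) : (forall x, 0 <= u x) -> u y = 0 -> 0 <= m -> neglap u y <= m.
Proof.
move=> u0 uy m0; apply: le_trans m0; apply: sumr_le0 => i _.
by rewrite uy mulr0 sub0r -opprD oppr_le0 addr_ge0.
Qed.

Lemma sub_torsion_neglap A u : sub_torsion A u -> forall y, neglap u y <= 2 * d%:R.
Proof.
move=> [u0 uA uL] y; have [/uL//|yA] := boolP (y \in A).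
by apply: neglap_le_at0; rewrite ?uA // mulr_ge0.
Qed.

(** Summation by parts of the equation tested against u. *)
Lemma energy_le A u (M : R) : sub_torsion A u -> (forall y, u y <= M) ->
  \sum_i \sum_y grad u i y ^+ 2 <= 2 * d%:R * M * #|A|%:R.
Proof.
move=> uA uM; under eq_bigr do under eq_bigr do rewrite expr2.
rewrite green_identity; have [u0 u_off _] := uA.
have -> : 2 * d%:R * M * #|A|%:R = \sum_(y in A) M * (2 * d%:R).
  by rewrite sumr_const mulr_natr; congr (_ *+ _); ring.
rewrite [leRHS]big_mkcond; apply: ler_sum => y _;
case: ifPn => [yA|/u_off ->]; last by rewrite mul0r.
apply: le_trans (ler_wpM2l (u0 y) (sub_torsion_neglap uA y)) _.
by rewrite ler_wpM2r // mulr_ge0.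
Qed.

Definition above u (t : R) : {set G} := finset (fun y => t < u y).

Lemma in_above u t y : (y \in above u t) = (t < u y).
Proof. by rewrite inE. Qed.

(** At a point above the level t the cut function is u - t, and at its neighbours
    it can only be larger. This drives all recursions on the cardinal. *)
Lemma sub_torsion_cut A u (t : R) : sub_torsion A u -> 0 <= t ->
  sub_torsion (above u t) (fun y => Num.max (u y - t) 0).
Proof.
move=> uA t0; split=> y; first by rewrite le_max lexx orbT.
  by rewrite inE -leNgt => uy; rewrite max_r // subr_le0.
rewrite inE => uy; apply: le_trans (sub_torsion_neglap uA y); apply: ler_sum => i _.
rewrite [Num.max (u y - t) 0]max_l; last by rewrite subr_ge0 ltW.
have ge x : u x - t <= Num.max (u x - t) 0 by rewrite le_max lexx.
by have := ge (y + step i); have := ge (y - step i); lra.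
Qed.

Definition set_indicator (E : {set G}) : G -> R := fun y => (y \in E)%:R.

Lemma sum_set_indicator E : \sum_y set_indicator E y = #|E|%:R.
Proof.
rewrite -sum1_card natr_sum [RHS]big_mkcond; apply: eq_bigr => y _.
by rewrite /set_indicator; case: (_ \in _).
Qed.

Definition perimeter (E : {set G}) : R := \sum_i \sum_y grad (set_indicator E) i y ^+ 2.

(** A point that a translation by z in W brings into E contributes 1 to the squared
    l2 norm of the corresponding increment of the indicator of E. *)
Lemma card_thick_le (W : {fset 'rV[int]_d}) (E : {set G}) (m : nat) :
  (forall z, z \in W -> (l1 z <= m)%N) ->
  #|thick W E|%:R <= #|E|%:R + #|` W|%fset%:R * m%:R ^+ 2 * perimeter E.
Proof.
move=> Wm; pose kap := Num.sqrt (perimeter E).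
have per0 : 0 <= perimeter E by do 2![apply: sumr_ge0 => ? _]; rewrite sqr_ge0.
have Hg i : l2_le (grad (set_indicator E) i) kap.
  split; first exact: sqrtr_ge0.
  rewrite sqr_sqrtr // /perimeter (bigD1 i) //= lerDl.
  by do 2![apply: sumr_ge0 => ? _]; rewrite sqr_ge0.
have one z : z \in W ->
    \sum_y (set_indicator E (y + iota z) - set_indicator E y) ^+ 2 <= m%:R ^+ 2 * perimeter E.
  move=> zW; have [_ H] := l2_translate (sqrtr_ge0 _) Hg z; apply: le_trans H _.
  rewrite exprMn sqr_sqrtr // ler_wpM2r // ler_pXn2r ?nnegrE //.
  by rewrite ler_nat Wm.
rewrite -mulrA -!sum_set_indicator.
have -> : #|` W|%fset%:R * (m%:R ^+ 2 * perimeter E) =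
    \sum_(z <- enum_fset W) m%:R ^+ 2 * perimeter E.
  by rewrite big_const_seq count_predT iter_addr addr0 mulr_natl.
apply: le_trans (_ : \sum_y set_indicator E y + \sum_(z <- enum_fset W)
    \sum_y (set_indicator E (y + iota z) - set_indicator E y) ^+ 2 <= _); last first.
  by rewrite lerD2l big_seq [leRHS]big_seq; apply: ler_sum => z; exact: one.
rewrite exchange_big /= -big_split /=; apply: ler_sum => y _.
have sum0 : 0 <= \sum_(z <- enum_fset W) (set_indicator E (y + iota z) - set_indicator E y) ^+ 2.
  by apply: sumr_ge0 => z _; rewrite sqr_ge0.
rewrite [leLHS]/set_indicator; case: thickP => [[z zW yz]|_]; last by rewrite addr_ge0 // ler0n.
have [yE|yE] := boolP (y \in E); first by rewrite {1}/set_indicator yE lerDl.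
rewrite {1}/set_indicator (negbTE yE) add0r (big_rem z) //=.
rewrite {1}/set_indicator yz {1}/set_indicator (negbTE yE).
rewrite subr0 expr1n lerDl; apply: sumr_ge0 => z' _; rewrite sqr_ge0 //.
Qed.

(** An edge leaving E = {u > tau} either carries a drop of u of at least tau, or
    ends in F = {0 < u <= tau}; the total drop is bounded by the equation. *)
Lemma perimeter_le A u (tau : R) : sub_torsion A u -> 0 <= tau ->
  tau * perimeter (above u tau) <= 2 * d%:R * #|above u tau|%:R +
    2 * d%:R * tau * #|above u 0 :\: above u tau|%:R.
Proof.
move=> uA tau0; set E := above u tau; set F := above u 0 :\: E.
have [u0 _ _] := uA.
have edge i y : tau * grad (set_indicator E) i y ^+ 2 <=
    grad u i y * grad (set_indicator E) i y +
      tau * (set_indicator F y + set_indicator F (y + step i)).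
  rewrite !gradE /set_indicator !inE; have := u0 y; have := u0 (y + step i).
  by do 4![case: ltP => ?] => /= *; nra.
rewrite /perimeter mulr_sumr.
apply: le_trans (_ : \sum_i \sum_y (grad u i y * grad (set_indicator E) i y +
  tau * (set_indicator F y + set_indicator F (y + step i))) <= _).
  by apply: ler_sum => i _; rewrite mulr_sumr; apply: ler_sum => y _; exact: edge.
under eq_bigr do rewrite big_split /= -mulr_sumr big_split /= sum_shift sum_set_indicator.
rewrite big_split /= green_identity lerD //.
  rewrite -(sum_set_indicator E) mulr_sumr; apply: ler_sum => y _; rewrite mulrC ler_wpM2r //.
  exact: (sub_torsion_neglap uA).
rewrite sumr_const card_ord -[leLHS]mulr_natr le_eqVlt; apply/orP; left.
by apply/eqP; ring.
Qed.

Lemma card_above_split A u (tau : R) : sub_torsion A u -> 0 <= tau ->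
  (#|above u tau| + #|above u 0 :\: above u tau| <= #|A|)%N.
Proof.
move=> [u0 u_off _] tau0; rewrite -[X in (X + _)%N](_ : #|above u 0 :&: above u tau| = _).
  rewrite cardsID; apply/subset_leq_card/fintype.subsetP => y; rewrite in_above => uy.
  by apply: contraTT uy => /u_off ->; rewrite ltxx.
congr #|pred_of_set _|; apply/finset.setIidPr/fintype.subsetP => y; rewrite !in_above.
exact: le_lt_trans.
Qed.

Definition liftable L (A : {set G}) : Prop :=
  forall y, y \in A -> exists2 z, z \in zbox d L & y = iota z.

Hypothesis d_gt0 : (0 < d)%N.

Lemma l1_zbox m z : z \in zbox d m -> (l1 z <= d * m)%N.
Proof.
move=> /mem_zbox Hz; rewrite /l1 -[d in leqRHS]card_ord -sum_nat_const.
by apply: leq_sum => i _; have := Hz i; lia.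
Qed.

(** The Brunn-Minkowski inequality with a one-point set compares E with its
    thickening by the corner cube, which the perimeter bounds from above. *)
Lemma perimeter_ge K L (E : {set G}) : {in zbox d K &, injective iota} ->
  (L + 1 <= K)%N -> liftable L E -> E != finset.set0 ->
  nroot d #|E|%:R ^+ d.-1 <= (3 ^ d * d)%:R * perimeter E.
Proof.
move=> injK LK EL E0.
pose W : {fset 'rV[int]_d} := [fset z in zbox d 1 | cube_corner (- z)]%fset.
have W1 z : z \in W -> z \in zbox d 1 by rewrite !inE => /andP[].
have := @thick_card K L 1 W [fset 0]%fset E 1 d_gt0 injK LK EL W1.
rewrite cardfs1 expr1n mulr1 => /(_ _ E0 _ ler01 (lexx _)) H.
have thick_ge : #|E|%:R + d%:R * nroot d #|E|%:R ^+ d.-1 <= #|thick W E|%:R :> R.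
  apply: H; last by apply/fset0Pn; exists 0; rewrite inE.
  move=> x e; rewrite inE => /eqP -> e01; rewrite add0r !inE /= opprK e01 andbT.
  apply/mem_zbox => i; rewrite mxE normrN.
  by have /forallP/(_ i)/orP[/eqP ->|/eqP ->] := e01.
have Wd z : z \in W -> (l1 z <= d)%N by move/W1/l1_zbox; rewrite muln1.
have := le_trans thick_ge (card_thick_le E Wd); rewrite lerD2l => per.
have per0 : 0 <= perimeter E by do 2![apply: sumr_ge0 => ? _]; rewrite sqr_ge0.
have W3 : #|` W|%fset%:R <= (3 ^ d)%:R :> R.
  rewrite ler_nat; apply: leq_trans (card_zbox d 1); apply: fsubset_leq_card.
  by apply/fsubsetP => z; exact: W1.
have d0 : 0 < d%:R :> R by rewrite ltr0n.
rewrite -(ler_pM2l d0); apply: le_trans per _.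
rewrite natrM; apply: le_trans (_ : (3 ^ d)%:R * d%:R ^+ 2 * perimeter E <= _).
  by rewrite !ler_wpM2r // sqr_ge0.
by rewrite le_eqVlt; apply/orP; left; apply/eqP; ring.
Qed.

(** A crude bound of the right order. The levels above a multiple of the radius
    of A have a radius smaller by a fixed amount, because otherwise the band below
    would be too thin for the perimeter of the upper levels; the bound follows by
    induction on the cardinal. *)
Lemma torsion_crude K L A u : {in zbox d K &, injective iota} -> (L + 1 <= K)%N ->
  liftable L A -> sub_torsion A u ->
  forall y, u y <= crude_constant R d * nroot d #|A|%:R ^+ 2.
Proof.
have d0 : 0 < d%:R :> R by rewrite ltr0n.
rewrite /crude_constant; set c0 := (3 ^ d * d)%:R^-1.
set c1 := c0 / (4 * d%:R); set c2 := 4 * d%:R / c0; set e := d%:R * 2 ^+ d.-1.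
set h := Num.min 1 (c1 / e).
have c00 : 0 < c0 by rewrite invr_gt0 ltr0n muln_gt0 expn_gt0.
have c10 : 0 < c1 by rewrite divr_gt0 // mulr_gt0.
have c20 : 0 < c2 by rewrite divr_gt0 // mulr_gt0.
have e0 : 0 < e by rewrite mulr_gt0 // exprn_gt0.
have h0 : 0 < h by rewrite lt_min ltr01 divr_gt0.
have h1 : h <= 1 by rewrite ge_min lexx.
have he : h * e <= c1 by rewrite -ler_pdivlMr // ge_min lexx orbT.
move=> injK LK; move Am : #|A| => m; elim/ltn_ind: m A u Am => m IHm A u Am AL uA y.
have [u0 u_off _] := uA.
have rootE (E : {set G}) : nroot d #|E|%:R ^+ d = #|E|%:R :> R.
  by case: d d_gt0 => // k _; rewrite nrootK.
have root1 (E : {set G}) : E != finset.set0 -> 1 <= nroot d #|E|%:R :> R.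
  move=> E0; rewrite -(@ler_pXn2r _ d) ?nnegrE ?nroot_ge0 // rootE expr1n ler1n.
  by rewrite card_gt0.
have C0 : 0 < c2 / h by rewrite divr_gt0.
have [yA|/u_off ->] := boolP (y \in A); last by rewrite mulr_ge0 ?sqr_ge0 // ltW.
have A0 : A != finset.set0 by apply/finset.set0Pn; exists y.
set P := nroot d m%:R; have P1 : 1 <= P by rewrite /P -Am; exact: root1.
have PdE : P ^+ d = m%:R by rewrite /P -Am rootE.
pose tau := c2 * P; have tau0 : 0 < tau by rewrite mulr_gt0 // (lt_le_trans ltr01).
have [ytau|ytau] := leP (u y) tau.
  have hinv : 1 <= h^-1 by rewrite invf_ge1.
  apply: le_trans ytau _.
  have -> : c2 / h * P ^+ 2 = c2 * (h^-1 * P ^+ 2) by rewrite mulrA.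
  rewrite /tau ler_pM2l //.
  have : P <= P * P by rewrite ler_peMl // (le_trans ler01).
  have : P * P <= h^-1 * (P * P) by rewrite ler_peMl // mulr_ge0 // (le_trans ler01).
  rewrite expr2; lra.
pose E := above u tau;
have E0 : E != finset.set0 by apply/finset.set0Pn; exists y; rewrite in_above.
set Q := nroot d #|E|%:R : R; have Q1 : 1 <= Q by exact: root1.
have Q0 : 0 < Q by rewrite (lt_le_trans ltr01).
have EA : E \subset A.
  apply/fintype.subsetP => x; rewrite in_above; apply: contraTT => /u_off ->.
  by rewrite -leNgt ltW.
have EL : liftable L E by move=> x /(fintype.subsetP EA); exact: AL.
have EF := card_above_split uA (ltW tau0); rewrite Am -/E -(ler_nat R) natrD in EF.
have QP : Q <= P.
  rewrite -(@ler_pXn2r _ d) ?nnegrE ?nroot_ge0 // rootE PdE -Am ler_nat.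
  exact: subset_leq_card.
have per := perimeter_ge injK LK EL E0.
have drop := perimeter_le uA (ltW tau0); rewrite -/E in drop EF.
set F := #|_ :\: _|%:R in drop EF.
have QdE : Q ^+ d = Q * Q ^+ d.-1 by rewrite -exprS prednK.
have Qd0 : 0 < Q ^+ d.-1 by rewrite exprn_gt0.
have HF : c1 * Q ^+ d.-1 <= F.
  have per' : c0 * Q ^+ d.-1 <= perimeter E.
    by rewrite /c0 mulrC ler_pdivrMr 1?mulrC // ltr0n muln_gt0 expn_gt0.
  have tc : tau * c0 = 4 * d%:R * P by rewrite /tau /c2; field; rewrite gt_eqF.
  have : tau * (c0 * Q ^+ d.-1) <= 2 * d%:R * (Q * Q ^+ d.-1) + 2 * d%:R * tau * F.
    by rewrite -QdE rootE; apply: le_trans drop; rewrite ler_pM2l.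
  have : 2 * d%:R * (Q * Q ^+ d.-1) <= 2 * d%:R * (P * Q ^+ d.-1).
    by rewrite ler_pM2l ?mulr_gt0 // ler_pM2r.
  have -> : 2 * d%:R * (P * Q ^+ d.-1) = tau * (c0 * Q ^+ d.-1) / 2.
    by rewrite [tau * _]mulrA tc; field.
  have t2 : 0 < 2 * d%:R * tau by rewrite mulr_gt0 // mulr_gt0.
  move=> le1 le2; rewrite -(ler_pM2l t2).
  rewrite (_ : 2 * d%:R * tau * (c1 * _) = tau * (c0 * Q ^+ d.-1) / 2); first lra.
  by rewrite /c1; field; rewrite gt_eqF.
have gap : Q + h <= P.
  rewrite leNgt; apply/negP => PQ.
  have : P ^+ d < (Q + h) ^+ d.
    have Qh0 : 0 <= Q + h by rewrite addr_ge0 // ltW.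
    by rewrite ltr_pXn2r // nnegrE nroot_ge0.
  rewrite PdE => lt; have := le_lt_trans (le_trans (lerD (lexx #|E|%:R) HF) EF) lt.
  apply/negP; rewrite -leNgt -rootE -/Q.
  have := @exprS_tangent R d.-1 Q (Q + h) (ltW Q0) (addr_ge0 (ltW Q0) (ltW h0)).
  rewrite prednK // => tang.
  have pow : (Q + h) ^+ d.-1 <= 2 ^+ d.-1 * Q ^+ d.-1.
    by rewrite -exprMn lerXn2r ?nnegrE ?addr_ge0 ?mulr_ge0 ?(ltW Q0) ?(ltW h0) //; lra.
  have : h * (d%:R * (Q + h) ^+ d.-1) <= h * (e * Q ^+ d.-1).
    by rewrite ler_pM2l // /e -mulrA ler_pM2l.
  have : h * (e * Q ^+ d.-1) <= c1 * Q ^+ d.-1 by rewrite mulrA ler_pM2r.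
  move: tang; rewrite opprD addNKr; lra.
have ltEm : (#|E| < m)%N.
  rewrite -(ltr_nat R) -rootE -PdE ltr_pXn2r ?nnegrE ?nroot_ge0 //.
  by rewrite -/Q -/P (lt_le_trans _ gap) // ltrDl.
have := IHm _ ltEm E _ erefl EL (sub_torsion_cut uA (ltW tau0)) y.
rewrite max_l ?subr_ge0 ?(ltW ytau) // -/Q lerBlDr => /le_trans; apply.
have -> : tau = c2 / h * (h * P) by rewrite /tau; field; rewrite gt_eqF.
rewrite -mulrDr ler_pM2l //.
nra.
Qed.

End TorusIsoperimetry.

(** * Growth of the level sets in a band of levels *)

Section MaximumOverNeighbourhood.
Context {R : realType} {G : finZmodType} {d : nat}.
Variable iota : {additive 'rV[int]_d -> G}.
Implicit Types (f v : G -> R) (y : G) (i : 'I_d) (z : 'rV[int]_d).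
Hypothesis d_gt0 : (0 < d)%N.

Lemma band_lip (a b x y : R) : x <= y -> band a b y - band a b x <= y - x.
Proof.
move=> xy; have xy0 : 0 <= y - x by rewrite subr_ge0.
have lip : Num.max a y <= Num.max a x + (y - x).
  rewrite ge_max; apply/andP; split.
    by rewrite (le_trans (_ : a <= Num.max a x)) ?lerDl // le_max lexx.
  by rewrite -lerBlDr opprB addrC subrK le_max lexx orbT.
rewrite /band opprB addrA subrK lerBlDr addrC.
have [_|_] := leP b (Num.max a x); last by rewrite ge_min lip orbT.
by rewrite ge_min lerDl xy0.
Qed.

Lemma band_homo (a b x y : R) : x <= y -> band a b x <= band a b y.
Proof.
move=> xy; rewrite /band lerD2r le_min !ge_min lexx /=; apply/orP; right.
by rewrite ge_max !le_max lexx xy orbT.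
Qed.

Lemma chebyshev f p (c : R) : l2_le f p -> 0 < c ->
  #|finset (fun y => c <= `|f y|)|%:R * c ^+ 2 <= p ^+ 2.
Proof.
move=> [_ fp] c0; apply: le_trans fp; rewrite -sum1_card natr_sum mulr_suml big_mkcond /=.
apply: ler_sum => y _; rewrite inE; case: ifPn => [cf|_]; last exact: sqr_ge0.
by rewrite mul1r -(real_normK (num_real (f y))) ler_pXn2r // nnegrE ltW.
Qed.

(** Cauchy-Schwarz and the inequality of arithmetic and geometric means; the
    weight tau is chosen later. *)
Lemma dot_le (s : nat) z (g : 'I_d -> R) (tau : R) : (0 < s)%N -> 0 < tau ->
  z \in zball d s ->
  \sum_i (z ord0 i)%:~R * g i <= s%:R / 2 * (tau^-1 + tau * \sum_i g i ^+ 2).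
Proof.
move=> s0 tau0; rewrite mem_zball -(ler_int R) rmorph_sum rmorphXn /= -pmulrn => zs.
have s0' : 0 < s%:R :> R by rewrite ltr0n.
apply: le_trans (_ : \sum_i ((z ord0 i)%:~R ^+ 2 / (2 * tau * s%:R) +
    s%:R / 2 * tau * g i ^+ 2) <= _).
  apply: ler_sum => i _; rewrite -subr_ge0.
  have -> : (z ord0 i)%:~R ^+ 2 / (2 * tau * s%:R) + s%:R / 2 * tau * g i ^+ 2 -
      (z ord0 i)%:~R * g i =
    ((z ord0 i)%:~R - tau * s%:R * g i) ^+ 2 / (2 * tau * s%:R).
    by field; rewrite !gt_eqF.
  by rewrite divr_ge0 ?sqr_ge0 // !mulr_ge0 // ltW.
rewrite big_split /= -mulr_suml -mulr_sumr mulrDr mulrA lerD2r.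
have -> : s%:R / 2 / tau = s%:R ^+ 2 / (2 * tau * s%:R) by field; rewrite !gt_eqF.
rewrite ler_wpM2r ?invr_ge0 ?mulr_ge0 ?(ltW tau0) ?(ltW s0') //.
by apply: le_trans zs; apply: ler_sum => i _; rewrite rmorphXn.
Qed.

Lemma zball_coord s z i : z \in zball d s -> `|z ord0 i| <= s%:Z.
Proof. by rewrite !inE /= => /andP[/mem_zbox]. Qed.

Lemma dot_abs_le (s : nat) z (g : 'I_d -> R) : z \in zball d s ->
  \sum_i (z ord0 i)%:~R * g i <= s%:R * \sum_i `|g i|.
Proof.
move=> zs; rewrite mulr_sumr; apply: ler_sum => i _.
apply: le_trans (ler_norm _) _; rewrite normrM ler_wpM2r //.
by rewrite -intr_norm pmulrn ler_int (zball_coord i zs).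
Qed.

(** A corner of the unit cube has norm at most sqrt d, hence at most d. *)
Lemma zball_shrink (k : nat) (x e : 'rV[int]_d) : x \in zball d (k + d) ->
  cube_corner e -> - (x + e) \in zball d (k + 2 * d).
Proof.
move=> xk e01; have xi i := zball_coord i xk; move: xk; rewrite !mem_zball => xk.
apply: le_trans (_ : \sum_i (x ord0 i ^+ 2 + (2 * (k + d)%:Z + 1)) <= _).
  apply: ler_sum => i _; rewrite !mxE sqrrN; have := xi i; rewrite ler_norml => /andP[lo hi].
  by have /forallP/(_ i)/orP[/eqP ->|/eqP ->] := e01; rewrite ?addr0 ?sqrrD ?expr1n; lra.
rewrite big_split /= sumr_const card_ord.
apply: le_trans (lerD xk (lexx _)) _.
have -> : (2 * (k + d)%:Z + 1) *+ d = (2 * (k%:Z + d%:Z) + 1) * d%:Z.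
  by rewrite PoszD -[LHS]mulr_natr (natz d).
rewrite -subr_ge0 (_ : _ - _ = d%:Z * (d%:Z - 1)); last by rewrite mul2n -addnn !PoszD; ring.
by rewrite mulr_ge0 // subr_ge0 lez_nat.
Qed.

(** The maximum of v over y + W; the initial value v y of the iteration is the term
    of z = 0 for the sets W used here. *)
Definition sup_over (W : {fset 'rV[int]_d}) v : G -> R :=
  fun y => \big[Num.max/v y]_(z <- enum_fset W) v (y + iota z).

Lemma sup_over_ge W v y z : z \in W -> v (y + iota z) <= sup_over W v y.
Proof.
rewrite /sup_over -[z \in W]/(z \in enum_fset W); elim: (enum_fset W) => //= z' s IHs.
rewrite in_cons big_cons le_max => /predU1P[->|/IHs ->]; first by rewrite lexx.
by rewrite orbT.
Qed.

Lemma sup_over_attained W v y : 0 \in W ->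
  exists2 z, z \in W & sup_over W v y = v (y + iota z).
Proof.
move=> W0; rewrite /sup_over.
suff H (s : seq 'rV[int]_d) : {subset s <= W} ->
  exists2 z, z \in W & \big[Num.max/v y]_(z <- s) v (y + iota z) = v (y + iota z) by exact: H.
elim: s => [|z' s IHs] sW; first by exists 0 => //; rewrite big_nil raddf0 addr0.
have [z zW zE] : exists2 z, z \in W & \big[Num.max/v y]_(z <- s) v (y + iota z) = v (y + iota z).
  by apply: IHs => x xs; apply: sW; rewrite in_cons xs orbT.
rewrite big_cons zE; case: (leP (v (y + iota z')) (v (y + iota z))) => _.
  by exists z.
by exists z' => //; apply: sW; rewrite in_cons eqxx.
Qed.

Lemma above_sup_over W v (t : R) : 0 \in W -> above (sup_over W v) t = thick iota W (above v t).
Proof.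
move=> W0; apply/setP => y; rewrite in_above; apply/idP/thickP => [|[z zW]].
  by have [z zW ->] := sup_over_attained v y W0; exists z; rewrite // in_above.
by rewrite in_above => /lt_le_trans; apply; exact: sup_over_ge.
Qed.

End MaximumOverNeighbourhood.

Section BandInequality.
Context {R : realType} {G : finZmodType} {d : nat}.
Variable iota : {additive 'rV[int]_d -> G}.
Implicit Types (f g u v w : G -> R) (y : G) (i j : 'I_d) (z : 'rV[int]_d).
Local Notation step := (step iota).
Local Notation grad := (grad iota).
Local Notation neglap := (neglap iota).
Hypothesis d_gt0 : (0 < d)%N.

Definition sqgrad v y : R := \sum_i grad v i y ^+ 2.

Lemma sqgrad_ge0 v y : 0 <= sqgrad v y.
Proof. by apply: sumr_ge0 => i _; rewrite sqr_ge0. Qed.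

(** Points of the band where no difference of v leaves the enlarged band: there
    the energy of v is that of its truncation, which the equation controls. *)
Definition flat_band v (a b : R) : {set G} :=
  finset (fun y => [&& a < v y, v y < b & [forall i, `|grad v i y| <= a / 2]]).

(** The equation is tested against the truncation psi of v; the products of
    differences of v and psi are nonnegative, and are squares on the flat band. *)
Lemma flat_energy_le v (a b : R) : 0 < a -> 0 < b -> (forall y, 0 <= v y) ->
  (forall y, neglap v y <= 2 * d%:R) ->
  \sum_(y in flat_band v a b) sqgrad v y <= 2 * d%:R * b * #|above v (a / 2)|%:R.
Proof.
move=> a0 b0 v0 vL; pose psi y := band (a / 2) (b + a / 2) (v y).
have ab2 : a / 2 <= b + a / 2 by rewrite lerDr ltW.
have psi_ge0 y : 0 <= psi y by exact: band_ge0.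
have psi_le y : psi y <= b * set_indicator (above v (a / 2)) y.
  rewrite /set_indicator in_above /psi; case: ltP => [_|va]; last by rewrite mulr0 band_low.
  by rewrite mulr1 (le_trans (band_le _ _ _)) // addrK.
apply: le_trans (_ : \sum_i \sum_y grad v i y * grad psi i y <= _).
  rewrite [leRHS]exchange_big [leLHS]big_mkcond /=; apply: ler_sum => y _.
  have mono i : 0 <= grad v i y * grad psi i y.
    rewrite !gradE /psi; have [vy|/ltW vy] := leP (v y) (v (y + step i)).
      by rewrite mulr_ge0 // subr_ge0 // band_homo.
    by rewrite mulr_le0 // subr_le0 // band_homo.
  case: ifPn => [|_]; last by apply: sumr_ge0.
  rewrite inE => /and3P[av vb /forallP flat]; apply: ler_sum => i _.
  have := flat i; rewrite !gradE ler_norml => /andP[lo hi].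
  by rewrite /psi !band_mid ?expr2 //; lra.
rewrite green_identity.
apply: le_trans (_ : \sum_y b * set_indicator (above v (a / 2)) y * (2 * d%:R) <= _).
  apply: ler_sum => y _; apply: le_trans (ler_wpM2l (psi_ge0 y) (vL y)) _.
  by rewrite ler_wpM2r ?psi_le // mulr_ge0.
rewrite -mulr_suml -mulr_sumr sum_set_indicator le_eqVlt; apply/orP; left.
by apply/eqP; ring.
Qed.

(** The isoperimetric input: at each level t between 2a and b, passing from v to its
    maximum over lattice balls thickens {v > t} by a ball, and the gain
    is integrated over t. *)
Lemma layers_grow K L k v (a b p : R) : (0 < k)%N -> 0 < a -> 2 * a < b ->
  {in zbox d K &, injective iota} -> (L + (k + 2 * d) <= K)%N ->
  (forall y, v y != 0 -> exists2 z, z \in zbox d L & y = iota z) ->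
  0 < p -> p ^+ d <= #|finset (fun y => b <= v y)|%:R ->
  d%:R * p ^+ d.-1 * (nroot d (omega R d) * k%:R) * (b - 2 * a) +
    \sum_y band (2 * a) b (v y) <=
  \sum_y band (2 * a) b (sup_over iota (zball d (k + 2 * d)) v y).
Proof.
move=> k0 a0 ab injK LK vL p0 pb; apply: layer_cake => // t ta tb.
have W0 : 0 \in zball d (k + 2 * d).
  by rewrite mem_zball big1 ?sqr_ge0 // => i _; rewrite mxE expr0n.
set W := zball d _ in W0 *.
have cardE (S : pred G) : #|[pred y | S y]| = #|finset S|.
  by apply: eq_card => y; rewrite inE.
rewrite (cardE (fun y => t < v y)) (cardE (fun y => t < sup_over iota W v y)).
rewrite -/(above v t) -/(above (sup_over iota W v) t) above_sup_over //.
pose om := nroot d (omega R d).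
have rootE (x : R) : 0 <= x -> nroot d x ^+ d = x by case: d d_gt0 => // n _; exact: nrootK.
have q0 : 0 <= om * k%:R by rewrite mulr_ge0 ?nroot_ge0.
have qY : (om * k%:R) ^+ d <= #|` zball d (k + d)|%fset%:R.
  by rewrite exprMn rootE ?card_zball_ge // ltW // omega_gt0.
have Y0 : zball d (k + d) != fset0.
  apply/fset0Pn; exists 0; rewrite mem_zball big1 ?sqr_ge0 // => i _.
  by rewrite mxE expr0n.
have sub : finset (fun y => b <= v y) \subset above v t.
  by apply/fintype.subsetP => y; rewrite !inE; exact: lt_le_trans.
have pt : p ^+ d <= #|above v t|%:R.
  by apply: le_trans pb _; rewrite ler_nat subset_leq_card.
have E0 : above v t != finset.set0.
  by rewrite -card_gt0 -(ltr_nat R); apply: lt_le_trans pt; rewrite exprn_gt0.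
have EL y : y \in above v t -> exists2 z, z \in zbox d L & y = iota z.
  rewrite in_above => tv; apply: vL; rewrite gt_eqF //.
  by apply: le_lt_trans tv; apply: le_trans ta; rewrite mulr_ge0 // ltW.
have WM z : z \in W -> z \in zbox d (k + 2 * d) by rewrite !inE /= => /andP[].
have YW (x e : 'rV[int]_d) : x \in zball d (k + d) -> cube_corner e -> - (x + e) \in W.
  exact: zball_shrink.
apply: le_trans (thick_card d_gt0 injK LK EL WM YW E0 Y0 q0 qY).
rewrite addrC lerD2l; apply: ler_wpM2r => //; rewrite ler_pM2l ?ltr0n //.
rewrite lerXn2r ?nnegrE ?nroot_ge0 ?(ltW p0) //.
by rewrite -(@ler_pXn2r _ d) ?nnegrE ?nroot_ge0 ?(ltW p0) // rootE.
Qed.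

Definition taylor_error (W : {fset 'rV[int]_d}) v : G -> R :=
  fun y => \sum_(z <- enum_fset W) `|taylor_rest iota v z y|.

Lemma l2_taylor_error s v (kap : R) : 0 <= kap ->
  (forall i j, l2_le (grad (grad v i) j) kap) ->
  l2_le (taylor_error (zball d s) v) (#|` zball d s|%fset%:R * ((d * s)%:R ^+ 2 * kap)).
Proof.
move=> kap0 Hv; have p0 : 0 <= (d * s)%:R ^+ 2 * kap by rewrite mulr_ge0 ?sqr_ge0.
pose F z := if z \in zball d s then fun y => `|taylor_rest iota v z y| else fun=> 0.
have HF z : l2_le (F z) ((d * s)%:R ^+ 2 * kap).
  rewrite /F; case: ifPn => [zs|_]; last exact: l2_le_mono p0 l2_le0.
  apply: l2_le_mono (_ : (l1 z)%:R ^+ 2 * kap <= _) _.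
    rewrite ler_wpM2r // ler_pXn2r ?nnegrE // ler_nat l1_zbox //.
    by move: zs; rewrite !inE /= => /andP[].
  by apply: l2_le_abs (l2_taylor kap0 Hv z) => y; rewrite normr_id.
have := l2_le_sum (enum_fset (zball d s)) p0 HF.
congr l2_le; apply/funext => y; rewrite /taylor_error big_seq [RHS]big_seq.
by apply: eq_bigr => z zs; rewrite /F -[z \in zball _ _]/(z \in enum_fset _) zs.
Qed.

Lemma sup_over_increment s v y (tau : R) : (0 < s)%N -> 0 < tau ->
  sup_over iota (zball d s) v y - v y <=
  s%:R / 2 * (tau^-1 + tau * sqgrad v y) + taylor_error (zball d s) v y.
Proof.
move=> s0 tau0; have W0 : 0 \in zball d s.
  by rewrite mem_zball big1 ?sqr_ge0 // => i _; rewrite mxE expr0n.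
have [z zs ->] := sup_over_attained iota v y W0.
have := dot_le (grad v ^~ y) s0 tau0 zs; rewrite -/(sqgrad v y) => dot.
have rest : taylor_rest iota v z y <= taylor_error (zball d s) v y.
  rewrite /taylor_error (big_rem z) //=; apply: le_trans (ler_norm _) _.
  by rewrite lerDl sumr_ge0.
by move: rest dot; rewrite /taylor_rest; lra.
Qed.

Lemma l2_sup_over_increment s v (eps pe : R) :
  (forall i, l2_le (grad v i) eps) -> l2_le (taylor_error (zball d s) v) pe -> 0 <= eps ->
  l2_le (fun y => sup_over iota (zball d s) v y - v y) (s%:R * (d%:R * eps) + pe).
Proof.
move=> Hv He eps0; have W0 : 0 \in zball d s.
  by rewrite mem_zball big1 ?sqr_ge0 // => i _; rewrite mxE expr0n.
have Habs : l2_le (fun y => \sum_i `|grad v i y|) (d%:R * eps).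
  apply: l2_le_sum_ord => // i; apply: l2_le_abs (Hv i) => y; by rewrite normr_id.
have := l2_leD (l2_leZ s%:R Habs) He; rewrite ger0_norm //; apply: l2_le_abs => y.
have w_ge : v y <= sup_over iota (zball d s) v y.
  by have := sup_over_ge iota v y W0; rewrite raddf0 addr0.
rewrite ger0_norm ?subr_ge0 // ger0_norm; last first.
  by rewrite addr_ge0 ?mulr_ge0 ?sumr_ge0.
have [z zs ->] := sup_over_attained iota v y W0.
have := dot_abs_le (grad v ^~ y) zs.
have : taylor_rest iota v z y <= taylor_error (zball d s) v y.
  rewrite /taylor_error (big_rem z) //=; apply: le_trans (ler_norm _) _.
  by rewrite lerDl sumr_ge0.
by rewrite /taylor_rest; lra.
Qed.

(** Four cases. Above the band nothing changes; below a, crossing up to 2a requires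
    an increment of at least a, and the increment is at most its square over a;
    on the flat band the increment is bounded through the gradient; elsewhere a
    difference of v exceeds a/2 and the last term exceeds the width of the band. *)
Lemma band_increment s v (a b tau mu : R) y : (0 < s)%N -> 0 < tau -> 0 < mu ->
  0 < a -> 2 * a < b ->
  band (2 * a) b (sup_over iota (zball d s) v y) - band (2 * a) b (v y) <=
    (s%:R / (2 * tau) + mu) * set_indicator (finset (fun y => (a < v y) && (v y < b))) y +
    s%:R * tau / 2 * (if y \in flat_band v a b then sqgrad v y else 0) +
    taylor_error (zball d s) v y ^+ 2 / mu +
    (sup_over iota (zball d s) v y - v y) ^+ 2 / a + 4 * b / a ^+ 2 * sqgrad v y.
Proof.
move=> s0 tau0 mu0 a0 ab; set w := sup_over iota (zball d s) v.
set e := taylor_error (zball d s) v; have b0 : 0 < b by lra.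
have W0 : 0 \in zball d s.
  by rewrite mem_zball big1 ?sqr_ge0 // => i _; rewrite mxE expr0n.
have w_ge : v y <= w y by have := sup_over_ge iota v y W0; rewrite raddf0 addr0.
have lip := band_lip (2 * a) b w_ge; have ab' : 2 * a <= b by exact: ltW.
have s0' : 0 < s%:R :> R by rewrite ltr0n.
have g0 := sqgrad_ge0 v y.
set t1 := _ * set_indicator _ _; set t2 := _ * (if _ then _ else _).
set t3 := _ / mu; set t4 := _ / a; set t5 := 4 * b / _ * _.
have t1_0 : 0 <= t1 by rewrite mulr_ge0 ?ler0n // addr_ge0 ?divr_ge0 ?mulr_ge0 ?ltW.
have t2_0 : 0 <= t2.
  by rewrite mulr_ge0 ?divr_ge0 ?mulr_ge0 ?(ltW tau0) //; case: ifP.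
have t3_0 : 0 <= t3 by rewrite divr_ge0 ?sqr_ge0 // ltW.
have t4_0 : 0 <= t4 by rewrite divr_ge0 ?sqr_ge0 // ltW.
have t5_0 : 0 <= t5 by rewrite mulr_ge0 // divr_ge0 ?sqr_ge0 // mulr_ge0 // ltW.
have [bv|vb] := leP b (v y).
  by rewrite !band_high // ?(le_trans bv) // subrr !addr_ge0.
have [va|av] := leP (v y) a.
  rewrite [band _ _ (v y)]band_low //; last by lra.
  have [wa|aw] := leP (w y) (2 * a); first by rewrite band_low // subr0 !addr_ge0.
  suff : band (2 * a) b (w y) <= t4 by lra.
  have h1 : band (2 * a) b (w y) <= w y - 2 * a.
    by rewrite /band lerB // ge_min ge_max lexx (ltW aw) orbT.
  rewrite /t4 ler_pdivlMr //; apply: le_trans (_ : (w y - v y) * a <= _).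
    by rewrite ler_pM2r //; lra.
  by rewrite expr2 ler_wpM2l; lra.
have t1E : t1 = s%:R / (2 * tau) + mu by rewrite /t1 /set_indicator inE av vb mulr1.
have [flat|steep] := boolP [forall i, `|grad v i y| <= a / 2].
  have t2E : t2 = s%:R * tau / 2 * sqgrad v y by rewrite /t2 inE av vb flat.
  have inc := sup_over_increment v y s0 tau0; rewrite -/w -/e in inc.
  have e_le : e y <= mu + t3.
    have [emu|mue] := leP (e y) mu; first by lra.
    suff : e y <= t3 by lra.
    rewrite /t3 ler_pdivlMr // expr2; apply: ler_wpM2l; last exact: ltW.
    exact: ltW (lt_trans mu0 mue).
  have sE : s%:R / 2 * (tau^-1 + tau * sqgrad v y) =
    s%:R / (2 * tau) + s%:R * tau / 2 * sqgrad v y by field; rewrite gt_eqF.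
  by move: inc; rewrite sE t1E t2E; lra.
suff : b <= t5 by have := band_le (2 * a) b (w y); have := band_ge0 (v y) ab'; lra.
move: steep; rewrite negb_forall => /existsP[i]; rewrite -ltNge => steep.
have ga : (a / 2) ^+ 2 <= sqgrad v y.
  apply: le_trans (_ : grad v i y ^+ 2 <= _).
    rewrite -(real_normK (num_real (grad v i y))) ler_pXn2r ?nnegrE //; first exact: ltW.
    by rewrite divr_ge0 // ltW.
  by rewrite /sqgrad (bigD1 i) //= lerDl sumr_ge0 // => j _; rewrite sqr_ge0.
have -> : b = 4 * b / a ^+ 2 * (a / 2) ^+ 2 by field; rewrite gt_eqF.
by rewrite /t5 ler_wpM2l // divr_ge0 ?sqr_ge0 // mulr_ge0 // ltW.
Qed.

Lemma sum_sqgrad_le v (eps : R) : (forall i, l2_le (grad v i) eps) ->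
  \sum_y sqgrad v y <= d%:R * eps ^+ 2.
Proof.
move=> Hv; rewrite exchange_big /=.
have -> : d%:R * eps ^+ 2 = \sum_(i < d) eps ^+ 2 by rewrite sumr_const card_ord mulr_natl.
by apply: ler_sum => i _; have [_] := Hv i.
Qed.

(** The number X of points of the band is bounded from below. Nb and X refer to the
    smoothed function; kap bounds the number of points where smoothing moves u by
    a/2 or more, by Chebyshev, and pe bounds the l2 norm of the Taylor remainders. *)
Lemma band_inequality K L k l s A u (eps a b tau mu kap pe : R) :
  (0 < k)%N -> (0 < l)%N -> s = (k + 2 * d)%N -> (L + d * l + s <= K)%N ->
  {in zbox d K &, injective iota} -> liftable iota L A -> sub_torsion iota A u ->
  0 < tau -> 0 < mu -> 0 < a -> 2 * a < b -> (forall i, l2_le (grad u i) eps) ->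
  kap = 4 * (d%:R * (l%:R * eps)) ^+ 2 / a ^+ 2 ->
  pe = #|` zball d s|%fset%:R * ((d * s)%:R ^+ 2 * (2 * eps / l%:R)) ->
  exists Nb X : nat, [/\ #|above u (a + b)|%:R <= Nb%:R + kap,
    X%:R + Nb%:R <= #|A|%:R + kap &
    forall p, 0 < p -> p ^+ d <= Nb%:R ->
      d%:R * p ^+ d.-1 * (nroot d (omega R d) * k%:R) * (b - 2 * a) <=
      X%:R * (s%:R / (2 * tau) + mu) +
      s%:R * tau / 2 * (2 * d%:R * b * (#|A|%:R + kap)) +
      pe ^+ 2 / mu + (s%:R * (d%:R * eps) + pe) ^+ 2 / a +
      4 * b / a ^+ 2 * (d%:R * eps ^+ 2)].
Proof.
move=> k0 l0 sE LK injK AL uA tau0 mu0 a0 ab Hu kapE peE.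
have b0 : 0 < b by lra.
have eps0 : 0 <= eps by case: (Hu (Ordinal d_gt0)).
have s0 : (0 < s)%N by rewrite sE addn_gt0 k0.
have l0' : 0 < l%:R :> R by rewrite ltr0n.
have [u0 u_off _] := uA.
pose v := smooth iota l (enum 'I_d) u.
have v0 y : 0 <= v y by exact: smooth_ge0.
have vL y : neglap v y <= 2 * d%:R.
  by apply: neglap_smooth_le => // x; exact: (sub_torsion_neglap uA).
have Hv i : l2_le (grad v i) eps by rewrite /v grad_smooth; exact: l2_smooth.
have Hvv i j : l2_le (grad (grad v i) j) (2 * eps / l%:R).
  by rewrite /v (grad_smooth _ _ _ _ i); apply: l2_grad_smooth => //; rewrite mem_enum.
have Huv : l2_le (fun y => v y - u y) (d%:R * (l%:R * eps)).
  have := l2_smooth_close l0 (enum 'I_d) eps0 Hu; by rewrite size_enum_ord.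
have kap2_0 : 0 <= 2 * eps / l%:R by rewrite divr_ge0 ?mulr_ge0 // ltW.
have He : l2_le (taylor_error (zball d s) v) pe by rewrite peE; exact: l2_taylor_error.
pose far (c : R) := finset (fun y => c <= `|v y - u y|).
have far_le : #|far (a / 2)|%:R <= kap.
  have := chebyshev Huv (_ : 0 < a / 2); rewrite divr_gt0 // => /(_ isT).
  rewrite kapE ler_pdivlMr ?exprn_gt0 // => H.
  by rewrite /far; move: H; rewrite expr_div_n; lra.
have vsupp y : v y != 0 -> exists2 z, z \in zbox d (L + d * l) & y = iota z.
  have := @smooth_supp _ _ _ iota l (enum 'I_d) u L l0; rewrite size_enum_ord; apply.
  by move=> x ux; apply: AL; apply: contraR ux => /u_off ->; rewrite eqxx.
have av : #|above v (a / 2)|%:R <= #|A|%:R + kap.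
  apply: le_trans (_ : (#|A| + #|far (a / 2)|)%:R <= _); last by rewrite natrD lerD2l.
  rewrite ler_nat; apply: leq_trans (leq_card_setU _ _).1.
  apply/subset_leq_card/fintype.subsetP => y; rewrite !inE => vy.
  have [//|/u_off uy] := boolP (y \in A); rewrite /= uy subr0 ger0_norm //; exact: ltW.
exists #|finset (fun y => b <= v y)|, #|finset (fun y => (a < v y) && (v y < b))|; split.
- apply: le_trans (_ : (#|finset (fun y => b <= v y)| + #|far (a / 2)|)%:R <= _).
    rewrite ler_nat; apply: leq_trans (leq_card_setU _ _).1.
    apply/subset_leq_card/fintype.subsetP => y; rewrite !inE => uy.
    have [//|vb] := leP b (v y); rewrite /= ler_normr opprB.
    by apply/orP; right; lra.
  by rewrite natrD lerD2l.
- apply: le_trans av; rewrite -natrD ler_nat -cardsUI.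
  rewrite [X in (_ + X)%N](_ : _ = 0%N) ?addn0.
    apply/subset_leq_card/fintype.subsetP => y; rewrite !inE => /orP[/andP[]|]; lra.
  apply/eqP; rewrite cards_eq0 -finset.subset0; apply/fintype.subsetP => y; rewrite !inE.
  by case/andP => /andP[_ yb]; rewrite leNgt yb.
move=> p p0 pb; rewrite sE in LK.
have := layers_grow k0 a0 ab injK LK vsupp p0 pb; rewrite -sE => grow.
have {grow} : d%:R * p ^+ d.-1 * (nroot d (omega R d) * k%:R) * (b - 2 * a) <=
    \sum_y (band (2 * a) b (sup_over iota (zball d s) v y) - band (2 * a) b (v y)).
  by rewrite sumrB lerBrDr.
move=> /le_trans; apply.
apply: le_trans (ler_sum _ (fun y _ => band_increment v y s0 tau0 mu0 a0 ab)) _.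
rewrite !big_split /= -!mulr_sumr -!mulr_suml sum_set_indicator.
have [_ e2] := He; have [_ D2] := l2_sup_over_increment Hv He eps0.
have flat := flat_energy_le a0 b0 v0 vL.
have c1 : 0 <= s%:R * tau / 2 by rewrite divr_ge0 // mulr_ge0 // ltW.
have c2 : 0 <= 4 * b / a ^+ 2 by rewrite divr_ge0 ?sqr_ge0 // mulr_ge0 // ltW.
rewrite mulrC; apply: lerD; last by rewrite ler_wpM2l // sum_sqgrad_le.
apply: lerD; last by rewrite ler_wpM2r // invr_ge0 ltW.
apply: lerD; last by rewrite ler_wpM2r // invr_ge0 ltW.
rewrite lerD2l ler_wpM2l // -big_mkcond /=; apply: le_trans flat _.
by rewrite ler_wpM2l // !mulr_ge0 // ltW.
Qed.

End BandInequality.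

(** * The loss of radius in one step *)

Section SharpStep.
Context {R : realType}.

(** Large enough to absorb all the error terms of order e in [gap_arith]. *)
Definition gap_constant (D K k1 B : R) : R :=
  2 * (D * K * (D * K ^+ 2 / 2 + k1 + 2 * D + 3) + 2 * k1 / K + D * K ^+ 2 / 2 + 2 * k1 +
    D * K * k1 / 2 + B + 1) / (D * K).

Lemma gap_constant_ge0 (D K k1 B : R) : 0 < D -> 0 < K -> 0 <= k1 -> 0 <= B ->
  0 <= gap_constant D K k1 B.
Proof.
move=> D0 K0 k10 B0; have DK0 : 0 < D * K by rewrite mulr_gt0.
rewrite /gap_constant divr_ge0 ?(ltW DK0) // mulr_ge0 //.
have h1 : 0 < D * K ^+ 2 by rewrite mulr_gt0 // exprn_gt0.
have h2 : 0 <= k1 / K by rewrite divr_ge0 // ltW.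
have h3 : 0 <= D * K * k1 by rewrite mulr_ge0 // ltW.
have h4 : 0 <= D * K * (D * K ^+ 2 / 2 + k1 + 2 * D + 3).
  by rewrite mulr_ge0 ?(ltW DK0) //; lra.
lra.
Qed.

(** Divided by the (d+1)-st power of the radius, and with e = 1/s, the band
    inequality is contradicted by a relative loss of radius below eta. Here x, xi
    and kp are the relative sizes of the band, of the set below its
    upper end and of the exceptional set of the smoothing. *)
Lemma gap_arith (D K k1 B e x xi kp eta : R) : 0 < D -> 0 < K -> 0 <= k1 -> 0 <= B ->
  0 < e -> e <= 1 -> 0 <= xi -> xi <= 1 -> 2 * D * e <= 1 -> 3 * e <= 1 ->
  xi <= D * eta + kp -> 0 <= x -> x <= D * eta + 2 * kp -> 0 <= kp -> kp <= k1 * e ^+ 2 ->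
  eta = K ^+ 2 * e / 2 * (1 - gap_constant D K k1 B * e) -> 0 <= eta ->
  x * (1 / (K * e) + e) + D * K / 2 * (1 + kp) + B * e <
  D * K * (1 - xi) * (1 - 2 * D * e) * (1 - 3 * e).
Proof.
move=> D0 K0 k10 B0 e0 e1 xi0 xi1 De1 e31 xiE x0 xE kp0 kpE etaE eta0.
set C := gap_constant _ _ _ _ in etaE.
have DK0 : 0 < D * K by rewrite mulr_gt0.
have CE : D * K * C / 2 = D * K * (D * K ^+ 2 / 2 + k1 + 2 * D + 3) + 2 * k1 / K +
    D * K ^+ 2 / 2 + 2 * k1 + D * K * k1 / 2 + B + 1.
  by rewrite /C /gap_constant; field; rewrite !gt_eqF.
have K20 : 0 < K ^+ 2 by rewrite exprn_gt0.
have C0 : 0 <= C by exact: gap_constant_ge0.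
have e20 : e ^+ 2 <= e by rewrite expr2 ler_piMr // ltW.
have kpe : kp <= k1 * e by apply: le_trans kpE _; rewrite ler_wpM2l.
have eta_le : eta <= K ^+ 2 * e / 2.
  have Ce0 : 0 <= C * e by rewrite mulr_ge0 // ltW.
  rewrite etaE; apply: ler_piMr; last by lra.
  by rewrite divr_ge0 // mulr_ge0 // ltW.
have Deta : D * eta <= D * (K ^+ 2 * e / 2) by rewrite ler_pM2l.
have prod : 1 - xi - 2 * D * e - 3 * e <= (1 - xi) * (1 - 2 * D * e) * (1 - 3 * e).
  have De0 : 0 <= 2 * D * e by rewrite !mulr_ge0 // ltW.
  have h1 : 1 - xi - 2 * D * e <= (1 - xi) * (1 - 2 * D * e).
    by rewrite mulrBl mul1r mulrBr mulr1; have := mulr_ge0 xi0 De0; lra.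
  have h2 : (1 - xi) * (1 - 2 * D * e) <= 1 by rewrite mulr_ile1 //; lra.
  have e30 : 0 <= 3 * e by rewrite mulr_ge0 // ltW.
  have := ler_wpM2r e30 h2; rewrite mul1r [_ * (1 - 3 * e)]mulrBr mulr1; lra.
have {prod} lhs : D * K * (1 - (D * K ^+ 2 / 2 + k1 + 2 * D + 3) * e) <=
    D * K * (1 - xi) * (1 - 2 * D * e) * (1 - 3 * e).
  rewrite (_ : _ * (1 - 3 * e) = D * K * ((1 - xi) * (1 - 2 * D * e) * (1 - 3 * e))).
    by rewrite ler_pM2l //; apply: le_trans prod; lra.
  by ring.
apply: lt_le_trans lhs.
have t1 : x * (1 / (K * e)) <= D * K / 2 * (1 - C * e) + 2 * k1 / K * e.
  apply: le_trans (_ : (D * eta + 2 * (k1 * e ^+ 2)) * (1 / (K * e)) <= _).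
    by rewrite ler_wpM2r ?divr_ge0 ?mulr_ge0 ?(ltW K0) ?(ltW e0) //; lra.
  by rewrite etaE le_eqVlt; apply/orP; left; apply/eqP; field; rewrite !gt_eqF.
have t2 : x * e <= (D * K ^+ 2 / 2 + 2 * k1) * e.
  rewrite ler_pM2r //; have : K ^+ 2 * e <= K ^+ 2 by rewrite ler_piMr // ltW.
  have : k1 * e <= k1 by rewrite ler_piMr.
  have : D * (K ^+ 2 * e / 2) <= D * (K ^+ 2 / 2) by rewrite ler_pM2l //; nra.
  lra.
have t3 : D * K / 2 * kp <= D * K / 2 * (k1 * e) by rewrite ler_pM2l // divr_gt0.
have CEe : D * K / 2 * (C * e) = (D * K * (D * K ^+ 2 / 2 + k1 + 2 * D + 3) + 2 * k1 / K +
    D * K ^+ 2 / 2 + 2 * k1 + D * K * k1 / 2 + B + 1) * e by rewrite -CE; field.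
rewrite mulrDr; move: t1 t2 t3 CEe; lra.
Qed.

(** The main terms of the band inequality are of order q r, where q = r^d; the
    errors are smaller by a factor S because S^6 <= r. *)
Lemma error_terms (D B0 B1 S r q eps pe : R) :
  0 <= D -> 0 <= B0 -> 0 <= B1 -> 1 <= S -> S ^+ 6 <= r -> 0 < q -> 0 <= eps -> 0 <= pe ->
  eps ^+ 2 = B0 * q * r ^+ 2 -> pe ^+ 2 <= B1 * q * r ^+ 2 / S ^+ 2 ->
  pe ^+ 2 / (r / S) + (S * (D * eps) + pe) ^+ 2 / (r ^+ 2 / S ^+ 2) +
    4 * (r ^+ 2 / S - r ^+ 2 / S ^+ 2) / (r ^+ 2 / S ^+ 2) ^+ 2 * (D * eps ^+ 2) <=
  (3 * B1 + 2 * D ^+ 2 * B0 + 4 * D * B0) * (q * r / S).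
Proof.
move=> D0 B00 B10 S1 Sr q0 eps0 pe0 epsE peE.
have S0 : 0 < S by exact: lt_le_trans S1.
have pow m : (m <= 6)%N -> S ^+ m <= r.
  by move=> m6; apply: le_trans Sr; rewrite ler_weXn2l.
have r0 : 0 < r by apply: lt_le_trans (pow 0%N isT); rewrite expr0.
have qrS : 0 < q * r / S by rewrite divr_gt0 // mulr_gt0.
have t1 : pe ^+ 2 / (r / S) <= B1 * (q * r / S).
  rewrite ler_pdivrMr ?divr_gt0 //; apply: le_trans peE _.
  by rewrite le_eqVlt; apply/orP; left; apply/eqP; field; rewrite !gt_eqF.
have unit_le m : (m <= 5)%N -> q * S ^+ m <= q * r / S.
  move=> m5; rewrite -mulrA ler_pM2l // ler_pdivlMr // -exprSr.
  exact: pow.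
have t2 : (S * (D * eps) + pe) ^+ 2 / (r ^+ 2 / S ^+ 2) <=
    (2 * B1 + 2 * D ^+ 2 * B0) * (q * r / S).
  apply: le_trans (_ : (2 * (S ^+ 2 * D ^+ 2 * (B0 * q * r ^+ 2)) +
      2 * (B1 * q * r ^+ 2 / S ^+ 2)) / (r ^+ 2 / S ^+ 2) <= _).
    rewrite ler_wpM2r ?invr_ge0 ?divr_ge0 ?exprn_ge0 ?(ltW r0) ?(ltW S0) //.
    rewrite -epsE; have := sqr_ge0 (S * (D * eps) - pe); move: peE.
    have -> : S ^+ 2 * D ^+ 2 * eps ^+ 2 = (S * (D * eps)) ^+ 2 by ring.
    by rewrite sqrrB sqrrD; lra.
  have -> : (2 * (S ^+ 2 * D ^+ 2 * (B0 * q * r ^+ 2)) + 2 * (B1 * q * r ^+ 2 / S ^+ 2)) /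
     (r ^+ 2 / S ^+ 2) = 2 * D ^+ 2 * B0 * (q * S ^+ 4) + 2 * B1 * (q * S ^+ 0).
    by rewrite expr0; field; rewrite !gt_eqF.
  have c4 : 0 <= 2 * D ^+ 2 * B0 by rewrite !mulr_ge0 ?sqr_ge0.
  have c0 : 0 <= 2 * B1 by rewrite mulr_ge0.
  have := ler_wpM2l c4 (unit_le 4%N isT); have := ler_wpM2l c0 (unit_le 0%N isT); lra.
have t3 : 4 * (r ^+ 2 / S - r ^+ 2 / S ^+ 2) / (r ^+ 2 / S ^+ 2) ^+ 2 * (D * eps ^+ 2) <=
    4 * D * B0 * (q * r / S).
  apply: le_trans (_ : 4 * (r ^+ 2 / S) / (r ^+ 2 / S ^+ 2) ^+ 2 * (D * eps ^+ 2) <= _).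
    rewrite ler_wpM2r ?mulr_ge0 ?sqr_ge0 // ler_wpM2r ?invr_ge0 ?sqr_ge0 //.
    by rewrite ler_wpM2l // gerBl divr_ge0 ?sqr_ge0.
  have -> : 4 * (r ^+ 2 / S) / (r ^+ 2 / S ^+ 2) ^+ 2 * (D * eps ^+ 2) =
     4 * D * B0 * (q * S ^+ 3) by rewrite epsE; field; rewrite !gt_eqF.
  by rewrite ler_wpM2l ?unit_le ?mulr_ge0.
lra.
Qed.

(** As c <= 1, the bound c on the d-th power of p/r also bounds the power d - 1. *)
Lemma pow_pred_ge (d : nat) (p r c : R) : (0 < d)%N -> 0 < p -> 0 < r -> 0 <= c <= 1 ->
  r ^+ d * c <= p ^+ d -> r ^+ d.-1 * c <= p ^+ d.-1.
Proof.
case: d => // d _ p0 r0 /andP[c0 c1] /= H; have [rp|pr] := leP r p.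
  apply: le_trans (_ : r ^+ d <= _); first by rewrite ler_piMr // exprn_ge0 // ltW.
  by rewrite lerXn2r // nnegrE ltW.
rewrite -(ler_pM2l r0) mulrA -exprS; apply: le_trans H _; rewrite exprS.
by rewrite ler_wpM2r ?(ltW pr) // exprn_ge0 // ltW.
Qed.

End SharpStep.

Section SharpRecursion.
Context {R : realType}.
Variable d : nat.
Hypothesis d_gt0 : (0 < d)%N.

Let D : R := d%:R.
Let om : R := nroot d (omega R d).
(* Bounds relative to powers of r and s: B0 for the energy, B1 for the Taylor
   remainders, k1 for the exceptional set of the smoothing, B for all errors. *)
Let B0 : R := 2 * D * crude_constant R d.
Let B1 : R := 16 * (3 ^+ d) ^+ 2 * D ^+ 4 * B0.
Let k1 : R := 4 * D ^+ 2 * B0.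
Let B : R := 3 * B1 + 2 * D ^+ 2 * B0 + 4 * D * B0.

Definition step_constant : R := gap_constant D om k1 B.

Let D_gt0 : 0 < D. Proof. by rewrite ltr0n. Qed.
Let om_gt0 : 0 < om. Proof. by apply: nroot_gt0; exact: omega_gt0. Qed.
Let B0_gt0 : 0 < B0.
Proof. by rewrite mulr_gt0 ?crude_constant_gt0 // mulr_gt0. Qed.
Let B1_gt0 : 0 < B1.
Proof. by rewrite mulr_gt0 // mulr_gt0 ?exprn_gt0 // mulr_gt0 // !exprn_gt0. Qed.
Let k1_gt0 : 0 < k1.
Proof. by rewrite mulr_gt0 // mulr_gt0 // exprn_gt0. Qed.
Let B_gt0 : 0 < B.
Proof.
have h1 : 0 < D * B0 by exact: mulr_gt0.
have h2 : 0 < D ^+ 2 * B0 by rewrite mulr_gt0 // exprn_gt0.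
by rewrite /B; have := B1_gt0; lra.
Qed.

(** A scale above which all the smallness conditions in [sharp_step] hold. *)
Definition step_scale : R :=
  `|step_constant| + D * om ^+ 2 + k1 + om ^+ 2 + 2 * D + 4.

Lemma step_constant_ge0 : 0 <= step_constant.
Proof. exact: gap_constant_ge0 (ltW k1_gt0) (ltW B_gt0). Qed.

Lemma step_scale_ge : step_constant + om ^+ 2 + 4 <= step_scale.
Proof.
rewrite /step_scale; have := ler_norm step_constant.
have : 0 < D * om ^+ 2 by rewrite mulr_gt0 // exprn_gt0.
by have := D_gt0; have := k1_gt0; lra.
Qed.

Lemma nrootKd (x : R) : 0 <= x -> nroot d x ^+ d = x.
Proof. by case: d d_gt0 => // n _; exact: nrootK. Qed.

(** Passing from A to the points where u exceeds r^2/s removes from the radius r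
    the amount by which the radius of a ball would shrink, up to a relative
    error of order 1/s. The exponent d + 6 makes the Taylor remainders small: they
    are summed over a ball of s^d points. *)
Lemma sharp_step (G : finZmodType) (iota : {additive 'rV[int]_d -> G}) K L
    (A : {set G}) (u : G -> R) k s :
  step_scale <= k%:R -> s = (k + 2 * d)%N -> s%:R ^+ (d + 6) <= nroot d #|A|%:R :> R ->
  (L + d * #|A| + s <= K)%N -> {in zbox d K &, injective iota} -> liftable iota L A ->
  sub_torsion iota A u ->
  nroot d #|above u (nroot d #|A|%:R ^+ 2 / s%:R)|%:R <=
  nroot d #|A|%:R * (1 - om ^+ 2 / (2 * s%:R) * (1 - step_constant / s%:R)).
Proof.
move=> k_big sE Sr LK injK AL uA.
set n := #|A|; set r := nroot d n%:R in Sr *; pose S : R := s%:R; rewrite -/S in Sr *.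
set C := step_constant.
have om20 : 0 < om ^+ 2 by rewrite exprn_gt0.
have kS : k%:R = S - 2 * D by rewrite /S sE natrD natrM addrK.
have [S_C S_om S_k1 S_om2 S_D] :
    [/\ C <= S, D * om ^+ 2 + k1 < S, k1 <= S, om ^+ 2 <= S & 2 * D + 4 <= S].
  have := k_big; rewrite kS /step_scale -/C; have := ler_norm C; have := normr_ge0 C.
  have := mulr_gt0 D_gt0 om20; have := D_gt0; have := k1_gt0.
  by move: om20 => *; split; lra.
have S0 : 0 < S by have := D_gt0; lra.
have S1 : 1 <= S by have := D_gt0; lra.
pose e := S^-1; have e0 : 0 < e by rewrite invr_gt0.
have e1 : e <= 1 by rewrite invf_le1.
have Se : S * e = 1 by rewrite mulfV // gt_eqF.
have k0 : (0 < k)%N.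
  by rewrite -(ltr0n R); apply: lt_le_trans k_big; rewrite /step_scale;
    have := normr_ge0 step_constant; have := mulr_gt0 D_gt0 om20; have := D_gt0;
    have := k1_gt0; move: om20 => *; lra.
have r1 : 1 <= r by apply: le_trans Sr; rewrite exprn_ege1.
have r0 : 0 < r by exact: lt_le_trans r1.
pose q := r ^+ d; have q0 : 0 < q by rewrite exprn_gt0.
have qE : q = n%:R by rewrite /q /r nrootKd.
have S6 : S ^+ 6 <= r.
  by apply: le_trans Sr; rewrite ler_weXn2l // leq_addl.
have S3 : S ^+ 3 <= r by apply: le_trans S6; rewrite ler_weXn2l.
(* The crude bound and the equation control the energy of u. *)
pose eps := Num.sqrt (B0 * q * r ^+ 2).
have eps2 : eps ^+ 2 = B0 * q * r ^+ 2.
  by rewrite sqr_sqrtr // mulr_ge0 ?sqr_ge0 // ltW // mulr_gt0.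
have eps0 : 0 <= eps by exact: sqrtr_ge0.
have LK1 : (L + 1 <= K)%N.
  apply: leq_trans LK; rewrite -addnA leq_add2l.
  by apply: leq_trans (leq_addl _ _); rewrite sE addn_gt0 k0.
have Hu i : l2_le (grad iota u i) eps.
  split=> //; rewrite eps2; have := energy_le uA (torsion_crude d_gt0 injK LK1 AL uA).
  rewrite (bigD1 i) //= => H; apply: le_trans (le_trans _ H) _.
    by rewrite lerDl; do 2![apply: sumr_ge0 => ? _]; rewrite sqr_ge0.
  rewrite -/n -/r -qE /B0 -/D le_eqVlt; apply/orP; left; apply/eqP; ring.
(* The smoothing length l is close to r/S^3: second differences are of order 1/l,
   while the displacement of u has to be small compared with a. *)
pose l := Num.trunc (r / S ^+ 3).
have rS3 : 1 <= r / S ^+ 3 by rewrite ler_pdivlMr ?exprn_gt0 // mul1r.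
have /andP[l_le l_gt] : l%:R <= r / S ^+ 3 < l.+1%:R.
  by apply: truncn_itv; rewrite (le_trans _ rS3).
have l0 : (0 < l)%N by rewrite /l truncn_gt0.
have l1 : 1 <= l%:R :> R by rewrite ler1n.
have l_ge : r / S ^+ 3 <= 2 * l%:R by move: l_gt; rewrite -natr1; lra.
have ln : (l <= n)%N.
  rewrite -(ler_nat R) -qE; apply: le_trans l_le _; apply: le_trans (_ : r <= _).
    by rewrite ler_pdivrMr ?exprn_gt0 // ler_peMr ?(ltW r0) // exprn_ege1.
  by rewrite /q -[leLHS]expr1 ler_weXn2l.
have LKl : (L + d * l + s <= K)%N.
  by apply: leq_trans LK; rewrite leq_add2r leq_add2l leq_mul2l ln orbT.
pose a := r ^+ 2 / S ^+ 2; pose b := r ^+ 2 / S - a.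
have a0 : 0 < a by rewrite divr_gt0 ?exprn_gt0.
have abE : a + b = r ^+ 2 / S by rewrite /b addrC subrK.
have aE : r ^+ 2 / S = a * S by rewrite /a; field; rewrite gt_eqF.
have S4 : 4 < S by have := D_gt0; lra.
have ab : 2 * a < b by rewrite /b aE; nra.
pose tau := om / (2 * r); have tau0 : 0 < tau by rewrite divr_gt0 // mulr_gt0.
pose mu := r / S; have mu0 : 0 < mu by rewrite divr_gt0.
pose kap := 4 * (D * (l%:R * eps)) ^+ 2 / a ^+ 2.
pose pe := #|` zball d s|%fset%:R * ((d * s)%:R ^+ 2 * (2 * eps / l%:R)).
have [Nb [X [N_le X_le key]]] := band_inequality d_gt0 k0 l0 sE LKl injK AL uA
  tau0 mu0 a0 ab Hu (erefl kap) (erefl pe).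
rewrite abE in N_le; rewrite -/n -qE -/D -/om in X_le key.
have kap_le : kap <= k1 * e ^+ 2 * q.
  have lr : l%:R ^+ 2 <= (r / S ^+ 3) ^+ 2.
    by rewrite ler_pXn2r ?nnegrE // divr_ge0 ?exprn_ge0 // ltW.
  have -> : kap = 4 * D ^+ 2 * eps ^+ 2 / a ^+ 2 * l%:R ^+ 2.
    by rewrite /kap; field; rewrite gt_eqF.
  apply: le_trans (ler_wpM2l _ lr) _.
    rewrite divr_ge0 ?sqr_ge0 // mulr_ge0 ?sqr_ge0 // mulr_ge0 ?sqr_ge0 //.
  rewrite eps2 /a /k1 /e le_eqVlt; apply/orP; left; apply/eqP.
  by field; rewrite !gt_eqF.
have kap0 : 0 <= kap by rewrite /kap divr_ge0 ?sqr_ge0 // mulr_ge0 ?sqr_ge0.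
have pe0 : 0 <= pe.
  by rewrite /pe mulr_ge0 // mulr_ge0 ?sqr_ge0 // divr_ge0 // mulr_ge0.
have pe_le : pe ^+ 2 <= B1 * q * r ^+ 2 / S ^+ 2.
  pose T := S ^+ d; have T0 : 0 < T by rewrite exprn_gt0.
  have ball : #|` zball d s|%fset%:R <= 3 ^+ d * T.
    apply: le_trans (_ : (s.*2.+1 ^ d)%:R <= _).
      rewrite ler_nat; apply: leq_trans (card_zbox d s); apply: fsubset_leq_card.
      by apply/fsubsetP => z; rewrite !inE => /andP[].
    rewrite natrX -exprMn lerXn2r ?nnegrE ?mulr_ge0 ?(ltW S0) //.
    by rewrite -natr1 -muln2 natrM -/S; lra.
  have inv_l : l%:R^-1 <= 2 * S ^+ 3 / r.
    have l0' : 0 < l%:R :> R by exact: lt_le_trans l1.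
    have S30 : 0 < S ^+ 3 by rewrite exprn_gt0.
    rewrite ler_pdivlMr // mulrC ler_pdivrMr // -mulrA mulrCA -ler_pdivrMl //.
    by rewrite mulrC.
  have pe_lin : pe <= 4 * 3 ^+ d * D ^+ 2 * (T * S ^+ 5) * eps / r.
    apply: le_trans (_ : 3 ^+ d * T * ((D * S) ^+ 2 * (2 * eps * (2 * S ^+ 3 / r))) <= _).
      apply: ler_pM => //; first by rewrite mulr_ge0 ?sqr_ge0 // divr_ge0 // mulr_ge0.
      rewrite natrM -/D -/S ler_wpM2l ?sqr_ge0 // ler_wpM2l // mulr_ge0 //.
    rewrite le_eqVlt; apply/orP; left; apply/eqP; ring.
  have TS : (T * S ^+ 6) ^+ 2 <= r ^+ 2.
    rewrite ler_pXn2r ?nnegrE ?(ltW r0) //; last first.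
      by rewrite mulr_ge0 ?exprn_ge0 ?(ltW S0) ?(ltW T0).
    by rewrite /T -exprD.
  apply: le_trans (_ : (4 * 3 ^+ d * D ^+ 2 * (T * S ^+ 5) * eps / r) ^+ 2 <= _).
    by rewrite ler_pXn2r ?nnegrE // (le_trans pe0).
  have -> : (4 * 3 ^+ d * D ^+ 2 * (T * S ^+ 5) * eps / r) ^+ 2 =
      B1 * q / S ^+ 2 * (T * S ^+ 6) ^+ 2.
    rewrite /B1; transitivity (16 * (3 ^+ d) ^+ 2 * D ^+ 4 * (T * S ^+ 5) ^+ 2 *
      eps ^+ 2 / r ^+ 2); first by field; rewrite gt_eqF.
    by rewrite eps2; field; rewrite !gt_eqF.
  have -> : B1 * q * r ^+ 2 / S ^+ 2 = B1 * q / S ^+ 2 * r ^+ 2 by rewrite mulrAC.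
  by apply: ler_wpM2l => //; rewrite divr_ge0 ?sqr_ge0 // mulr_ge0 // ltW.
have D0' : 0 <= D by exact: ltW.
have err := error_terms D0' (ltW B0_gt0) (ltW B1_gt0) S1 S6 q0 eps0 pe0 eps2 pe_le.
rewrite -/a -/b -/B -/mu in err.
(* From here on the radius is supposed to shrink by less than claimed,
   and sizes are divided by q. *)
rewrite leNgt; apply/negP => big.
pose eta := om ^+ 2 * e / 2 * (1 - C * e).
pose kp := kap / q; pose x := X%:R / q; pose xi := D * eta + kp.
have kapE : kap = q * kp by rewrite /kp mulrC divfK // gt_eqF.
have XE : X%:R = q * x by rewrite /x mulrC divfK // gt_eqF.
have kp0 : 0 <= kp by rewrite divr_ge0 // ltW.
have kp_le : kp <= k1 * e ^+ 2 by rewrite ler_pdivrMr.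
have x0 : 0 <= x by rewrite divr_ge0 // ltW.
have e2 : e ^+ 2 <= e by rewrite expr2 ler_piMr // ltW.
have Ce : C * e <= 1 by rewrite -Se ler_pM2r.
have om2e : om ^+ 2 * e <= 1 by rewrite -Se ler_pM2r.
have om2e0 : 0 < om ^+ 2 * e by rewrite mulr_gt0.
have C0 : 0 <= C by exact: gap_constant_ge0 (ltW k1_gt0) (ltW B_gt0).
have Ce0 : 0 <= C * e by rewrite mulr_ge0 // ltW.
have eta0 : 0 <= eta by rewrite mulr_ge0 ?subr_ge0 // divr_ge0 // ltW.
have eta_le : eta <= om ^+ 2 * e / 2 by apply: ler_piMr; [rewrite divr_ge0 // ltW | rewrite gerBl].
have eta1 : 0 <= eta <= 1 by rewrite eta0 /=; lra.
have Deta0 : 0 <= D * eta by rewrite mulr_ge0.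
have Deta : D * eta <= D * om ^+ 2 * e.
  by rewrite -mulrA ler_pM2l //; lra.
have k1e : k1 * e ^+ 2 <= k1 * e by rewrite ler_pM2l.
have xi1 : xi < 1.
  apply: le_lt_trans (_ : (D * om ^+ 2 + k1) * e < _); first by rewrite /xi mulrDl; lra.
  by rewrite -Se ltr_pM2r.
have xi0 : 0 <= xi by rewrite addr_ge0.
have N_ge : q * (1 - D * eta) <= #|above u (r ^+ 2 / S)|%:R.
  rewrite -[leRHS]nrootKd //; apply: le_trans (_ : (r * (1 - eta)) ^+ d <= _).
    by rewrite exprMn ler_pM2l // bernoulli_le.
  have -> : eta = om ^+ 2 / (2 * S) * (1 - C / S) by rewrite /eta /e; field; rewrite gt_eqF.
  have eta1' : om ^+ 2 / (2 * S) * (1 - C / S) <= 1.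
    by case/andP: eta1 => _; rewrite (_ : eta = om ^+ 2 / (2 * S) * (1 - C / S)) //
      /eta /e; field; rewrite gt_eqF.
  by rewrite lerXn2r ?nnegrE ?nroot_ge0 ?(ltW big) // mulr_ge0 ?(ltW r0) // subr_ge0.
have Nb_ge : q * (1 - xi) <= Nb%:R.
  by move: (le_trans N_ge N_le); rewrite kapE /xi !mulrBr mulrDr mulr1; lra.
have x_le : x <= D * eta + 2 * kp.
  rewrite -(ler_pM2l q0) -XE; move: Nb_ge X_le; rewrite kapE /xi !mulrBr mulr1 !mulrDr.
  by rewrite (mulrCA q 2); lra.
have Nb0 : 0 < Nb%:R :> R.
  by apply: lt_le_trans Nb_ge; rewrite mulr_gt0 // subr_gt0.
pose p := nroot d Nb%:R : R; have p0 : 0 < p by exact: nroot_gt0.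
have pd : p ^+ d = Nb%:R by rewrite nrootKd // ltW.
have p_pred : r ^+ d.-1 * (1 - xi) <= p ^+ d.-1.
  by apply: pow_pred_ge => //; [rewrite subr_ge0 gerBl xi0 ltW | rewrite pd].
have De1 : 2 * D * e <= 1 by rewrite -[leRHS]Se ler_pM2r //; lra.
have e31 : 3 * e <= 1 by rewrite -[leRHS]Se ler_pM2r //; lra.
have := gap_arith D_gt0 om_gt0 (ltW k1_gt0) (ltW B_gt0) e0 e1 xi0 (ltW xi1) De1 e31
  (lexx _) x0 x_le kp0 kp_le (erefl eta) eta0.
have qr0 : 0 < q * r by exact: mulr_gt0.
rewrite -(ltr_pM2l qr0); apply/negP; rewrite -leNgt.
have low : q * r * (D * om * (1 - xi) * (1 - 2 * D * e) * (1 - 3 * e)) <=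
    D * p ^+ d.-1 * (om * k%:R) * (b - 2 * a).
  have -> : D * p ^+ d.-1 * (om * k%:R) * (b - 2 * a) =
      D * om * (1 - 2 * D * e) * (1 - 3 * e) * r ^+ 2 * p ^+ d.-1.
    by rewrite kS /b /a /e; field; rewrite gt_eqF.
  have -> : q * r * (D * om * (1 - xi) * (1 - 2 * D * e) * (1 - 3 * e)) =
      D * om * (1 - 2 * D * e) * (1 - 3 * e) * r ^+ 2 * (r ^+ d.-1 * (1 - xi)).
    by rewrite /q -[in LHS](prednK d_gt0) exprS; ring.
  apply: ler_wpM2l => //; rewrite mulr_ge0 ?sqr_ge0 // mulr_ge0 ?subr_ge0 //.
  by rewrite mulr_ge0 ?subr_ge0 // mulr_ge0 // ltW.
apply: le_trans low (le_trans (key p p0 _) _); first by rewrite pd.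
have b_le : b <= r ^+ 2 / S by rewrite /b gerBl ltW.
have main : s%:R * tau / 2 * (2 * D * b * (q + kap)) <= q * r * (D * om / 2 * (1 + kp)).
  apply: le_trans (_ : s%:R * tau / 2 * (2 * D * (r ^+ 2 / S) * (q + kap)) <= _).
    apply: ler_wpM2l; first by rewrite divr_ge0 // mulr_ge0 // ltW.
    apply: ler_wpM2r; first by rewrite addr_ge0 // ltW.
    by apply: ler_wpM2l => //; rewrite mulr_ge0.
  by rewrite kapE /tau -/S le_eqVlt; apply/orP; left; apply/eqP; field; rewrite !gt_eqF.
have loss : X%:R * (s%:R / (2 * tau) + mu) = q * r * (x * (1 / (om * e) + e)).
  by rewrite XE /tau /mu /e -/S; field; rewrite !gt_eqF.
rewrite loss !mulrDr; move: err main; rewrite -/S (_ : q * r / S = q * r * e) //.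
rewrite !mulrDr; lra.
Qed.

End SharpRecursion.

(** * The sharp bound for subsolutions *)

Section RadiusRecursion.
Context {R : realType}.

(** Since eps <= 1, the power 1 - eps is nondecreasing. *)
Lemma powR_shrink (r r' eps : R) : 0 < r' -> r' <= r -> eps <= 1 ->
  r' ^+ 2 * r' `^ (- eps) <= r * r' * r `^ (- eps).
Proof.
move=> r'0 r'r eps1; have r0 : 0 < r by exact: lt_le_trans r'r.
have split_pow x : 0 < x -> x * x `^ (- eps) = x `^ (1 - eps).
  by move=> x0; rewrite powRD ?powRr1 ?(ltW x0) // (gt_eqF x0) implybT.
rewrite expr2 -mulrA split_pow // [r * r']mulrC -mulrA split_pow //.
by rewrite ler_pM2l // ge0_ler_powR ?subr_ge0 ?nnegrE // ltW.
Qed.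

(** Removing the levels below r^2/s costs the time r^2/s and shrinks the radius
    to at most r'; the correction factor grows just enough to absorb the
    relative error of order 1/s in the loss of radius. *)
Lemma radius_recursion (om r r' S Cs C g g' x : R) :
  0 < om -> 0 < r -> 0 < r' -> 0 < S -> 0 <= Cs -> 2 * Cs <= S -> om ^+ 2 <= S ->
  8 * Cs + 2 * om ^+ 2 <= C -> (2 * S)^-1 <= g ->
  r' <= r * (1 - om ^+ 2 / (2 * S) * (1 - Cs / S)) ->
  r' ^+ 2 * g' <= r * r' * g ->
  x - r ^+ 2 / S <= r' ^+ 2 / om ^+ 2 * (1 + C * g') ->
  x <= r ^+ 2 / om ^+ 2 * (1 + C * g).
Proof.
move=> om0 r0 r'0 S0 Cs0 CsS2 omS C_ge g_ge r'_le shrink x_le.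
have om20 : 0 < om ^+ 2 by rewrite exprn_gt0.
set kappa := om ^+ 2 / (2 * S) in r'_le *; set t := Cs / S in r'_le *.
have kap0 : 0 < kappa by rewrite divr_gt0 // mulr_gt0.
have kap1 : kappa <= 2^-1.
  by rewrite ler_pdivrMr ?mulr_gt0 // mulrA mulVf ?pnatr_eq0 // mul1r.
have t0 : 0 <= t by rewrite divr_ge0 // ltW.
have t1 : t <= 2^-1 by rewrite ler_pdivrMr //; lra.
set h := kappa * (1 - t) in r'_le *.
have h0 : 0 < h by rewrite mulr_gt0 //; lra.
have h_le : h <= kappa by rewrite ler_piMr ?(ltW kap0) // gerBl.
have g0 : 0 < g by apply: lt_le_trans g_ge; rewrite invr_gt0 mulr_gt0.
have C0 : 0 <= C by lra.
have gain : 2 * t + kappa <= C * g * (1 - t).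
  apply: le_trans (_ : C * (2 * S)^-1 * 2^-1 <= _); last first.
    apply: ler_pM; rewrite ?invr_ge0 ?mulr_ge0 ?invr_ge0 ?mulr_ge0 ?(ltW S0) //; last lra.
    by rewrite ler_wpM2l.
  have -> : 2 * t + kappa = (8 * Cs + 2 * om ^+ 2) * (2 * S)^-1 * 2^-1.
    by rewrite /t /kappa; field; rewrite gt_eqF.
  by rewrite !ler_wpM2r ?invr_ge0 ?mulr_ge0 ?(ltW S0).
have step1 : x * om ^+ 2 <= 2 * kappa * r ^+ 2 + (r' ^+ 2 + C * (r * r' * g)).
  have := ler_wpM2l C0 shrink; have := ler_wpM2r (ltW om20) x_le.
  have -> : r' ^+ 2 / om ^+ 2 * (1 + C * g') * om ^+ 2 = r' ^+ 2 + C * (r' ^+ 2 * g').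
    by field; rewrite gt_eqF.
  have -> : (x - r ^+ 2 / S) * om ^+ 2 = x * om ^+ 2 - 2 * kappa * r ^+ 2.
    by rewrite /kappa; field; rewrite gt_eqF.
  by lra.
have step2 : r' ^+ 2 + C * (r * r' * g) <= r ^+ 2 * ((1 - h) ^+ 2 + C * g * (1 - h)).
  have h1' : 0 <= 1 - h by lra.
  have sq : r' ^+ 2 <= (r * (1 - h)) ^+ 2.
    by rewrite ler_pXn2r ?nnegrE ?(ltW r'0) // mulr_ge0 // ltW.
  have lin : C * (r * r' * g) <= C * g * r * (r * (1 - h)).
    rewrite (_ : C * (r * r' * g) = C * g * r * r'); last by ring.
    by rewrite ler_wpM2l // mulr_ge0 ?(ltW r0) // mulr_ge0 // ltW.
  by move: sq; rewrite exprMn; lra.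
have step3 : 2 * kappa + ((1 - h) ^+ 2 + C * g * (1 - h)) <= 1 + C * g.
  have hh : h ^+ 2 <= kappa ^+ 2 by rewrite ler_pXn2r ?nnegrE // ltW.
  have := ler_wpM2l (ltW kap0) gain.
  rewrite (_ : kappa * (C * g * (1 - t)) = C * g * h); last by rewrite /h; ring.
  rewrite mulrDr -expr2 (_ : kappa * (2 * t) = 2 * kappa - 2 * h); last by rewrite /h; ring.
  by rewrite sqrrB expr1n mul1r; move: hh; lra.
have r20 : 0 < r ^+ 2 by rewrite exprn_gt0.
rewrite mulrAC ler_pdivlMr //.
have := ler_wpM2l (ltW r20) step3; lra.
Qed.

End RadiusRecursion.

Section TorsionBound.
Context {R : realType}.
Variable d : nat.
Hypothesis d_gt0 : (0 < d)%N.

Let om : R := nroot d (omega R d).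
Let Cs : R := @step_constant R d.
Let s0 : R := 2 * @step_scale R d + 2 * d%:R.

(** With s = r^(1/(d+6)), the largest scale allowed in [sharp_step], the relative
    error 1/s is r to the power minus this number. *)
Definition error_exponent : R := (d + 6)%:R^-1.

(** The first term covers the radii that are too small for [sharp_step], by the crude
    bound; the others are what [radius_recursion] requires. *)
Definition error_constant : R :=
  crude_constant R d * om ^+ 2 * (s0 + 2) + 8 * Cs + 2 * om ^+ 2.

Let om_gt0 : 0 < om. Proof. by apply: nroot_gt0; exact: omega_gt0. Qed.

Let Cs_ge0 : 0 <= Cs. Proof. exact: step_constant_ge0. Qed.

Let s0_ge : 2 * Cs + om ^+ 2 + 8 + 2 * d%:R <= s0.
Proof.
have := @step_scale_ge R d d_gt0; rewrite /s0 -/Cs -/om; have := sqr_ge0 om; lra.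
Qed.

Lemma error_constant_ge0 : 0 <= error_constant.
Proof.
have om2 : 0 <= om ^+ 2 by exact: sqr_ge0.
have h : 0 <= s0 + 2 by have := s0_ge; have := Cs_ge0; have := ler0n R d; lra.
have := mulr_ge0 (mulr_ge0 (ltW (crude_constant_gt0 R d_gt0)) om2) h.
by rewrite /error_constant; have := Cs_ge0; lra.
Qed.

(** Induction on the cardinal: a step of relative height 1/s is removed at the
    scale s = r^(1/(d+6)) until the radius is bounded. *)
Lemma torsion_sharp (G : finZmodType) (iota : {additive 'rV[int]_d -> G}) K L
    (A : {set G}) (u : G -> R) :
  {in zbox d K &, injective iota} -> (L + d.+1 * #|A| <= K)%N -> liftable iota L A ->
  sub_torsion iota A u -> forall y,
  u y <= nroot d #|A|%:R ^+ 2 / om ^+ 2 *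
    (1 + error_constant * nroot d #|A|%:R `^ (- error_exponent)).
Proof.
move=> injK; move Am : #|A| => m; elim/ltn_ind: m A u Am => m IHm A u Am LK AL uA y.
have [u0 u_off _] := uA.
set r := nroot d m%:R; set C := error_constant; set eps := error_exponent.
set g := r `^ (- eps).
have om20 : 0 < om ^+ 2 by rewrite exprn_gt0.
have g0 : 0 <= g by exact: powR_ge0.
have C0 : 0 <= C by exact: error_constant_ge0.
have Cg0 : 0 <= C * g by rewrite mulr_ge0.
have bound0 : 0 <= r ^+ 2 / om ^+ 2 * (1 + C * g).
  by rewrite mulr_ge0 ?addr_ge0 // divr_ge0 ?sqr_ge0.
have [yA|/u_off -> //] := boolP (y \in A).
have m0 : (0 < m)%N by rewrite -Am card_gt0; apply/finset.set0Pn; exists y.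
have r_ge1 j : (0 < j)%N -> 1 <= nroot d j%:R :> R.
  move=> j0; rewrite -(@ler_pXn2r _ d) ?nnegrE ?nroot_ge0 // nrootKd // expr1n.
  by rewrite ler1n.
have r1 : 1 <= r by exact: r_ge1.
have r0 : 0 < r by exact: lt_le_trans r1.
have LK1 : (L + 1 <= K)%N.
  by apply: leq_trans LK; rewrite leq_add2l muln_gt0.
have eps0 : 0 < eps by rewrite invr_gt0 ltr0n addnC.
have eps1 : eps <= 1 by rewrite invf_le1 ?ler1n ?ltr0n addnC.
pose rho := r `^ eps.
have rho0 : 0 < rho by exact: powR_gt0.
have gE : g = rho^-1 by rewrite /g powRN.
have rhoX : rho ^+ (d + 6) = r.
  by rewrite /rho -powR_mulrn ?powR_ge0 // -powRrM mulVf ?powRr1 ?(ltW r0) // pnatr_eq0 addnC.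
pose s := Num.trunc rho; pose S : R := s%:R.
have /andP[S_le S_gt] : S <= rho < s.+1%:R by apply: truncn_itv; exact: ltW.
rewrite -natr1 -/S in S_gt.
have om_crude := torsion_crude d_gt0 injK LK1 AL uA y; rewrite Am -/r in om_crude.
have r20 : 0 < r ^+ 2 by rewrite exprn_gt0.
have [S_small|S_big] := ltP S s0.
  apply: le_trans om_crude _; rewrite [leRHS]mulrAC ler_pdivlMr //.
  rewrite -mulrA mulrCA ler_pM2l //.
  apply: le_trans (_ : C * g <= _); last by rewrite lerDr.
  rewrite gE ler_pdivlMr //; apply: le_trans (_ : crude_constant R d * om ^+ 2 * (s0 + 2) <= _).
    by rewrite ler_pM2l; [lra | rewrite pmulr_rgt0 ?crude_constant_gt0].
  by rewrite /C /error_constant; have := Cs_ge0; lra.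
have S_ge := le_trans s0_ge S_big.
have D0 : 0 <= d%:R :> R by exact: ler0n.
have S0 : 0 < S by have := Cs_ge0; lra.
have sr : S ^+ (d + 6) <= r by rewrite -rhoX lerXn2r ?nnegrE ?(ltW S0) ?(ltW rho0).
pose k := (s - 2 * d)%N.
have s2d : (2 * d <= s)%N.
  by rewrite -(ler_nat R) natrM -/S; have := Cs_ge0; lra.
have sE : s = (k + 2 * d)%N by rewrite /k subnK.
have k_big : @step_scale R d <= k%:R.
  rewrite /k natrB // natrM -/S; have := S_big; rewrite /s0.
  have := @step_scale_ge R d d_gt0; have := Cs_ge0; rewrite -/Cs -/om. lra.
have S1 : 1 <= S by have := Cs_ge0; lra.
have sm : (s <= m)%N.
  rewrite -(ler_nat R) -[leRHS](nrootKd d_gt0) // -/r -/S.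
  apply: le_trans (_ : r <= _); last by rewrite -[leLHS]expr1 ler_weXn2l.
  by apply: le_trans sr; rewrite -[leLHS]expr1 ler_weXn2l // addnC.
have LKs : (L + d * #|A| + s <= K)%N.
  by apply: leq_trans LK; rewrite Am -addnA leq_add2l mulSn addnC leq_add2r.
have srA : s%:R ^+ (d + 6) <= nroot d #|A|%:R :> R by rewrite Am.
have := sharp_step d_gt0 k_big sE srA LKs injK AL uA.
rewrite Am -/r -/S -/om -/Cs; set delta := r ^+ 2 / S.
set E := above u delta; set r' := nroot d #|E|%:R; set h := _ * (1 - Cs / S) => r'_le.
have kap0 : 0 < om ^+ 2 / (2 * S) by rewrite divr_gt0 // mulr_gt0.
have CsS : Cs / S <= 2^-1 by rewrite ler_pdivrMr //; lra.
have CsS0 : 0 <= Cs / S by rewrite divr_ge0 ?Cs_ge0 // ltW.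
have h0 : 0 < h by rewrite mulr_gt0 //; lra.
have h_le : h <= om ^+ 2 / (2 * S) by rewrite ler_piMr ?(ltW kap0) // gerBl.
have h1 : h <= 1.
  by apply: le_trans h_le _; rewrite ler_pdivrMr ?mulr_gt0 //; have := Cs_ge0; lra.
have r'r : r' < r by apply: le_lt_trans r'_le _; rewrite gtr_pMr //; lra.
have Em : (#|E| < m)%N.
  rewrite -(ltr_nat R) -[ltLHS](nrootKd d_gt0) // -[ltRHS](nrootKd d_gt0) //.
  by rewrite ltr_pXn2r // nnegrE nroot_ge0.
have delta0 : 0 < delta by rewrite divr_gt0.
have [y_low|y_high] := leP (u y) delta.
  apply: le_trans y_low _; apply: le_trans (_ : r ^+ 2 / om ^+ 2 <= _).
    by rewrite ler_pM2l // lef_pV2 ?posrE //; have := Cs_ge0; lra.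
  by rewrite ler_peMr ?lerDl // divr_ge0 ?sqr_ge0.
have yE : y \in E by rewrite in_above.
have r'1 : 1 <= r' by apply: r_ge1; rewrite card_gt0; apply/finset.set0Pn; exists y.
have r'0 : 0 < r' by exact: lt_le_trans r'1.
have EL : liftable iota L E.
  by move=> x; rewrite in_above => xE; apply: AL; apply: contraTT xE => /u_off ->;
    rewrite -leNgt ltW.
have LKE : (L + d.+1 * #|E| <= K)%N.
  by apply: leq_trans LK; rewrite leq_add2l leq_mul2l ltnW // orbT.
have u_le : u y - delta <= r' ^+ 2 / om ^+ 2 * (1 + C * r' `^ (- eps)).
  apply: le_trans (IHm _ Em E _ erefl LKE EL (sub_torsion_cut uA (ltW delta0)) y).
  by rewrite le_max lexx.
apply: (radius_recursion om_gt0 r0 r'0 S0 Cs_ge0 _ _ _ _ r'_le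
  (powR_shrink r'0 (ltW r'r) eps1) u_le).
- have := Cs_ge0; lra.
- have := Cs_ge0; lra.
- rewrite /C /error_constant -addrA lerDr.
  have s00 : 0 <= s0 + 2.
    have := s0_ge; have := Cs_ge0. lra.
  have := crude_constant_gt0 R d_gt0; move: (crude_constant R d) => c c0.
  by rewrite mulr_ge0 // mulr_ge0 // ltW.
- have S20 : 0 < 2 * S by rewrite mulr_gt0.
  by change (r `^ (- eps)) with g; rewrite gE lef_pV2 ?posrE //; lra.
Qed.

End TorsionBound.

Section LatticeTorsion.
Context {R : realType}.
Variable d : nat.
Hypothesis d_gt0 : (0 < d)%N.
Implicit Types (z : 'rV[int]_d) (i : 'I_d).
Local Open Scope fset_scope.
Local Open Scope ring_scope.

Definition torus_proj (N : nat) (z : 'rV[int]_d) : 'rV['Z_N]_d := map_mx intr z.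

Lemma torus_proj_additive N : zmod_morphism (torus_proj N).
Proof. by move=> x y; apply/rowP => i; rewrite !mxE rmorphB. Qed.

HB.instance Definition _ N := GRing.isZmodMorphism.Build _ _ (torus_proj N) (torus_proj_additive N).

(** Coordinates of points of the box differ by at most 2 K, which is less than the
    period. *)
Lemma torus_proj_inj K : {in zbox d K &, injective (torus_proj (2 * K + 2))}.
Proof.
move=> x y /mem_zbox Hx /mem_zbox Hy /rowP xy; apply/rowP => i.
have := xy i; rewrite !mxE => /eqP; rewrite -subr_eq0 -rmorphB /= => /eqP.
have := Hx i; have := Hy i; rewrite !ler_norml => /andP[y1 y2] /andP[x1 x2].
have zero (m : nat) : (m < 2 * K + 2)%N -> m%:R = 0 :> 'Z_(2 * K + 2) -> m = 0%N.
  by move=> mK /(congr1 val); rewrite /= val_Zp_nat ?addn2 // modn_small // -addn2.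
change (x 0 i) with (x ord0 i) in *; change (y 0 i) with (y ord0 i) in *.
move: (x ord0 i) (y ord0 i) x1 x2 y1 y2 => s t s1 s2 t1 t2.
have small : (absz (s - t) < 2 * K + 2)%N by lia.
have [le_ts|lt_st] := leP t s.
  by rewrite -(gez0_abs (_ : 0 <= s - t)) ?subr_ge0 // => /(zero _ small); lia.
rewrite -[s - t]opprB rmorphN /= => /eqP; rewrite oppr_eq0 => /eqP.
have {}small : (absz (t - s) < 2 * K + 2)%N by lia.
by rewrite -(gez0_abs (_ : 0 <= t - s)) ?subr_ge0 ?(ltW lt_st) // => /(zero _ small); lia.
Qed.

Definition unitv i : 'rV[int]_d := delta_mx ord0 i.

Definition lattice_torsion (A : {fset 'rV[int]_d}) (u : 'rV[int]_d -> R) : Prop :=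
  [/\ forall z, 0 <= u z, forall z, z \notin A -> u z = 0
    & forall z, z \in A ->
      u z <= 1 + (2 * d%:R)^-1 * \sum_i (u (z + unitv i) + u (z - unitv i))].

Lemma fset_sub_zbox (A : {fset 'rV[int]_d}) : exists L, forall z, z \in A -> z \in zbox d L.
Proof.
exists (\sum_(z <- A) l1 z)%N => z zA; apply/mem_zbox => i.
rewrite -abszE lez_nat (big_fsetD1 z) //= /l1 (bigD1 i) //=.
by rewrite -addnA leq_addr.
Qed.

(** The function is copied to a torus so large that the box containing A, enlarged
    by all the scales involved, embeds into it. *)
Theorem lattice_torsion_sharp A u : lattice_torsion A u -> forall z,
  u z <= nroot d #|` A|%:R ^+ 2 / nroot d (omega R d) ^+ 2 *
    (1 + error_constant d * nroot d #|` A|%:R `^ (- error_exponent d)).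
Proof.
move=> [u0 u_off uL] z.
have [L AL] := fset_sub_zbox A; pose K := (L + 1 + d.+1 * #|` A|)%N.
pose iota := torus_proj (2 * K + 2).
have injK : {in zbox d K &, injective iota} by exact: torus_proj_inj.
have LK : (L <= K)%N by rewrite /K -addnA leq_addr.
have L1K : (L + 1 <= K)%N by rewrite leq_addr.
pose w (y : 'rV['Z_(2 * K + 2)]_d) : R := \sum_(x <- A | iota x == y) u x.
pose B := finset (fun y => has (fun x => iota x == y) (enum_fset A)).
have wE x : x \in zbox d K -> w (iota x) = u x.
  move=> xK; rewrite /w big_seq_cond.
  have same x' : (x' \in A) && (iota x' == iota x) = (x' == x) && (x \in A).
    apply/andP/andP => [[x'A /eqP e]|[/eqP -> xA]]; last by rewrite xA eqxx.
    by have <- : x' = x by apply: injK => //; apply: zbox_sub (AL _ x'A).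
  under eq_bigl do rewrite same.
  have [xA|xA] := boolP (x \in A); last first.
    by rewrite u_off // big_pred0 // => x'; rewrite andbF.
  under eq_bigl do rewrite andbT.
  by rewrite -big_filter filter_pred1_uniq ?fset_uniq // big_seq1.
have B_le : #|B| = #|` A|.
  apply/eqP; rewrite -(size_map iota) eqn_leq; apply/andP; split.
    rewrite cardE; apply: uniq_leq_size; first exact: enum_uniq.
    by move=> y; rewrite mem_enum inE => /hasP[x xA /eqP <-]; exact: map_f.
  rewrite cardE; apply: uniq_leq_size.
    by rewrite map_inj_in_uniq ?fset_uniq // => x y xA yA; apply: injK;
      apply: zbox_sub (AL _ _).
  by move=> y /mapP[x xA ->]; rewrite mem_enum inE; apply/hasP; exists x.
have BL : liftable iota L B.
  by move=> y; rewrite inE => /hasP[x xA /eqP <-]; exists x; rewrite ?AL.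
have unit1 i : unitv i \in zbox d 1.
  by apply/mem_zbox => j; rewrite mxE eqxx; case: (j == i).
have unitN1 i : - unitv i \in zbox d 1.
  by apply/mem_zbox => j; rewrite !mxE eqxx normrN; case: (j == i).
have wB : sub_torsion iota B w.
  split=> [y|y|y].
  - by apply: sumr_ge0.
  - rewrite inE => /hasPn yB; rewrite /w big_seq_cond big_pred0 // => x.
    by apply/negbTE; apply/negP => /andP[/yB /negP].
  rewrite inE => /hasP[x xA /eqP <-]; have xL := AL _ xA.
  have d0 : 0 < 2 * d%:R :> R by rewrite mulr_gt0 // ltr0n.
  have := uL _ xA; rewrite -(ler_pM2l d0) mulrDr mulr1 mulrA mulfV ?gt_eqF // mul1r => ux.
  have -> : neglap iota w (iota x) =
      2 * d%:R * u x - \sum_i (u (x + unitv i) + u (x - unitv i)).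
    have -> : 2 * d%:R * u x = \sum_(i < d) 2 * u x.
      by rewrite sumr_const card_ord -[RHS]mulr_natr; ring.
    rewrite -sumrB; apply: eq_bigr => i _; rewrite opprD addrA /step -raddfD -raddfB.
    have xK : x \in zbox d K by exact: zbox_sub xL.
    have pK : x + unitv i \in zbox d K by apply: zbox_sub L1K _; exact: zboxD.
    have mK : x - unitv i \in zbox d K by apply: zbox_sub L1K _; exact: zboxD.
    by rewrite (wE _ xK) (wE _ pK) (wE _ mK).
  by lra.
have [zA|/u_off ->] := boolP (z \in A); last first.
  have C0 := error_constant_ge0 (R := R) d_gt0.
  by rewrite mulr_ge0 ?addr_ge0 ?mulr_ge0 ?powR_ge0 // invr_ge0 sqr_ge0.
rewrite -(wE z); last exact: zbox_sub LK (AL _ zA).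
have LKB : (L + d.+1 * #|B| <= K)%N by rewrite B_le /K leq_add2r leq_addr.
by have := torsion_sharp d_gt0 injK LKB BL wB (iota z); rewrite B_le.
Qed.

End LatticeTorsion.

(** * Probability of staying in a set *)

Section StayProbability.
Context {R : realType}.
Variable d : nat.
Hypothesis d_gt0 : (0 < d)%N.
Implicit Types (x : 'rV[int]_d) (A : set 'rV[int]_d).

(** The probability that the walk from x is in A up to time k, through the
    recursion obtained from the first step. *)
Fixpoint stay A k x : R :=
  if x \in A then
    if k is k'.+1 then
      (2 * d%:R)^-1 * \sum_i (stay A k' (x + unitv i) + stay A k' (x - unitv i))
    else 1
  else 0.

Lemma stay_ge0 A k x : 0 <= stay A k x.
Proof.
elim: k x => [|k IHk] x /=; case: ifP => // _.
by rewrite mulr_ge0 ?invr_ge0 ?mulr_ge0 // sumr_ge0 // => i _; rewrite addr_ge0.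
Qed.

Lemma stay_off A k x : x \notin A -> stay A k x = 0.
Proof. by move=> /negbTE xA; case: k => [|k] /=; rewrite xA. Qed.

Lemma stayS_le A k x : stay A k.+1 x <= stay A k x.
Proof.
elim: k x => [|k IHk] x; last first.
  rewrite [stay A k.+2 x]/= [stay A k.+1 x]/=; case: ifP => // _.
  apply: ler_wpM2l; first by rewrite invr_ge0 mulr_ge0.
  by apply: ler_sum => i _; apply: lerD; exact: IHk.
rewrite /=; case: ifP => // _.
have d0 : 0 < 2 * d%:R :> R by rewrite mulr_gt0 // ltr0n.
rewrite mulrC ler_pdivrMr // mul1r.
have -> : 2 * d%:R = \sum_(i < d) (1 + 1) :> R by rewrite sumr_const card_ord -[RHS]mulr_natr.
by apply: ler_sum => i _; apply: lerD; case: ifP.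
Qed.

Lemma stay_le A j k x : (j <= k)%N -> stay A k x <= stay A j x.
Proof.
move=> /subnK <-; elim: (k - j)%N => [|m IHm]; first by rewrite add0n.
by rewrite addSn (le_trans (stayS_le _ _ _)).
Qed.

Definition stay_sum A k x : R := \sum_(j < k) stay A j x.

Lemma stay_sumS A k x : x \in A -> stay_sum A k.+1 x =
  1 + (2 * d%:R)^-1 * \sum_i (stay_sum A k (x + unitv i) + stay_sum A k (x - unitv i)).
Proof.
move=> xA; rewrite /stay_sum big_ord_recl /= xA; congr (_ + _).
rewrite -mulr_sumr; congr (_ * _); rewrite exchange_big /=.
by apply: eq_bigr => i _; rewrite big_split.
Qed.

(** The recursion for the sums up to k + 1 involves the sums up to k on the right; as
    these increase with k, the equation becomes an inequality. *)
Lemma lattice_torsion_stay_sum (A : {fset 'rV[int]_d}) k :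
  lattice_torsion A (stay_sum [set` A] k).
Proof.
split=> [z|z zA|z zA].
- by apply: sumr_ge0 => j _; exact: stay_ge0.
- by apply: big1 => j _; apply: stay_off; rewrite notin_setE /=; apply/negP.
rewrite -stay_sumS; last by rewrite inE.
by rewrite /stay_sum big_ord_recr /= lerDl stay_ge0.
Qed.

(** The points off A are at squared distance at least rho, so |x|^2 minus the
    elapsed time being a martingale gives this bound as long as the walk has
    left A; on the event that it has not, at most rho is lost. *)
Lemma stay_sum_ge_martingale A (rho : R) k x :
  (forall z, z \notin A -> rho <= \sum_i (z ord0 i)%:~R ^+ 2) -> 0 <= rho ->
  rho - \sum_i (x ord0 i)%:~R ^+ 2 - rho * stay A k x <= stay_sum A k x.
Proof.
move=> A_out rho0; elim: k x => [|k IHk] x.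
  rewrite /stay_sum big_ord0 /=; case: ifPn => [xA|/A_out]; last by rewrite mulr0; lra.
  rewrite mulr1; have : 0 <= \sum_i (x ord0 i)%:~R ^+ 2 :> R.
    by apply: sumr_ge0 => i _; rewrite sqr_ge0.
  lra.
have [xA|xA] := boolP (x \in A); last first.
  rewrite stay_off // mulr0; have := A_out _ xA.
  have : 0 <= stay_sum A k.+1 x by apply: sumr_ge0 => j _; exact: stay_ge0.
  lra.
rewrite stay_sumS //= xA.
have d0 : 0 < 2 * d%:R :> R by rewrite mulr_gt0 // ltr0n.
pose N (z : 'rV[int]_d) : R := \sum_i (z ord0 i)%:~R ^+ 2.
have Nsum i : N (x + unitv i) + N (x - unitv i) = 2 * N x + 2.
  rewrite /N -big_split /= (bigD1 i) //= [in RHS](bigD1 i) //=.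
  rewrite !mxE !eqxx /= intrD intrB.
  have -> : \sum_(j | j != i) (((x + unitv i) ord0 j)%:~R ^+ 2 + ((x - unitv i) ord0 j)%:~R ^+ 2) =
      2 * \sum_(j | j != i) (x ord0 j)%:~R ^+ 2 :> R.
    rewrite mulr_sumr; apply: eq_bigr => j ji.
    by rewrite !mxE eqxx (negbTE ji) /= ?subr0 ?addr0; ring.
  by ring.
have avg : (2 * d%:R)^-1 * \sum_i ((rho - N (x + unitv i) - rho * stay A k (x + unitv i)) +
      (rho - N (x - unitv i) - rho * stay A k (x - unitv i))) <=
    (2 * d%:R)^-1 * \sum_i (stay_sum A k (x + unitv i) + stay_sum A k (x - unitv i)).
  apply: ler_wpM2l; first by rewrite invr_ge0 ltW.
  by apply: ler_sum => i _; apply: lerD; exact: IHk.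
apply: le_trans (lerD (lexx 1) avg); rewrite -/(N x).
have -> : \sum_i ((rho - N (x + unitv i) - rho * stay A k (x + unitv i)) +
      (rho - N (x - unitv i) - rho * stay A k (x - unitv i))) =
    2 * d%:R * (rho - N x - 1) -
    rho * \sum_i (stay A k (x + unitv i) + stay A k (x - unitv i)).
  rewrite mulr_sumr.
  have -> : 2 * d%:R * (rho - N x - 1) = \sum_(i < d) 2 * (rho - N x - 1).
    by rewrite sumr_const card_ord -[RHS]mulr_natr; ring.
  by rewrite -sumrB; apply: eq_bigr => i _; have := Nsum i; lra.
set m := 2 * d%:R in d0 *; set Sst := \sum_i (stay _ _ _ + _).
have -> : m^-1 * (m * (rho - N x - 1) - rho * Sst) =
    rho - N x - 1 - rho * (m^-1 * Sst) by field; rewrite gt_eqF.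
lra.
Qed.

(** Staying has a probability p decreasing in time, so k p is at most the sum; thus
    either p <= rho/k, and little is lost, or the sum exceeds rho. *)
Lemma stay_sum_ge A (rho : R) k :
  (forall z, z \notin A -> rho <= \sum_i (z ord0 i)%:~R ^+ 2) -> 0 <= rho -> (0 < k)%N ->
  rho - rho ^+ 2 / k%:R <= stay_sum A k 0.
Proof.
move=> A_out rho0 k0; have k0' : 0 < k%:R :> R by rewrite ltr0n.
have := stay_sum_ge_martingale k 0 A_out rho0.
rewrite big1 ?subr0 => [H|i _]; last by rewrite mxE expr0n.
have kp : k%:R * stay A k 0 <= stay_sum A k 0.
  have -> : k%:R * stay A k 0 = \sum_(j < k) stay A k 0.
    by rewrite sumr_const card_ord -[RHS]mulr_natl.
  by apply: ler_sum => j _; apply: stay_le; exact: ltnW.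
have p0 := stay_ge0 A k 0.
have [big|small] := leP (rho / k%:R) (stay A k 0).
  have : rho <= k%:R * stay A k 0 by rewrite mulrC -ler_pdivrMr.
  have : 0 <= rho ^+ 2 / k%:R by rewrite divr_ge0 ?sqr_ge0 // ltW.
  lra.
have : rho * stay A k 0 <= rho * (rho / k%:R) by rewrite ler_wpM2l // ltW.
by rewrite mulrA -expr2; lra.
Qed.

End StayProbability.

Section WalkEvents.
Context {R : realType} {disp : measure_display} {T : measurableType disp}.
Variables (P : probability T R) (d : nat) (xi : nat -> T -> 'rV[int]_d).
Hypothesis d_gt0 : (0 < d)%N.
Hypothesis xi_steps : simple_steps P xi.
Implicit Types (x v : 'rV[int]_d) (A : set 'rV[int]_d) (F : set T).

Let c : R := (2 * d)%:R^-1.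

Definition signed_unit (p : 'I_d * bool) : 'rV[int]_d :=
  if p.2 then - unitv p.1 else unitv p.1.

Lemma signed_unit_inj : injective signed_unit.
Proof.
have coord (i j : 'I_d) : unitv i 0 j = (j == i)%:R by rewrite mxE eqxx.
have coordN (i j : 'I_d) : (- unitv i) 0 j = - (j == i)%:R by rewrite mxE coord.
move=> [i b] [j b'] /rowP /(_ i); rewrite /signed_unit /=.
by case: b; case: b'; rewrite ?coordN ?coord eqxx; case: eqP => [->|].
Qed.

Lemma unit_step_signed p : unit_step (signed_unit p).
Proof.
case: p => i b; apply/existsP; exists i; rewrite /signed_unit /unitv /=.
by case: b; rewrite eqxx ?orbT.
Qed.

Let D k v : set T := xi k @^-1` [set v].

Let measurable_D k v : measurable (D k v).
Proof. by case: xi_steps => H _ _; exact: H. Qed.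

Lemma prob_signed_unit k p : P (D k (signed_unit p)) = c%:E.
Proof. by case: xi_steps => _ H _; rewrite /D H unit_step_signed. Qed.

(** The 2 d signed unit vectors carry total probability 1, so the other values
    of the step are negligible. *)
Lemma prob_split_step k F : measurable F ->
  P F = (\sum_p P (F `&` D k (signed_unit p)))%E.
Proof.
move=> mF; pose r := enum {: 'I_d * bool}.
have split_sum G : measurable G ->
    P (\bigcup_(p in [set` r]) (G `&` D k (signed_unit p))) =
    (\sum_p P (G `&` D k (signed_unit p)))%E.
  move=> mG; rewrite measure_fin_bigcup //.
  - by rewrite -fsbig_seq ?enum_uniq // big_enum.
  - move=> p q _ _ [w [[_ wp] [_ wq]]]; apply: signed_unit_inj.
    by rewrite -wp -wq.
  - by move=> p _; apply: measurableI.
pose U := \bigcup_(p in [set` r]) D k (signed_unit p).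
have mU : measurable U by apply: fin_bigcup_measurable => // p _; exact: measurable_D.
have PU : P U = 1%E.
  have := split_sum setT measurableT; rewrite -setI_bigcupr setTI => ->.
  under eq_bigr do rewrite setTI prob_signed_unit.
  rewrite sumEFin sumr_const card_prod card_ord card_bool -mulr_natr /c.
  by rewrite [(d * 2)%N]mulnC mulVf // pnatr_eq0 muln_eq0 /= -lt0n.
rewrite -(split_sum F mF) -setI_bigcupr -/U (measureDI P mF mU).
rewrite [X in (X + _)%E](_ : _ = 0%E) ?add0e //; apply/eqP; rewrite eq_le measure_ge0 andbT.
have -> : 0%E = P (~` U) by rewrite probability_setC // PU subee.
apply: le_measure; rewrite ?inE; [exact: measurableD|exact: measurableC|].
by move=> w [_ nU].
Qed.

(** The first j steps are prescribed by h. Independence enters the proof through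
    the probabilities of these events only. *)
Definition cyl (h : nat -> 'rV[int]_d) j : set T :=
  \bigcap_(k in [set` [fset k in iota 0 j]%fset]) (xi k @^-1` [set h k]).

Lemma in_cyl h j w : cyl h j w <-> forall k, (k < j)%N -> xi k w = h k.
Proof.
split=> [H k kj|H k /=]; first by apply: H; rewrite /= !inE /= mem_iota.
by rewrite !inE /= mem_iota => /H.
Qed.

Lemma measurable_cyl h j : measurable (cyl h j).
Proof. by apply: fin_bigcap_measurable => // k _; exact: measurable_D. Qed.

Lemma prob_cyl h j : (forall k, (k < j)%N -> unit_step (h k)) ->
  P (cyl h j) = (c ^+ j)%:E.
Proof.
move=> hu; case: xi_steps => _ Hp Hi.
rewrite /cyl (Hi _ (fun k => [set h k])).
rewrite big_seq (eq_bigr (fun=> c%:E)) => [|k]; last first.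
  by rewrite !inE /= mem_iota => /hu kj; rewrite Hp kj.
rewrite -big_seq big_const_seq count_predT.
have -> : size (enum_fset [fset k in iota 0 j]%fset) = j.
  by rewrite -/(#|` _|%fset) card_imfset //= undup_id ?iota_uniq ?size_iota.
by elim: j {hu} => //= j ->; rewrite exprS EFinM.
Qed.

(** The walk is restarted from x at time j, so that the later steps appear in the
    first-step analysis. *)
Definition stays A j k x : set T :=
  [set w | forall m, (m <= k)%N -> A (x + \sum_(i < m) xi (j + i)%N w)].

Lemma stays0 A j x : stays A j 0 x = [set w | A x].
Proof.
apply/seteqP; split => w /=; first by move/(_ 0 isT); rewrite big_ord0 addr0.
by move=> Ax m; rewrite leqn0 => /eqP ->; rewrite big_ord0 addr0.
Qed.

Lemma staysS A j k x : stays A j k.+1 x =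
  [set w | A x /\ stays A j.+1 k (x + xi j w) w].
Proof.
have shift m w : x + \sum_(i < m.+1) xi (j + i)%N w =
    x + xi j w + \sum_(i < m) xi (j.+1 + i)%N w.
  rewrite big_ord_recl addn0 addrA; congr (_ + _).
  by apply: eq_bigr => i _; rewrite addSnnS.
apply/seteqP; split => w /=.
  move=> H; split; first by have := H 0 isT; rewrite big_ord0 addr0.
  by move=> m mk; rewrite -shift; exact: H.
by move=> [Ax H] [|m] mk; rewrite ?big_ord0 ?addr0 // shift; exact: H.
Qed.

Lemma measurable_stays A j k x : measurable (stays A j k x).
Proof.
elim: k j x => [|k IHk] j x.
  rewrite stays0; have [Ax|nAx] := pselect (A x).
    by rewrite (_ : [set _ | _] = setT) //; apply/seteqP; split.
  by rewrite (_ : [set _ | _] = set0) //; apply/seteqP; split.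
have [Ax|nAx] := pselect (A x); last first.
  by rewrite staysS (_ : [set _ | _] = set0) //; apply/seteqP; split => w //= [].
have -> : stays A j k.+1 x = \bigcup_v (D j v `&` stays A j.+1 k (x + v)).
  rewrite staysS; apply/seteqP; split => w /=.
    by move=> [_ H]; exists (xi j w).
  by move=> [v _ [<- H]].
apply: countable_bigcupT_measurable => [|v]; first exact: countableP.
exact: measurableI.
Qed.

(** First-step analysis after a prescribed past: splitting according to the step j
    prolongs the past by one step, so the induction needs every past. *)
Lemma prob_cyl_stays A k j x h : (forall i, (i < j)%N -> unit_step (h i)) ->
  P (cyl h j `&` stays A j k x) = (c ^+ j * stay A k x)%:E.
Proof.
elim: k j x h => [|k IHk] j x h hu.
  rewrite stays0 /=; have [Ax|nAx] := boolP (x \in A).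
    rewrite (_ : [set _ | _] = setT) ?setIT ?prob_cyl ?mulr1 //.
    by apply/seteqP; split => // w _ /=; exact: set_mem.
  rewrite (_ : [set _ | _] = set0) ?setI0 ?measure0 ?mulr0 //.
  by apply/seteqP; split => // w /= /mem_set; rewrite (negbTE nAx).
have [xA|xA] := boolP (x \in A); last first.
  rewrite stay_off // mulr0 staysS (_ : [set _ | _] = set0) ?setI0 ?measure0 //.
  by apply/seteqP; split => // w /= [/mem_set]; rewrite (negbTE xA).
rewrite (prob_split_step j) //; last first.
  by apply: measurableI; [exact: measurable_cyl|exact: measurable_stays].
have piece p : P (cyl h j `&` stays A j k.+1 x `&` D j (signed_unit p)) =
    (c ^+ j.+1 * stay A k (x + signed_unit p))%:E.
  pose h' i := if i == j then signed_unit p else h i.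
  rewrite -(IHk j.+1 (x + signed_unit p) h') => [|i]; last first.
    rewrite ltnS leq_eqVlt /h'; case: eqP => [_ _|_ /= /hu //]; exact: unit_step_signed.
  congr (P _); rewrite staysS; apply/seteqP; split => w /=.
    move=> [[/in_cyl Hc [_ Hs]] Hj]; rewrite /D /= in Hj; rewrite Hj in Hs; split=> //.
    apply/in_cyl => i; rewrite ltnS leq_eqVlt /h'.
    by case: eqP => [-> _|_ /= /Hc].
  move=> [/in_cyl Hc Hs].
  have Hj : xi j w = signed_unit p by have := Hc j (ltnSn j); rewrite /h' eqxx.
  split=> //; split; last by rewrite Hj; split => //; exact: set_mem.
  apply/in_cyl => i ij; have := Hc i (ltnW ij); rewrite /h'.
  by rewrite (ltn_eqF ij).
under eq_bigr do rewrite piece.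
rewrite sumEFin; congr EFin; rewrite -mulr_sumr /= xA exprSr -mulrA /c natrM.
congr (_ * (_ * _)).
rewrite -(pair_big xpredT xpredT (fun i b => stay A k (x + signed_unit (i, b)))) /=.
apply: eq_bigr => i _; rewrite big_bool /signed_unit /=; exact: addrC.
Qed.

Lemma prob_stays A k x : P (stays A 0 k x) = (stay A k x)%:E.
Proof.
have := @prob_cyl_stays A k 0 x (fun=> 0); rewrite expr0 mul1r => <- //.
congr (P _); apply/seteqP; split => w //=; last by case.
by move=> H; split=> //; apply/in_cyl.
Qed.

End WalkEvents.

(** * Expected exit times *)

Section ExpectedExitTime.
Context {R : realType} {disp : measure_display} {T : measurableType disp}.
Variables (P : probability T R) (d : nat) (xi : nat -> T -> 'rV[int]_d).
Hypothesis d_gt0 : (0 < d)%N.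
Hypothesis xi_steps : simple_steps P xi.
Implicit Types (x : 'rV[int]_d) (A : set 'rV[int]_d).

Lemma in_stays A k x w : stays xi A 0 k x w <-> forall j, (j <= k)%N -> A (walk xi x j w).
Proof. by split=> H j jk; have := H j jk. Qed.

(** The exit time is the number of times k such that the walk is in A up to time k. *)
Lemma exit_time_series A x w :
  exit_time xi x A w = (\sum_(0 <= k <oo) (\1_(stays xi A 0 k x) w : R)%:E)%E.
Proof.
pose one k : \bar R := (\1_(stays xi A 0 k x) w : R)%:E.
have one_ge0 k : (0 <= one k)%E by rewrite lee_fin.
have partial K : (forall k, (k < K)%N -> stays xi A 0 k x w) ->
    (K%:R%:E <= \sum_(0 <= k <oo) one k)%E.
  move=> HK; apply: le_trans (nneseries_lim_ge K (fun n _ _ => one_ge0 n)).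
  rewrite big_mkord (eq_bigr (fun=> 1%E)) => [|k _]; last first.
    by rewrite /one indicE mem_set //; exact: HK.
  by rewrite sumEFin sumr_const card_ord.
apply/eqP; rewrite eq_le; apply/andP; split; last first.
  apply: lime_le; first exact: is_cvg_nneseries.
  apply: nearW => K; apply/ereal_infP => _ /= [k nA <-].
  rewrite big_mkord sumEFin lee_fin.
  apply: le_trans (_ : \sum_(i < K) (i < k)%N%:R <= _).
    apply: ler_sum => i _; rewrite indicE; case: ltnP => ik; last first.
      by rewrite memNset // => /in_stays /(_ _ ik).
    by case: (_ \in _).
  rewrite -natr_sum ler_nat.
  suff : (\sum_(i < K) (i < k)%N <= minn K k)%N by move/leq_trans; apply; exact: geq_minr.
  elim: K => [|K]; first by rewrite big_ord0.
  by rewrite big_ord_recr /=; move: (\sum_(i < K) _)%N => s; case: ltnP => Kk; lia.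
have [[k nA]|allA] := pselect (exists k, ~ A (walk xi x k w)); last first.
  have all_stay k : stays xi A 0 k x w.
    by apply/in_stays => j _; apply: contrapT => nA; apply: allA; exists j.
  rewrite (_ : (\sum_(0 <= k <oo) _)%E = +oo%E) ?leey //.
  apply/eqyP => r _; apply: le_trans (partial (Num.trunc r).+1 (fun k _ => all_stay k)).
  by rewrite lee_fin ltW // truncnS_gt.
have exA : exists k, `[< ~ A (walk xi x k w) >] by exists k; apply/asboolP.
case: (ex_minnP exA) => m /asboolP nAm min_m.
apply: le_trans (partial m _).
  by apply: ge_ereal_inf; exists m%:R%:E => //; exists m.
move=> j jm; apply/in_stays => i ij; apply: contrapT => nAi.
have /min_m : `[< ~ A (walk xi x i w) >] by exact/asboolP.
by rewrite leqNgt (leq_ltn_trans ij jm).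
Qed.

Lemma expected_exit_time_series A x :
  expected_exit_time P xi x A = (\sum_(0 <= k <oo) (stay A k x)%:E)%E.
Proof.
rewrite /expected_exit_time; under eq_integral do rewrite exit_time_series.
rewrite integral_nneseries //; last first.
  move=> k; apply/measurable_EFinP; apply: measurable_indic.
  exact: measurable_stays xi_steps _ _ _ _.
apply: eq_eseriesr => k _; rewrite integral_indic ?setIT //.
  exact: prob_stays.
exact: measurable_stays xi_steps _ _ _ _.
Qed.

Lemma expected_exit_time_le A x (b : R) : (forall k, stay_sum A k x <= b) ->
  (expected_exit_time P xi x A <= b%:E)%E.
Proof.
move=> Hb; rewrite expected_exit_time_series; apply: lime_le.
  by apply: is_cvg_nneseries => k _ _; rewrite lee_fin stay_ge0.
by apply: nearW => k; rewrite big_mkord sumEFin lee_fin; exact: Hb.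
Qed.

Lemma expected_exit_time_ge A x k : ((stay_sum A k x)%:E <= expected_exit_time P xi x A)%E.
Proof.
rewrite expected_exit_time_series.
apply: le_trans (nneseries_lim_ge k _); first by rewrite big_mkord sumEFin.
by move=> n _ _; rewrite lee_fin stay_ge0.
Qed.

(** The loss rho^2/k in [stay_sum_ge] vanishes as k grows. *)
Lemma expected_exit_time_ge_sqr A (rho : R) :
  (forall z, z \notin A -> rho <= \sum_i (z ord0 i)%:~R ^+ 2) -> 0 <= rho ->
  (rho%:E <= expected_exit_time P xi 0 A)%E.
Proof.
move=> A_out rho0; apply/lee_subgt0Pr => e e0.
pose k := (Num.trunc (rho ^+ 2 / e)).+1.
have k0 : 0 < k%:R :> R by rewrite ltr0n.
apply: le_trans (expected_exit_time_ge A 0 k); rewrite -EFinB lee_fin.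
apply: le_trans (stay_sum_ge d_gt0 A_out rho0 _) => //.
rewrite lerB // ler_pdivrMr // mulrC -ler_pdivrMr //.
by rewrite ltW // truncnS_gt.
Qed.

End ExpectedExitTime.

Lemma sqr_enorm (R : realType) d (z : 'rV[int]_d) :
  enorm (map_mx intr z : 'rV[R]_d) ^+ 2 = \sum_i (z ord0 i)%:~R ^+ 2.
Proof.
rewrite /enorm sqr_sqrtr; first by apply: eq_bigr => i _; rewrite mxE.
by apply: sumr_ge0 => i _; rewrite sqr_ge0.
Qed.

Lemma lattice_ball_out (R : realType) d n (z : 'rV[int]_d) : (0 < d)%N ->
  z \notin lattice_ball R d n ->
  (nroot d n%:R / nroot d (omega R d)) ^+ 2 <= \sum_i (z ord0 i)%:~R ^+ 2.
Proof.
move=> d0; rewrite notin_setE /lattice_ball /= => /negP; rewrite -leNgt => out.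
rewrite -sqr_enorm; have enorm0 : 0 <= enorm (map_mx intr z : 'rV[R]_d) by exact: sqrtr_ge0.
have om0 := @omega_gt0 R d.
have q0 : 0 <= nroot d n%:R / nroot d (omega R d) by rewrite divr_ge0 ?nroot_ge0.
rewrite ler_pXn2r // -(@ler_pXn2r _ d) ?nnegrE // expr_div_n !nrootKd ?(ltW om0) //.
by rewrite ler_pdivrMr // mulrC.
Qed.

Theorem theorem1p2 (R : realType) (d : nat) (hd : (1 <= d)%N) :
  exists2 eps0 : R, 0 < eps0 & forall eps : R, 0 < eps < eps0 ->
  exists2 C : R, 0 <= C &
  forall (disp : measure_display) (T : measurableType disp)
    (P : probability T R) (xi : nat -> T -> 'rV[int]_d),
    simple_steps P xi ->
  forall (n : nat) (A : {fset 'rV[int]_d}) (x : 'rV[int]_d),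
    x \in A -> #|` A|%fset = n ->
    (expected_exit_time P xi x [set` A] <=
     expected_exit_time P xi 0 (lattice_ball R d n)
       * (1 + C * n%:R `^ (- eps))%:E)%E.
Proof.
(* The error r^(-1/(d+6)) is n^(-1/(d(d+6))), as r is the d-th root of n. *)
exists (error_exponent d / d%:R).
  by rewrite divr_gt0 ?invr_gt0 ?ltr0n // addnC.
move=> eps /andP[eps0 eps_lt].
exists (error_constant d); first exact: error_constant_ge0.
move=> disp T P xi xi_steps n A x xA An.
have n0 : (0 < n)%N by rewrite -An cardfs_gt0; apply/fset0Pn; exists x.
have n1 : 1 <= n%:R :> R by rewrite ler1n.
have C0 : 0 <= error_constant d :> R by exact: error_constant_ge0.
pose r : R := nroot d n%:R; pose om := nroot d (omega R d).
have upper : (expected_exit_time P xi x [set` A] <=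
    (r ^+ 2 / om ^+ 2 * (1 + error_constant d * n%:R `^ (- eps)))%:E)%E.
  apply: expected_exit_time_le => // k.
  apply: le_trans (lattice_torsion_sharp hd (lattice_torsion_stay_sum A k) x) _.
  rewrite An -/r -/om.
  rewrite ler_wpM2l ?divr_ge0 ?sqr_ge0 // lerD2l ler_wpM2l //.
  rewrite /r /nroot -powRrM; apply: ler_powR => //.
  by rewrite mulrN lerN2 mulrC ltW.
apply: le_trans upper _; rewrite EFinM.
apply: lee_wpmul2r; first by rewrite lee_fin addr_ge0 // mulr_ge0 // powR_ge0.
rewrite -expr_div_n; apply: expected_exit_time_ge_sqr => //; last exact: sqr_ge0.
by move=> z; exact: lattice_ball_out.
Qed.
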